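(* Let $H^2_{\beta}$ be a weighted Hardy space of polynomial growth. Let $\varphi:\overline{\mathbb{D}}\rightarrow\overline{\mathbb{D}}$ be an analytic map. Then the composition operator $C_{\varphi}$ acting on $H^2_{\beta}$ is Fredholm if and only if $\varphi$ is a disk automorphism.
   Context: $\mathbb{D}$ is the open unit disk. ''Analytic on $\overline{\mathbb{D}}$'' means analytic on a neighborhood of the closed disk. Let $w=\{w_k\}_{k\ge1}$ be a sequence of positive numbers with $w_k\to1$, and put $\beta_0=1$, $\beta_k=\prod_{j=1}^k w_j$. The weighted Hardy space $H^2_\beta$ is the Hilbert space of analytic functions $f(z)=\sum_{k\ge0}\widehat f(k)z^k$ on $\mathbb{D}$ with $\|f\|_{H^2_\beta}^2=\sum_{k\ge0}|\widehat f(k)|^2\beta_k^2<\infty$. It is of polynomial growth if $\sup_k (k+1)|w_k-1|<\infty$. Composition operators $C_\varphi f=f\circ\varphi$ are defined for analytic self-maps $\varphi$ of $\mathbb{D}$ (so $\varphi(\mathbb{D})\subseteq\mathbb{D}$); it is known that $C_\varphi$ is bounded on such $H^2_\beta$ when $\varphi$ is moreover analytic on $\overline{\mathbb{D}}$. A bounded operator $T$ on a Hilbert space is Fredholm if it has closed range and both $\dim\ker T<\infty$ and $\dim\ker T^*<\infty$. A disk automorphism is an analytic bijection $\mathbb{D}\to\mathbb{D}$. *)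

(* Defs.v *)
From Stdlib Require Import Reals FunctionalExtensionality.
From Coquelicot Require Import Coquelicot.
Open Scope R_scope.

(** * Operators on a Hilbert space

    The Hilbert space is given as a linear subspace [H] of an ambient complex
    vector space [V], with an inner product [ip] (linear in the first argument)
    that is only meaningful on [H].  Operators are maps on [V] that are only
    looked at on [H]. *)

Definition ip_norm {V : ModuleSpace C_Ring} (ip : V -> V -> C) (x : V) : R :=
  sqrt (Re (ip x x)).

Definition bounded_operator {V : ModuleSpace C_Ring} (H : V -> Prop)
    (ip : V -> V -> C) (T : V -> V) : Prop :=
  (forall x, H x -> H (T x)) /\
  (forall x y, H x -> H y -> T (plus x y) = plus (T x) (T y)) /\
  (forall (c : C) x, H x -> T (scal c x) = scal c (T x)) /\
  (exists M : R, forall x, H x -> ip_norm ip (T x) <= M * ip_norm ip x).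

Definition kernel {V : ModuleSpace C_Ring} (H : V -> Prop) (T : V -> V) :
    V -> Prop :=
  fun x => H x /\ T x = zero.

(* The spanning family has [n + 1] members, which may be zero or repeated. *)
Definition finite_dimensional {V : ModuleSpace C_Ring} (E : V -> Prop) : Prop :=
  exists (n : nat) (e : nat -> V),
    (forall i, (i <= n)%nat -> E (e i)) /\
    (forall x, E x -> exists c : nat -> C, x = sum_n (fun i => scal (c i) (e i)) n).

Definition closed_range {V : ModuleSpace C_Ring} (H : V -> Prop)
    (ip : V -> V -> C) (T : V -> V) : Prop :=
  forall y, H y ->
    (forall eps : R, 0 < eps -> exists x, H x /\ ip_norm ip (minus (T x) y) < eps) ->
    exists x, H x /\ T x = y.

(* [S] is the Hilbert space adjoint of [T]; it is determined on [H] by [T]. *)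
Definition is_adjoint {V : ModuleSpace C_Ring} (H : V -> Prop)
    (ip : V -> V -> C) (T S : V -> V) : Prop :=
  bounded_operator H ip S /\
  forall x y, H x -> H y -> ip (T x) y = ip x (S y).

Definition Fredholm {V : ModuleSpace C_Ring} (H : V -> Prop)
    (ip : V -> V -> C) (T : V -> V) : Prop :=
  bounded_operator H ip T /\
  closed_range H ip T /\
  finite_dimensional (kernel H T) /\
  exists S : V -> V, is_adjoint H ip T S /\ finite_dimensional (kernel H S).

(** * Functions on the open unit disk *)

Definition disk : Type := {z : C | Cmod z < 1}.

Definition disk_val (z : disk) : C := proj1_sig z.
Coercion disk_val : disk >-> C.

(* Complex functions on the disk, with pointwise operations. *)
Definition disk_fun_AbelianMonoid_mixin : AbelianMonoid.mixin_of (disk -> C).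
Proof.
  apply (AbelianMonoid.Mixin (disk -> C)
    (fun f g z => Cplus (f z) (g z)) (fun _ => RtoC 0));
    intros; apply functional_extensionality; intro.
  - apply Cplus_comm.
  - apply Cplus_assoc.
  - apply Cplus_0_r.
Defined.

Canonical disk_fun_AbelianMonoid :=
  AbelianMonoid.Pack (disk -> C) disk_fun_AbelianMonoid_mixin (disk -> C).

Definition disk_fun_AbelianGroup_mixin :
  AbelianGroup.mixin_of disk_fun_AbelianMonoid.
Proof.
  apply (AbelianGroup.Mixin disk_fun_AbelianMonoid (fun f z => Copp (f z))).
  intros f; apply functional_extensionality; intros z; apply Cplus_opp_r.
Defined.

Canonical disk_fun_AbelianGroup :=
  AbelianGroup.Pack (disk -> C)
    (AbelianGroup.Class _ disk_fun_AbelianMonoid_mixin disk_fun_AbelianGroup_mixin)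
    (disk -> C).

Definition disk_fun_ModuleSpace_mixin :
  ModuleSpace.mixin_of C_Ring disk_fun_AbelianGroup.
Proof.
  apply (ModuleSpace.Mixin C_Ring disk_fun_AbelianGroup
    (fun (c : C) f z => Cmult c (f z)));
    intros; apply functional_extensionality; intro.
  - apply Cmult_assoc.
  - apply Cmult_1_l.
  - apply Cmult_plus_distr_l.
  - apply Cmult_plus_distr_r.
Defined.

Canonical disk_fun_ModuleSpace :=
  ModuleSpace.Pack C_Ring (disk -> C)
    (ModuleSpace.Class C_Ring _ _ disk_fun_ModuleSpace_mixin) (disk -> C).

Definition disk_expansion (f : disk -> C) (a : nat -> C) : Prop :=
  forall z : disk, is_pseries a (z : C) (f z).

(* The [k]-th Taylor coefficient at [0] of a function with a power series
   expansion on the disk; the expansion is unique, so [iota] picks the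
   only candidate.  The value is irrelevant for other functions. *)
Definition taylor_coeff (f : disk -> C) (k : nat) : C :=
  iota (T := C_CompleteNormedModule)
    (fun c : C => exists a, disk_expansion f a /\ a k = c).

(** * Weighted Hardy spaces *)

(* [w 0] is never used. *)
Fixpoint beta (w : nat -> R) (k : nat) : R :=
  match k with
  | O => 1
  | S j => beta w j * w (S j)
  end.

Definition Hardy_weight (w : nat -> R) : Prop :=
  (forall k, (1 <= k)%nat -> 0 < w k) /\ is_lim_seq w 1.

Definition polynomial_growth (w : nat -> R) : Prop :=
  exists M : R, forall k, (1 <= k)%nat -> (INR k + 1) * Rabs (w k - 1) <= M.

Definition H2 (w : nat -> R) (f : disk -> C) : Prop :=
  exists a : nat -> C,
    disk_expansion f a /\ ex_series (fun k => (Cmod (a k))^2 * (beta w k)^2).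

Definition C_Series (u : nat -> C) : C :=
  (Series (fun k => Re (u k)), Series (fun k => Im (u k))).

Definition H2_ip (w : nat -> R) (f g : disk -> C) : C :=
  C_Series (fun k =>
    (taylor_coeff f k * Cconj (taylor_coeff g k) * RtoC ((beta w k)^2))%C).

Lemma H2_norm_eq (w : nat -> R) (f : disk -> C) :
  ip_norm (H2_ip w) f =
  sqrt (Series (fun k => (Cmod (taylor_coeff f k))^2 * (beta w k)^2)).
Proof.
  unfold ip_norm, H2_ip, C_Series.
  apply (f_equal sqrt), Series_ext; intros k.
  rewrite <- Cmod2_conj, <- RtoC_mult; reflexivity.
Qed.

(** * Analytic maps and composition operators *)

Definition analytic_at (f : C -> C) (z : C) : Prop :=
  exists (a : nat -> C) (r : R), 0 < r /\
    forall h : C, Cmod h < r -> is_pseries a h (f (z + h)%C).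

Definition analytic_on (f : C -> C) (U : C -> Prop) : Prop :=
  forall z, U z -> analytic_at f z.

Definition analytic_on_closed_disk (f : C -> C) : Prop :=
  exists U : C -> Prop,
    open U /\ (forall z, Cmod z <= 1 -> U z) /\ analytic_on f U.

Definition disk_restriction (phi : C -> C)
    (hphi : forall z, Cmod z < 1 -> Cmod (phi z) < 1) : disk -> disk :=
  fun z => exist (fun u : C => Cmod u < 1) (phi z) (hphi z (proj2_sig z)).

Definition composition_operator (psi : disk -> disk) (f : disk -> C) : disk -> C :=
  fun z => f (psi z).

Definition disk_automorphism (phi : C -> C) : Prop :=
  analytic_on phi (fun z => Cmod z < 1) /\
  (forall z, Cmod z < 1 -> Cmod (phi z) < 1) /\
  (forall z1 z2, Cmod z1 < 1 -> Cmod z2 < 1 -> phi z1 = phi z2 -> z1 = z2) /\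
  (forall u, Cmod u < 1 -> exists z, Cmod z < 1 /\ phi z = u).

(* Main.v *)
Require Import Defs.
From Stdlib Require Import Reals Arith Lra Lia Psatz.
From Stdlib Require Import FunctionalExtensionality Classical ClassicalEpsilon.
From Coquelicot Require Import Coquelicot.
Open Scope R_scope.

(** If [C_phi] is Fredholm with adjoint [T'], then every collision
    [phi a = phi b] would, by the open mapping theorem, come with infinitely many
    disjoint ones, and the differences [K_a - K_b] of reproducing kernels would
    span an infinite-dimensional part of [ker T']; hence [phi] is injective.  If
    [|phi zeta| < 1] at some [|zeta| = 1], then all functions in the range extend
    analytically across [zeta]; but the range and [ker T'] together span the
    space, so some nontrivial combination of the functions
    [sum_k (k + 1)^(-p - i) (conj zeta z)^k] lies in the range, although one of its
    derivatives blows up at [zeta].  So [|phi| = 1] on the circle, and the minimum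
    modulus principle applied to [(phi - u) / (1 - conj u phi)] gives surjectivity.

    Conversely an automorphism is [z |-> c1 tau_s (c2 z)] with
    [tau_s z = (z + s) / (1 + s z)], and its inverse has the same form, so it
    suffices that [C_(tau_s)] is bounded.  The functions [f o tau_s] solve the
    transport equation [(1 - s^2) du/ds = (1 - z^2) du/dz], in coefficients
    [(1 - s^2) u_k' = (k + 1) u_(k+1) - (k - 1) u_(k-1)].  In the derivative of the
    energy [sum_k u_k^2 beta_k^2] the term [u_k u_(k+1)] has the factor
    [(k + 1) beta_k^2 - k beta_(k+1)^2], which polynomial growth bounds by a
    multiple of [beta_k beta_(k+1)], and Gronwall's inequality concludes. *)

(** * Finite sums and complex series *)

(** Analyticity means a local power series expansion, and no contour integral occurs. Stability
    under composition is proved by rearranging a double series; products, inverses and Blaschke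
    quotients are derived from it. The maximum principle is replaced by the minimum modulus
    principle for zero-free functions, which needs only leading terms of expansions and compactness.
    Applied to both [g] and [/ g], it shows that a zero-free function of modulus one on the circle
    is constant. This yields the form of an automorphism after division by a power of the Blaschke
    factor at its zero, and injectivity forces that power to be one. The energy is estimated on
    truncations [k <= j], because neither finiteness of the full sum nor differentiation under it is
    known beforehand. Truncation leaves boundary terms with a factor [j]; for combinations of
    finitely many powers [tau_s ^ n] the coefficients decay geometrically, so these terms vanish as
    [j] grows. The resulting bound does not depend on the number of powers and therefore passes from
    polynomials to the whole space. *)

Fixpoint Rsum (u : nat -> R) (n : nat) : R :=
  match n with O => 0 | S n => Rsum u n + u n end.

Fixpoint Csum (u : nat -> C) (n : nat) : C :=
  match n with O => RtoC 0 | S n => (Csum u n + u n)%C end.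

Lemma Rsum_ext (u v : nat -> R) (n : nat) :
  (forall k, (k < n)%nat -> u k = v k) -> Rsum u n = Rsum v n.
Proof.
  induction n as [|n IH]; simpl; intros H; [reflexivity|].
  rewrite IH, H by auto with arith; reflexivity.
Qed.

Lemma Csum_ext (u v : nat -> C) (n : nat) :
  (forall k, (k < n)%nat -> u k = v k) -> Csum u n = Csum v n.
Proof.
  induction n as [|n IH]; simpl; intros H; [reflexivity|].
  rewrite IH, H by auto with arith; reflexivity.
Qed.

Lemma Rsum_plus (u v : nat -> R) (n : nat) :
  Rsum (fun k => u k + v k) n = Rsum u n + Rsum v n.
Proof. induction n as [|n IH]; simpl; [ring|rewrite IH; ring]. Qed.

Lemma Rsum_scal (c : R) (u : nat -> R) (n : nat) :
  Rsum (fun k => c * u k) n = c * Rsum u n.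
Proof. induction n as [|n IH]; simpl; [ring|rewrite IH; ring]. Qed.

Lemma Csum_plus (u v : nat -> C) (n : nat) :
  Csum (fun k => u k + v k)%C n = (Csum u n + Csum v n)%C.
Proof. induction n as [|n IH]; simpl; [ring|rewrite IH; ring]. Qed.

Lemma Csum_minus (u v : nat -> C) (n : nat) :
  Csum (fun k => u k - v k)%C n = (Csum u n - Csum v n)%C.
Proof. induction n as [|n IH]; simpl; [ring|rewrite IH; ring]. Qed.

Lemma Csum_scal (c : C) (u : nat -> C) (n : nat) :
  Csum (fun k => c * u k)%C n = (c * Csum u n)%C.
Proof. induction n as [|n IH]; simpl; [ring|rewrite IH; ring]. Qed.

Lemma Csum_zero (n : nat) : Csum (fun _ => RtoC 0) n = 0.
Proof. induction n as [|n IH]; simpl; [reflexivity|rewrite IH; ring]. Qed.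

Lemma Rsum_le (u v : nat -> R) (n : nat) :
  (forall k, (k < n)%nat -> u k <= v k) -> Rsum u n <= Rsum v n.
Proof.
  induction n as [|n IH]; simpl; intros H; [lra|].
  apply Rplus_le_compat; auto with arith.
Qed.

Lemma Rsum_nonneg (u : nat -> R) (n : nat) :
  (forall k, 0 <= u k) -> 0 <= Rsum u n.
Proof.
  intros H; induction n as [|n IH]; simpl; [lra|specialize (H n); lra].
Qed.

Lemma Rsum_mono (u : nat -> R) (m n : nat) :
  (forall k, 0 <= u k) -> (m <= n)%nat -> Rsum u m <= Rsum u n.
Proof.
  intros H; induction 1 as [|n _ IH]; simpl; [lra|specialize (H n); lra].
Qed.

Lemma Rsum_split (u : nat -> R) (m n : nat) :
  Rsum u (m + n) = Rsum u m + Rsum (fun k => u (m + k)%nat) n.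
Proof.
  induction n as [|n IH]; simpl.
  - rewrite Nat.add_0_r; ring.
  - rewrite Nat.add_succ_r; simpl; rewrite IH; ring.
Qed.

Lemma Csum_split (u : nat -> C) (m n : nat) :
  Csum u (m + n) = (Csum u m + Csum (fun k => u (m + k)%nat) n)%C.
Proof.
  induction n as [|n IH]; simpl.
  - rewrite Nat.add_0_r; ring.
  - rewrite Nat.add_succ_r; simpl; rewrite IH; ring.
Qed.

Lemma Csum_swap (u : nat -> nat -> C) (m n : nat) :
  Csum (fun i => Csum (u i) n) m = Csum (fun j => Csum (fun i => u i j) m) n.
Proof.
  induction m as [|m IH]; simpl.
  - now rewrite Csum_zero.
  - now rewrite IH, Csum_plus.
Qed.

Lemma Cmod_Csum (u : nat -> C) (n : nat) :
  Cmod (Csum u n) <= Rsum (fun k => Cmod (u k)) n.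
Proof.
  induction n as [|n IH]; simpl; [rewrite Cmod_0; lra|].
  eapply Rle_trans; [apply Cmod_triangle|lra].
Qed.

Lemma Re_Csum (u : nat -> C) (n : nat) : Re (Csum u n) = Rsum (fun k => Re (u k)) n.
Proof. induction n as [|n IH]; simpl; [reflexivity|rewrite <- IH; apply re_plus]. Qed.

Lemma Im_Csum (u : nat -> C) (n : nat) : Im (Csum u n) = Rsum (fun k => Im (u k)) n.
Proof. induction n as [|n IH]; simpl; [reflexivity|rewrite <- IH; apply im_plus]. Qed.

Lemma sum_n_Rsum (u : nat -> R) (n : nat) : sum_n u n = Rsum u (S n).
Proof.
  induction n as [|n IH]; [rewrite sum_O; simpl; ring|].
  rewrite sum_Sn, IH; reflexivity.
Qed.

Lemma sum_n_Csum (u : nat -> C) (n : nat) : sum_n u n = Csum u (S n).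
Proof.
  induction n as [|n IH]; [rewrite sum_O; simpl; ring|].
  rewrite sum_Sn, IH; reflexivity.
Qed.

Lemma sum_f_R0_Rsum (u : nat -> R) (n : nat) : sum_f_R0 u n = Rsum u (S n).
Proof. rewrite <- sum_n_Rsum; symmetry; apply sum_n_Reals. Qed.

Lemma is_series_Rsum (u : nat -> R) (l : R) :
  is_series u l <-> is_lim_seq (Rsum u) l.
Proof.
  rewrite (is_lim_seq_incr_1 (Rsum u)).
  split; intros H.
  - apply (is_lim_seq_ext (sum_n u)); [apply sum_n_Rsum|exact H].
  - apply (is_lim_seq_ext _ (sum_n u)) in H; [exact H|].
    intros n; symmetry; apply sum_n_Rsum.
Qed.

Lemma series_of_bounded (u : nat -> R) (M : R) :
  (forall k, 0 <= u k) -> (forall n, Rsum u n <= M) ->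
  ex_series u /\ Series u <= M.
Proof.
  intros Hu HM.
  destruct (ex_finite_lim_seq_incr (Rsum u) M) as [l Hl]; trivial.
  { intros n; apply Rsum_mono; auto. }
  assert (is_series u l) by (now apply is_series_Rsum).
  split; [exists l; trivial|].
  rewrite (is_series_unique u l) by trivial.
  exact (is_lim_seq_le _ _ (Finite l) (Finite M) HM Hl (is_lim_seq_const M)).
Qed.

Lemma Rsum_le_Series (u : nat -> R) (n : nat) :
  (forall k, 0 <= u k) -> ex_series u -> Rsum u n <= Series u.
Proof.
  intros Hu Hex; apply Series_correct, is_series_Rsum in Hex.
  apply (is_lim_seq_incr_compare (Rsum u)); trivial.
  intros k; apply Rsum_mono; auto.
Qed.

Lemma series_tail (u : nat -> R) (eps : R) :
  (forall k, 0 <= u k) -> ex_series u -> 0 < eps ->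
  exists N, forall m n, (N <= m)%nat -> Rsum (fun k => u (m + k)%nat) n <= eps.
Proof.
  intros Hu Hex He.
  pose proof (proj1 (is_series_Rsum u _) (Series_correct u Hex)) as Hl.
  apply is_lim_seq_spec in Hl; destruct (Hl (mkposreal eps He)) as [N HN].
  exists N; intros m n Hm; specialize (HN m Hm); simpl in HN.
  apply Rabs_def2 in HN.
  pose proof (Rsum_le_Series u (m + n) Hu Hex) as H.
  rewrite Rsum_split in H; lra.
Qed.

Lemma Rsum_geom_le (q : R) (n : nat) :
  0 <= q < 1 -> Rsum (fun k => q ^ k) n <= / (1 - q).
Proof.
  intros Hq.
  assert (E : Rsum (fun k => q ^ k) n * (1 - q) = 1 - q ^ n).
  { induction n as [|n IH]; simpl; [ring|].
    rewrite Rmult_plus_distr_r, IH; ring. }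
  assert (0 <= q ^ n) by (apply pow_le; lra).
  apply (Rmult_le_reg_r (1 - q)); [lra|].
  rewrite E, Rinv_l; lra.
Qed.

(** * Convergence of complex series *)

Definition cser (u : nat -> C) (l : C) : Prop :=
  forall eps, 0 < eps ->
    exists N, forall n, (N <= n)%nat -> Cmod (Csum u n - l) < eps.

Lemma Cmod_minus_sym (x y : C) : Cmod (x - y) = Cmod (y - x).
Proof. rewrite <- Cmod_opp; f_equal; ring. Qed.

Lemma Cmod_triangle3 (x y z : C) : Cmod (x - z) <= Cmod (x - y) + Cmod (y - z).
Proof.
  replace (x - z)%C with ((x - y) + (y - z))%C by ring; apply Cmod_triangle.
Qed.

Lemma Cmod_rev_triangle (x y : C) : Cmod x - Cmod y <= Cmod (x - y).
Proof.
  replace x with ((x - y) + y)%C at 1 by ring.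
  pose proof (Cmod_triangle (x - y) y); lra.
Qed.

Lemma Cmod_small_eq (x y : C) : (forall eps, 0 < eps -> Cmod (x - y) < eps) -> x = y.
Proof.
  intros H; apply Ceq_minus, Cmod_eq_0.
  destruct (Rle_lt_or_eq_dec _ _ (Cmod_ge_0 (x - y))) as [Hp|]; [|auto].
  specialize (H _ Hp); lra.
Qed.

Lemma cser_unique (u : nat -> C) (l l' : C) : cser u l -> cser u l' -> l = l'.
Proof.
  intros H H'; apply Cmod_small_eq; intros eps He.
  destruct (H (eps / 2)) as [N HN]; [lra|].
  destruct (H' (eps / 2)) as [N' HN']; [lra|].
  specialize (HN (N + N')%nat); specialize (HN' (N + N')%nat).
  pose proof (Cmod_triangle3 l (Csum u (N + N')) l').
  rewrite (Cmod_minus_sym l (Csum u (N + N'))) in H0.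
  assert (Cmod (Csum u (N + N') - l) < eps / 2) by (apply HN; lia).
  assert (Cmod (Csum u (N + N') - l') < eps / 2) by (apply HN'; lia).
  lra.
Qed.

Lemma cser_ext (u v : nat -> C) (l : C) :
  (forall k, u k = v k) -> cser u l -> cser v l.
Proof.
  intros H Hu eps He; destruct (Hu eps He) as [N HN]; exists N; intros n Hn.
  rewrite <- (Csum_ext u v); auto.
Qed.

Lemma cser_plus (u v : nat -> C) (l m : C) :
  cser u l -> cser v m -> cser (fun k => u k + v k)%C (l + m)%C.
Proof.
  intros H H' eps He.
  destruct (H (eps / 2)) as [N HN]; [lra|].
  destruct (H' (eps / 2)) as [N' HN']; [lra|].
  exists (N + N')%nat; intros n Hn; rewrite Csum_plus.
  replace (Csum u n + Csum v n - (l + m))%C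
    with ((Csum u n - l) + (Csum v n - m))%C by ring.
  eapply Rle_lt_trans; [apply Cmod_triangle|].
  specialize (HN n ltac:(lia)); specialize (HN' n ltac:(lia)); lra.
Qed.

Lemma cser_scal (c : C) (u : nat -> C) (l : C) :
  cser u l -> cser (fun k => c * u k)%C (c * l)%C.
Proof.
  intros H eps He.
  pose proof (Cmod_ge_0 c).
  destruct (H (eps / (Cmod c + 1))) as [N HN].
  { apply Rdiv_lt_0_compat; lra. }
  exists N; intros n Hn; rewrite Csum_scal.
  replace (c * Csum u n - c * l)%C with (c * (Csum u n - l))%C by ring.
  rewrite Cmod_mult; specialize (HN n Hn).
  apply (Rmult_lt_compat_r (Cmod c + 1)) in HN; [|lra].
  unfold Rdiv in HN; rewrite Rmult_assoc, Rinv_l in HN by lra.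
  pose proof (Cmod_ge_0 (Csum u n - l)); lra.
Qed.

Lemma cser_shift (u : nat -> C) (l : C) (m : nat) :
  cser u l <-> cser (fun k => u (m + k)%nat) (l - Csum u m)%C.
Proof.
  split; intros H eps He; destruct (H eps He) as [N HN].
  - exists N; intros n Hn; specialize (HN (m + n)%nat ltac:(lia)).
    rewrite Csum_split in HN.
    replace (Csum (fun k => u (m + k)%nat) n - (l - Csum u m))%C
      with (Csum u m + Csum (fun k => u (m + k)%nat) n - l)%C by ring.
    exact HN.
  - exists (m + N)%nat; intros n Hn; specialize (HN (n - m)%nat ltac:(lia)).
    replace n with (m + (n - m))%nat by lia; rewrite Csum_split.
    replace (Csum u m + Csum (fun k => u (m + k)%nat) (n - m) - l)%C
      with (Csum (fun k => u (m + k)%nat) (n - m) - (l - Csum u m))%C by ring.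
    exact HN.
Qed.

Lemma cser_finite (u : nat -> C) (n : nat) :
  (forall k, (n <= k)%nat -> u k = 0) -> cser u (Csum u n).
Proof.
  intros H; apply (cser_shift u (Csum u n) n).
  intros eps He; exists O; intros m _.
  rewrite (Csum_ext _ (fun _ => RtoC 0)) by (intros; apply H; lia).
  rewrite Csum_zero; replace (0 - (Csum u n - Csum u n))%C with (RtoC 0) by ring.
  now rewrite Cmod_0.
Qed.

Lemma cser_zero (u : nat -> C) : (forall k, u k = 0) -> cser u 0.
Proof. intros H; exact (cser_finite u 0 (fun k _ => H k)). Qed.

Lemma cser_mod_le (u : nat -> C) (l : C) (M : R) :
  cser u l -> (forall n, Cmod (Csum u n) <= M) -> Cmod l <= M.
Proof.
  intros H HM; apply Rnot_lt_le; intros Hlt.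
  destruct (H (Cmod l - M)) as [N HN]; [lra|].
  specialize (HN N (le_n _)); specialize (HM N).
  rewrite Cmod_minus_sym in HN.
  pose proof (Cmod_rev_triangle l (Csum u N)); lra.
Qed.

Lemma cser_terms_bounded (u : nat -> C) (l : C) :
  cser u l -> exists M, 0 <= M /\ forall k, Cmod (u k) <= M.
Proof.
  intros H; destruct (H 1 Rlt_0_1) as [N HN].
  assert (forall n, exists M, 0 <= M /\ forall k, (k < n)%nat -> Cmod (u k) <= M) as HF.
  { induction n as [|n [M [HM IH]]].
    - exists 0; split; [lra|intros; lia].
    - exists (M + Cmod (u n)); pose proof (Cmod_ge_0 (u n)); split; [lra|].
      intros k Hk; destruct (Nat.eq_dec k n) as [->|]; [lra|].
      specialize (IH k ltac:(lia)); lra. }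
  destruct (HF N) as [M [HM0 HM]].
  exists (M + 2); split; [lra|]; intros k.
  destruct (Nat.lt_ge_cases k N) as [Hk|Hk]; [specialize (HM k Hk); lra|].
  replace (u k) with ((Csum u (S k) - l) - (Csum u k - l))%C by (simpl; ring).
  pose proof (Cmod_triangle (Csum u (S k) - l) (- (Csum u k - l))).
  rewrite Cmod_opp in H0; unfold Cminus at 1.
  pose proof (HN k Hk); pose proof (HN (S k) ltac:(lia)); lra.
Qed.

Lemma re_minus (x y : C) : Re (x - y) = Re x - Re y.
Proof. unfold Cminus; rewrite re_plus, re_opp; ring. Qed.

Lemma im_minus (x y : C) : Im (x - y) = Im x - Im y.
Proof. unfold Cminus; rewrite im_plus, im_opp; ring. Qed.

Lemma cser_Re (u : nat -> C) (l : C) : cser u l -> is_series (fun k => Re (u k)) (Re l).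
Proof.
  intros H; apply is_series_Rsum, is_lim_seq_spec; intros eps.
  destruct (H eps (cond_pos eps)) as [N HN]; exists N; intros n Hn.
  rewrite <- Re_Csum; eapply Rle_lt_trans; [|apply (HN n Hn)].
  rewrite <- re_minus; apply re_le_Cmod.
Qed.

Lemma im_le_Cmod (z : C) : Rabs (Im z) <= Cmod z.
Proof.
  unfold Cmod; rewrite <- sqrt_Rsqr_abs; apply sqrt_le_1_alt.
  unfold Rsqr, Im; pose proof (pow2_ge_0 (fst z)); simpl in *; lra.
Qed.

Lemma Cmod_le_Re_Im (z : C) : Cmod z <= Rabs (Re z) + Rabs (Im z).
Proof.
  pose proof (Rabs_pos (Re z)); pose proof (Rabs_pos (Im z)).
  apply Rsqr_incr_0_var; [|lra].
  unfold Rsqr; replace (Cmod z * Cmod z) with (Cmod z ^ 2) by ring.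
  rewrite Cmod2_alt, <- (pow2_abs (Re z)), <- (pow2_abs (Im z)); nra.
Qed.

Lemma cser_Im (u : nat -> C) (l : C) : cser u l -> is_series (fun k => Im (u k)) (Im l).
Proof.
  intros H; apply is_series_Rsum, is_lim_seq_spec; intros eps.
  destruct (H eps (cond_pos eps)) as [N HN]; exists N; intros n Hn.
  rewrite <- Im_Csum; eapply Rle_lt_trans; [|apply (HN n Hn)].
  rewrite <- im_minus; apply im_le_Cmod.
Qed.

Lemma ex_series_dominated (u v : nat -> R) :
  (forall k, Rabs (u k) <= v k) -> ex_series v -> ex_series u.
Proof.
  exact (ex_series_le (K := R_AbsRing) (V := R_CompleteNormedModule) u v).
Qed.

Lemma ex_series_abs_Re_Im (u : nat -> C) : ex_series (fun k => Cmod (u k)) ->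
  ex_series (fun k => Rabs (Re (u k))) /\ ex_series (fun k => Rabs (Im (u k))).
Proof.
  intros H; split; apply (ex_series_dominated _ (fun k => Cmod (u k))); trivial; intros k;
    rewrite Rabs_Rabsolu; [apply re_le_Cmod|apply im_le_Cmod].
Qed.

Lemma cser_Re_Im (u : nat -> C) (l : C) :
  is_series (fun k => Re (u k)) (Re l) -> is_series (fun k => Im (u k)) (Im l) ->
  cser u l.
Proof.
  intros HR HI eps He.
  apply is_series_Rsum, is_lim_seq_spec in HR.
  apply is_series_Rsum, is_lim_seq_spec in HI.
  assert (He2 : 0 < eps / 2) by lra.
  destruct (HR (mkposreal _ He2)) as [N HN], (HI (mkposreal _ He2)) as [N' HN'].
  exists (N + N')%nat; intros n Hn.
  specialize (HN n ltac:(lia)); specialize (HN' n ltac:(lia)); simpl in HN, HN'.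
  rewrite <- Re_Csum in HN; rewrite <- Im_Csum in HN'.
  eapply Rle_lt_trans; [apply Cmod_le_Re_Im|].
  rewrite re_minus, im_minus; lra.
Qed.

Lemma cser_C_Series (u : nat -> C) (l : C) : cser u l -> C_Series u = l.
Proof.
  intros H; unfold C_Series.
  rewrite (is_series_unique _ _ (cser_Re u l H)), (is_series_unique _ _ (cser_Im u l H)).
  destruct l; reflexivity.
Qed.

(** Naming the limit as [C_Series u] turns sums into total functions of their terms, which is how
    [fn] and the rearranged coefficients in [analytic_at_comp_series] are defined. *)
Lemma cser_abs (u : nat -> C) (M : R) :
  (forall n, Rsum (fun k => Cmod (u k)) n <= M) ->
  cser u (C_Series u) /\ Cmod (C_Series u) <= M.
Proof.
  intros HM.
  assert (Hex : ex_series (fun k => Cmod (u k))).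
  { apply (series_of_bounded _ M); trivial; intros; apply Cmod_ge_0. }
  assert (cser u (C_Series u)).
  { apply cser_Re_Im; simpl; apply Series_correct.
    - apply (ex_series_dominated _ (fun k => Cmod (u k))); trivial.
      intros; apply re_le_Cmod.
    - apply (ex_series_dominated _ (fun k => Cmod (u k))); trivial.
      intros; apply im_le_Cmod. }
  split; trivial.
  apply (cser_mod_le u); trivial; intros n.
  eapply Rle_trans; [apply Cmod_Csum|apply HM].
Qed.

Lemma cser_is_series (u : nat -> C) (l : C) :
  is_series (K := C_AbsRing) (V := C_NormedModule) u l <-> cser u l.
Proof.
  split.
  - intros H eps He.
    pose proof (proj1 (filterlim_locally_ball_norm (K := C_AbsRing) (U := C_NormedModule)
      (sum_n u) l) H (mkposreal eps He)) as [N HN].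
    exists (S N); intros n Hn; destruct n as [|n]; [lia|].
    specialize (HN n ltac:(lia)); rewrite sum_n_Csum in HN.
    exact HN.
  - intros H.
    apply (proj2 (filterlim_locally_ball_norm (K := C_AbsRing) (U := C_NormedModule)
      (sum_n u) l)); intros eps.
    destruct (H eps (cond_pos eps)) as [N HN]; exists N; intros n Hn.
    rewrite sum_n_Csum; exact (HN (S n) ltac:(lia)).
Qed.

Lemma pow_n_Cpow (z : C) (k : nat) : pow_n (K := C_Ring) z k = (z ^ k)%C.
Proof. induction k as [|k IH]; simpl; [reflexivity|now rewrite IH]. Qed.

Lemma is_pseries_cser (a : nat -> C) (z l : C) :
  is_pseries (K := C_AbsRing) (V := C_NormedModule) a z l <->
  cser (fun k => a k * z ^ k)%C l.
Proof.
  unfold is_pseries; rewrite cser_is_series.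
  split; apply cser_ext; intros k.
  - rewrite <- pow_n_Cpow; apply (Cmult_comm (pow_n (K := C_Ring) z k) (a k)).
  - rewrite <- pow_n_Cpow; apply (Cmult_comm (a k) (pow_n (K := C_Ring) z k)).
Qed.

(** * Cauchy products *)

Definition conv (a b : nat -> C) (n : nat) : C :=
  Csum (fun k => a k * b (n - k)%nat)%C (S n).

(** Real and imaginary parts reduce the claim to products of real series. The bound on the moduli is
    carried along so that the lemma can be iterated in [cser_conv_pow]. *)
Lemma cser_conv (a b : nat -> C) (la lb : C) (Ma Mb : R) :
  cser a la -> cser b lb ->
  (forall n, Rsum (fun k => Cmod (a k)) n <= Ma) ->
  (forall n, Rsum (fun k => Cmod (b k)) n <= Mb) ->
  cser (conv a b) (la * lb)%C /\
  (forall n, Rsum (fun k => Cmod (conv a b k)) n <= Ma * Mb).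
Proof.
  intros Ha Hb HMa HMb.
  assert (Ea : ex_series (fun k => Cmod (a k))).
  { apply (series_of_bounded _ Ma); trivial; intros; apply Cmod_ge_0. }
  assert (Eb : ex_series (fun k => Cmod (b k))).
  { apply (series_of_bounded _ Mb); trivial; intros; apply Cmod_ge_0. }
  destruct (ex_series_abs_Re_Im a Ea) as [aR aI].
  destruct (ex_series_abs_Re_Im b Eb) as [bR bI].
  pose proof (cser_Re _ _ Ha) as haR; pose proof (cser_Im _ _ Ha) as haI.
  pose proof (cser_Re _ _ Hb) as hbR; pose proof (cser_Im _ _ Hb) as hbI.
  split.
  - apply cser_Re_Im.
    + rewrite re_mult.
      pose proof (is_series_minus _ _ _ _ (is_series_mult _ _ _ _ haR hbR aR bR)
        (is_series_mult _ _ _ _ haI hbI aI bI)) as H.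
      eapply is_series_ext; [|exact H].
      intros n; unfold conv; rewrite Re_Csum, !sum_f_R0_Rsum.
      unfold plus, opp; simpl plus; change (plus ?x (opp ?y)) with (x + - y).
      rewrite (Rsum_ext (fun k => Re (a k * b (n - k)%nat)%C)
        (fun k => Re (a k) * Re (b (n - k)%nat) + (-1) * (Im (a k) * Im (b (n - k)%nat)))).
      2: { intros; rewrite re_mult; ring. }
      rewrite Rsum_plus, Rsum_scal; simpl; ring.
    + rewrite im_mult.
      pose proof (is_series_plus _ _ _ _ (is_series_mult _ _ _ _ haR hbI aR bI)
        (is_series_mult _ _ _ _ haI hbR aI bR)) as H.
      eapply is_series_ext; [|exact H].
      intros n; unfold conv; rewrite Im_Csum, !sum_f_R0_Rsum.
      rewrite (Rsum_ext (fun k => Im (a k * b (n - k)%nat)%C)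
        (fun k => Re (a k) * Im (b (n - k)%nat) + Im (a k) * Re (b (n - k)%nat))).
      2: { intros; rewrite im_mult; ring. }
      rewrite Rsum_plus; reflexivity.
  - intros n.
    pose proof (is_series_mult_pos _ _ _ _ (Series_correct _ Ea) (Series_correct _ Eb)
      (fun k => Cmod_ge_0 (a k)) (fun k => Cmod_ge_0 (b k))) as H.
    apply Rle_trans with (Series (fun k => Cmod (a k)) * Series (fun k => Cmod (b k))).
    + rewrite <- (is_series_unique _ _ H).
      eapply Rle_trans; [|apply (Rsum_le_Series _ n)].
      * apply Rsum_le; intros k _; rewrite sum_f_R0_Rsum.
        eapply Rle_trans; [apply Cmod_Csum|].
        apply Rsum_le; intros j _; rewrite Cmod_mult; lra.
      * intros k; rewrite sum_f_R0_Rsum; apply Rsum_nonneg; intros.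
        apply Rmult_le_pos; apply Cmod_ge_0.
      * eexists; exact H.
    + apply Rmult_le_compat.
      * apply Rle_trans with (Rsum (fun k => Cmod (a k)) 0); [simpl; lra|].
        apply Rsum_le_Series; trivial; intros; apply Cmod_ge_0.
      * apply Rle_trans with (Rsum (fun k => Cmod (b k)) 0); [simpl; lra|].
        apply Rsum_le_Series; trivial; intros; apply Cmod_ge_0.
      * apply (series_of_bounded _ Ma); trivial; intros; apply Cmod_ge_0.
      * apply (series_of_bounded _ Mb); trivial; intros; apply Cmod_ge_0.
Qed.

(** * Local power series expansions *)

Definition expands (f : C -> C) (z0 : C) (a : nat -> C) (r : R) : Prop :=
  forall h, Cmod h < r -> cser (fun k => a k * h ^ k)%C (f (z0 + h)%C).

Lemma analytic_at_expands (f : C -> C) (z : C) :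
  analytic_at f z <-> exists a r, 0 < r /\ expands f z a r.
Proof.
  split; intros [a [r [Hr H]]]; exists a, r; split; trivial;
    intros h Hh; apply is_pseries_cser, H; trivial.
Qed.

Lemma Cmod_RtoC_nonneg (x : R) : 0 <= x -> Cmod x = x.
Proof. intros; rewrite Cmod_R; now apply Rabs_pos_eq. Qed.

(** A substitute for Cauchy's estimates: the series converges at the point [rho] itself, so its
    terms there are bounded. *)
Lemma expands_bounded (f : C -> C) (z0 : C) (a : nat -> C) (r rho : R) :
  expands f z0 a r -> 0 <= rho < r ->
  exists K, 0 <= K /\ forall k, Cmod (a k) * rho ^ k <= K.
Proof.
  intros H Hr.
  destruct (cser_terms_bounded _ _ (H (RtoC rho) ltac:(rewrite Cmod_RtoC_nonneg; lra)))
    as [K [HK0 HK]].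
  exists K; split; trivial; intros k; specialize (HK k).
  now rewrite Cmod_mult, Cmod_pow, Cmod_RtoC_nonneg in HK by lra.
Qed.

Lemma geom_bound_sum (u : nat -> R) (K q : R) (n : nat) :
  0 <= q < 1 -> 0 <= K -> (forall k, u k <= K * q ^ k) -> Rsum u n <= K * / (1 - q).
Proof.
  intros Hq HK H.
  apply Rle_trans with (Rsum (fun k => K * q ^ k) n).
  - apply Rsum_le; auto.
  - rewrite Rsum_scal; apply Rmult_le_compat_l; trivial; now apply Rsum_geom_le.
Qed.

(** The terms at the midpoint of [rho] and [r] are bounded, so those at [rho] are dominated by a
    geometric series. *)
Lemma expands_abs (f : C -> C) (z0 : C) (a : nat -> C) (r rho : R) :
  expands f z0 a r -> 0 <= rho < r ->
  exists M, forall n, Rsum (fun k => Cmod (a k) * rho ^ k) n <= M.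
Proof.
  intros H Hr.
  destruct (expands_bounded f z0 a r ((rho + r) / 2) H ltac:(lra)) as [K [HK0 HK]].
  assert (Hq : 0 <= rho / ((rho + r) / 2) < 1).
  { split; [apply Rdiv_le_0_compat; lra|apply (Rdiv_lt_1 rho); lra]. }
  exists (K * / (1 - rho / ((rho + r) / 2))); intros n.
  apply geom_bound_sum; trivial; intros k.
  replace rho with (((rho + r) / 2) * (rho / ((rho + r) / 2))) at 1 by (field; lra).
  rewrite Rpow_mult_distr, <- Rmult_assoc.
  apply Rmult_le_compat_r; [apply pow_le; lra|apply HK].
Qed.

Lemma expands_remainder (f : C -> C) (z0 : C) (a : nat -> C) (r : R) (m : nat) :
  0 < r -> expands f z0 a r ->
  exists K rho, 0 <= K /\ 0 < rho < r /\
    forall h, Cmod h <= rho ->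
      Cmod (f (z0 + h)%C - Csum (fun k => a k * h ^ k)%C m) <= K * Cmod h ^ m.
Proof.
  intros Hr H.
  destruct (expands_bounded f z0 a r (r / 2) H ltac:(lra)) as [K [HK0 HK]].
  (* The coefficients are controlled at radius [r / 2]; for [Cmod h <= r / 4] the tail is then
     geometric with ratio one half, and the factor 2 is its sum. *)
  exists (K * / (r / 2) ^ m * 2), (r / 4).
  assert (0 < (r / 2) ^ m) by (apply pow_lt; lra).
  assert (0 < / (r / 2) ^ m) by now apply Rinv_0_lt_compat.
  split; [apply Rmult_le_pos; [apply Rmult_le_pos; lra|lra]|].
  split; [lra|]; intros h Hh.
  pose proof (proj1 (cser_shift _ _ m) (H h ltac:(lra))) as Hs.
  apply (cser_mod_le _ _ _ Hs); intros n.
  eapply Rle_trans; [apply Cmod_Csum|].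
  replace (K * / (r / 2) ^ m * 2 * Cmod h ^ m)
    with ((K * / (r / 2) ^ m * Cmod h ^ m) * / (1 - / 2)) by (field; lra).
  assert (0 <= Cmod h ^ m) by (apply pow_le, Cmod_ge_0).
  apply geom_bound_sum; [lra| |].
  { apply Rmult_le_pos; trivial; apply Rmult_le_pos; lra. }
  intros k; rewrite Cmod_mult, Cmod_pow, pow_add.
  specialize (HK (m + k)%nat); rewrite pow_add in HK.
  assert (0 < (r / 2) ^ k) by (apply pow_lt; lra).
  assert (HKk : Cmod (a (m + k)%nat) <= K * / (r / 2) ^ m * / (r / 2) ^ k).
  { apply (Rmult_le_reg_r ((r / 2) ^ m * (r / 2) ^ k)).
    - now apply Rmult_lt_0_compat.
    - eapply Rle_trans; [exact HK|].
      apply Req_le; field; split; apply Rgt_not_eq; trivial. }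
  assert (Hhk : Cmod h ^ k <= (r / 2) ^ k * (/ 2) ^ k).
  { rewrite <- Rpow_mult_distr; apply pow_incr; split; [apply Cmod_ge_0|lra]. }
  apply Rle_trans with ((K * / (r / 2) ^ m * / (r / 2) ^ k) *
    (Cmod h ^ m * ((r / 2) ^ k * (/ 2) ^ k))).
  - apply Rmult_le_compat; trivial; try apply Cmod_ge_0.
    + apply Rmult_le_pos; trivial; apply pow_le, Cmod_ge_0.
    + apply Rmult_le_compat_l; trivial.
  - apply Req_le; field; split; apply Rgt_not_eq; trivial.
Qed.

Lemma analytic_at_continuous (f : C -> C) (z0 : C) (eps : R) :
  analytic_at f z0 -> 0 < eps ->
  exists d, 0 < d /\ forall z, Cmod (z - z0) < d -> Cmod (f z - f z0) < eps.
Proof.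
  intros Hf He; apply analytic_at_expands in Hf; destruct Hf as [a [r [Hr H]]].
  destruct (expands_remainder f z0 a r 1 Hr H) as [K [rho [HK [Hrho Hb]]]].
  assert (E : forall z, Cmod (z - z0) <= rho -> Cmod (f z - a O) <= K * Cmod (z - z0)).
  { intros z Hz; specialize (Hb _ Hz); simpl in Hb.
    replace (z0 + (z - z0))%C with z in Hb by ring.
    replace (0 + a O * 1)%C with (a O) in Hb by ring.
    rewrite Rmult_1_r in Hb; exact Hb. }
  assert (E0 : f z0 = a O).
  { apply Ceq_minus, Cmod_eq_0; specialize (E z0).
    replace (z0 - z0)%C with (RtoC 0) in E by ring; rewrite Cmod_0 in E.
    pose proof (Cmod_ge_0 (f z0 - a O)); lra. }
  assert (0 < Rmin rho (eps / (K + 1))).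
  { apply Rmin_pos; [lra|apply Rdiv_lt_0_compat; lra]. }
  exists (Rmin rho (eps / (K + 1))); split; trivial; intros z Hz.
  rewrite E0; eapply Rle_lt_trans; [apply E|].
  - eapply Rle_trans; [apply Rlt_le, Hz|apply Rmin_l].
  - assert (Cmod (z - z0) < eps / (K + 1)) as Hz2
      by (eapply Rlt_le_trans; [apply Hz|apply Rmin_r]).
    apply (Rmult_lt_compat_r (K + 1)) in Hz2; [|lra].
    unfold Rdiv in Hz2; rewrite Rmult_assoc, Rinv_l in Hz2 by lra.
    pose proof (Cmod_ge_0 (z - z0)); lra.
Qed.

Lemma expands_value (f : C -> C) (z0 : C) (a : nat -> C) (r : R) :
  0 < r -> expands f z0 a r -> f z0 = a O.
Proof.
  intros Hr H; specialize (H (RtoC 0) ltac:(rewrite Cmod_0; lra)).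
  replace (z0 + 0)%C with z0 in H by ring.
  apply (cser_unique _ _ _ H).
  replace (a O) with (Csum (fun k => a k * 0 ^ k)%C 1) by (simpl; ring).
  apply cser_finite; intros [|k] Hk; [lia|simpl; ring].
Qed.

(** * Powers and composition of power series *)

Fixpoint conv_pow (b : nat -> C) (n : nat) : nat -> C :=
  match n with
  | O => fun k => match k with O => RtoC 1 | _ => RtoC 0 end
  | S n => conv b (conv_pow b n)
  end.

Lemma conv_scale (a b : nat -> C) (h : C) (n : nat) :
  conv (fun k => a k * h ^ k)%C (fun k => b k * h ^ k)%C n = (conv a b n * h ^ n)%C.
Proof.
  unfold conv; rewrite Cmult_comm, <- Csum_scal; apply Csum_ext; intros k Hk.
  replace (h ^ n)%C with (h ^ k * h ^ (n - k))%C by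
    (rewrite <- Cpow_add_r; f_equal; lia).
  ring.
Qed.

Lemma cser_conv_pow (b : nat -> C) (h g : C) (M : R) (n : nat) :
  cser (fun k => b k * h ^ k)%C g ->
  (forall N, Rsum (fun k => Cmod (b k * h ^ k)) N <= M) ->
  cser (fun k => conv_pow b n k * h ^ k)%C (g ^ n)%C /\
  (forall N, Rsum (fun k => Cmod (conv_pow b n k * h ^ k)) N <= M ^ n).
Proof.
  intros Hg HM; induction n as [|n [IH1 IH2]].
  - split.
    + replace (g ^ 0)%C with (Csum (fun k => conv_pow b 0 k * h ^ k)%C 1) by (simpl; ring).
      apply cser_finite; intros [|k] Hk; [lia|simpl; ring].
    + intros N; simpl pow.
      assert (HN : forall m, Rsum (fun k => Cmod (conv_pow b 0 k * h ^ k)) (S m) = 1).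
      { induction m as [|m IH]; simpl in *.
        - rewrite Cmult_1_l, Cmod_1; ring.
        - rewrite IH; rewrite Cmult_0_l, Cmod_0; ring. }
      destruct N; [simpl; lra|rewrite HN; lra].
  - destruct (cser_conv _ _ _ _ _ _ Hg IH1 HM IH2) as [H1 H2].
    split.
    + eapply cser_ext; [|exact H1]; intros k; apply conv_scale.
    + intros N; eapply Rle_trans; [|apply (H2 N)].
      apply Req_le, Rsum_ext; intros k _; f_equal; symmetry; apply conv_scale.
Qed.

Lemma cser_Csum (u : nat -> nat -> C) (l : nat -> C) (m : nat) :
  (forall i, (i < m)%nat -> cser (u i) (l i)) ->
  cser (fun n => Csum (fun i => u i n) m) (Csum l m).
Proof.
  induction m as [|m IH]; intros H; simpl.
  - now apply cser_zero.
  - apply cser_plus; auto with arith.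
Qed.

(** Collecting the powers of [h] in [sum_n a n * g (z0 + h) ^ n] rearranges a double series. It
    converges absolutely once [sum_k |b k| r1^k <= R1 < R0], because [sum_n |a n| R1^n] is finite.
    The outer expansion stays centred at 0, so [f] is never re-expanded at [g z0]. *)
Lemma analytic_at_comp_series (f g : C -> C) (a : nat -> C) (R0 : R) (z0 : C) :
  expands f 0 a R0 -> Cmod (g z0) < R0 -> analytic_at g z0 ->
  analytic_at (fun z => f (g z)) z0.
Proof.
  intros Hf Hg0 Hg.
  apply analytic_at_expands in Hg; destruct Hg as [b [r [Hr Hg]]].
  rewrite (expands_value g z0 b r Hr Hg) in Hg0.
  pose proof (Cmod_ge_0 (b O)) as Hb0.
  set (R1 := (Cmod (b O) + R0) / 2).
  destruct (expands_abs f 0 a R0 R1 Hf ltac:(unfold R1; lra)) as [A HA].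
  destruct (expands_bounded g z0 b r (r / 2) Hg ltac:(lra)) as [K [HK0 HK]].
  (* the radius is chosen so that [sum_k |b k| r1^k <= R1 < R0] *)
  assert (Hr1 : exists r1, 0 < r1 < r /\
    forall N, Rsum (fun k => Cmod (b k) * r1 ^ k) N <= R1).
  (* This [q] makes the geometric tail [K * (q / 2) / (1 - q / 2)] at most [R1 - Cmod (b O)]. *)
  { set (q := (R1 - Cmod (b O)) / (K + (R1 - Cmod (b O)))).
    assert (HR1 : 0 < R1 - Cmod (b O)) by (unfold R1; lra).
    assert (Hq0 : 0 < q) by (apply Rdiv_lt_0_compat; lra).
    assert (Hq1 : q <= 1).
    { unfold q; apply (Rmult_le_reg_r (K + (R1 - Cmod (b O)))); [lra|].
      unfold Rdiv; rewrite Rmult_assoc, Rinv_l; lra. }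
    exists (r / 2 * (q / 2)); split; [nra|]; intros N.
    apply Rle_trans with (Rsum (fun k => Cmod (b k) * (r / 2 * (q / 2)) ^ k) (1 + N)).
    - apply Rsum_mono; [|lia]; intros k; apply Rmult_le_pos; [apply Cmod_ge_0|].
      apply pow_le; nra.
    - rewrite Rsum_split; simpl Rsum at 1.
      assert (Rsum (fun k => Cmod (b (1 + k)%nat) * (r / 2 * (q / 2)) ^ (1 + k)) N
        <= (K * (q / 2)) * / (1 - q / 2)) as Ht.
      { apply geom_bound_sum; [lra|nra|]; intros k.
        rewrite Rpow_mult_distr, <- Rmult_assoc, pow_add, pow_1.
        rewrite pow_add, pow_1.
        specialize (HK (1 + k)%nat); rewrite pow_add, pow_1 in HK.
        rewrite <- Rmult_assoc.
        apply Rmult_le_compat_r; [apply pow_le; lra|].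
        apply Rmult_le_compat_r; [lra|exact HK]. }
      assert (K * (q / 2) * / (1 - q / 2) <= R1 - Cmod (b O)).
      { apply (Rmult_le_reg_r (1 - q / 2)); [lra|].
        rewrite Rmult_assoc, Rinv_l, Rmult_1_r by lra.
        assert (q * (K + (R1 - Cmod (b O))) = R1 - Cmod (b O)) by (unfold q; field; lra).
        nra. }
      simpl in *; lra. }
  clear K HK0 HK.
  destruct Hr1 as [r1 [Hr1 Hsum]].
  pose (P := conv_pow b).
  assert (HP : forall n N, Rsum (fun k => Cmod (P n k) * r1 ^ k) N <= R1 ^ n).
  { intros n N.
    destruct (cser_conv_pow b (RtoC r1) _ R1 n
      (Hg (RtoC r1) ltac:(rewrite Cmod_RtoC_nonneg; lra))) as [_ H].
    - intros N'; eapply Rle_trans; [|apply (Hsum N')].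
      apply Req_le, Rsum_ext; intros k _.
      now rewrite Cmod_mult, Cmod_pow, Cmod_RtoC_nonneg by lra.
    - eapply Rle_trans; [|apply (H N)].
      apply Req_le, Rsum_ext; intros k _.
      now rewrite Cmod_mult, Cmod_pow, Cmod_RtoC_nonneg by lra. }
  assert (HR1 : 0 <= R1) by (unfold R1; lra).
  set (d := fun k => C_Series (fun n => a n * P n k)%C).
  assert (Hd : forall k, cser (fun n => a n * P n k)%C (d k)).
  { intros k; apply (cser_abs _ (/ r1 ^ k * A)); intros N.
    apply Rle_trans with (Rsum (fun n => / r1 ^ k * (Cmod (a n) * R1 ^ n)) N).
    - apply Rsum_le; intros n _; rewrite Cmod_mult.
      assert (0 < r1 ^ k) by (apply pow_lt; lra).
      assert (Cmod (P n k) * r1 ^ k <= R1 ^ n) as Hn.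
      { eapply Rle_trans; [|apply (HP n (S k))]; simpl.
        assert (0 <= Rsum (fun k => Cmod (P n k) * r1 ^ k) k); [|lra].
        apply Rsum_nonneg; intros; apply Rmult_le_pos; [apply Cmod_ge_0|apply pow_le; lra]. }
      apply (Rmult_le_reg_r (r1 ^ k)); trivial.
      replace (/ r1 ^ k * (Cmod (a n) * R1 ^ n) * r1 ^ k) with (Cmod (a n) * R1 ^ n)
        by (field; lra).
      rewrite Rmult_assoc; apply Rmult_le_compat_l; trivial; apply Cmod_ge_0.
    - rewrite Rsum_scal; apply Rmult_le_compat_l; [|apply HA].
      apply Rlt_le, Rinv_0_lt_compat, pow_lt; lra. }
  apply analytic_at_expands; exists d, r1; split; [lra|]; intros h Hh.
  assert (HgP : forall n, cser (fun k => P n k * h ^ k)%C (g (z0 + h)%C ^ n)%C).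
  { intros n.
    apply (cser_conv_pow b h _ R1 n (Hg h ltac:(lra))); intros N.
    eapply Rle_trans; [|apply (Hsum N)].
    apply Rsum_le; intros k _; rewrite Cmod_mult, Cmod_pow.
    apply Rmult_le_compat_l; [apply Cmod_ge_0|].
    apply pow_incr; split; [apply Cmod_ge_0|lra]. }
  assert (HgR : Cmod (g (z0 + h)%C) <= R1).
  { apply (cser_mod_le _ _ _ (Hg h ltac:(lra))); intros N.
    eapply Rle_trans; [apply Cmod_Csum|].
    eapply Rle_trans; [|apply (Hsum N)].
    apply Rsum_le; intros k _; rewrite Cmod_mult, Cmod_pow.
    apply Rmult_le_compat_l; [apply Cmod_ge_0|].
    apply pow_incr; split; [apply Cmod_ge_0|lra]. }
  assert (Hfg : cser (fun n => a n * g (z0 + h)%C ^ n)%C (f (g (z0 + h)%C))).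
  { replace (f (g (z0 + h)%C)) with (f (0 + g (z0 + h)%C)%C) by (f_equal; ring).
    apply Hf; unfold R1 in HgR; lra. }
  intros eps He.
  (* The outer sum is cut at [N]. The tail of [f] ([H3]), the tail of the rearranged coefficients
     ([H1]) and the convergence of the finite part ([H2]) each cost [eps / 4]. *)
  destruct (series_tail (fun n => Cmod (a n) * R1 ^ n) (eps / 4)) as [N HN].
  { intros k; apply Rmult_le_pos; [apply Cmod_ge_0|now apply pow_le]. }
  { apply (series_of_bounded _ A); trivial; intros k.
    apply Rmult_le_pos; [apply Cmod_ge_0|now apply pow_le]. }
  { lra. }
  specialize (HN N); assert (HN' := fun n => HN n (le_n N)); clear HN.
  pose (dN := fun k => Csum (fun n => a n * P n k)%C N).
  assert (H3 : Cmod (f (g (z0 + h)%C) - Csum (fun n => a n * g (z0 + h)%C ^ n)%C N)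
    <= eps / 4).
  { apply (cser_mod_le _ _ _ (proj1 (cser_shift _ _ N) Hfg)); intros n.
    eapply Rle_trans; [apply Cmod_Csum|]; eapply Rle_trans; [|apply (HN' n)].
    apply Rsum_le; intros k _; rewrite Cmod_mult, Cmod_pow.
    apply Rmult_le_compat_l; [apply Cmod_ge_0|].
    apply pow_incr; split; [apply Cmod_ge_0|trivial]. }
  assert (H1 : forall m, Cmod (Csum (fun k => (d k - dN k) * h ^ k)%C m) <= eps / 4).
  { intros m.
    pose proof (cser_Csum (fun k n => h ^ k * (a (N + n)%nat * P (N + n)%nat k))%C
      (fun k => h ^ k * (d k - dN k))%C m
      (fun k _ => cser_scal _ _ _ (proj1 (cser_shift _ _ N) (Hd k)))) as Hs.
    rewrite (Csum_ext _ (fun k => h ^ k * (d k - dN k))%C) by (intros; ring).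
    apply (cser_mod_le _ _ _ Hs); intros n.
    eapply Rle_trans; [apply Cmod_Csum|]; eapply Rle_trans; [|apply (HN' n)].
    apply Rsum_le; intros j _.
    eapply Rle_trans; [apply Cmod_Csum|].
    apply Rle_trans with (Cmod (a (N + j)%nat) * Rsum (fun k => Cmod (P (N + j)%nat k) * r1 ^ k) m).
    - rewrite <- Rsum_scal; apply Rsum_le; intros k _.
      rewrite !Cmod_mult, Cmod_pow.
      assert (Cmod h ^ k <= r1 ^ k) by (apply pow_incr; split; [apply Cmod_ge_0|lra]).
      rewrite Rmult_comm, Rmult_assoc.
      apply Rmult_le_compat_l; [apply Cmod_ge_0|].
      apply Rmult_le_compat_l; [apply Cmod_ge_0|trivial].
    - apply Rmult_le_compat_l; [apply Cmod_ge_0|apply HP]. }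
  assert (H2 : cser (fun k => dN k * h ^ k)%C (Csum (fun n => a n * g (z0 + h)%C ^ n)%C N)).
  { eapply cser_ext; [|apply (cser_Csum (fun n k => a n * (P n k * h ^ k))%C)].
    - intros k; simpl; unfold dN; rewrite Cmult_comm, <- Csum_scal.
      apply Csum_ext; intros; ring.
    - intros n _; apply cser_scal, HgP. }
  destruct (H2 (eps / 4)) as [M HM]; [lra|].
  exists M; intros m Hm; specialize (HM m Hm); specialize (H1 m).
  rewrite (Csum_ext _ (fun k => d k * h ^ k - dN k * h ^ k)%C) in H1 by (intros; ring).
  rewrite Csum_minus in H1.
  rewrite Cmod_minus_sym in H3.
  eapply Rle_lt_trans; [apply (Cmod_triangle3 _ (Csum (fun k => dN k * h ^ k)%C m))|].
  pose proof (Cmod_triangle3 (Csum (fun k => dN k * h ^ k)%C m)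
    (Csum (fun n => a n * g (z0 + h)%C ^ n)%C N) (f (g (z0 + h)%C))).
  lra.
Qed.

(** * Algebra of analytic functions and the minimum modulus principle *)

Lemma analytic_at_ext (f g : C -> C) (z0 : C) (d : R) :
  0 < d -> (forall z, Cmod (z - z0) < d -> f z = g z) ->
  analytic_at f z0 -> analytic_at g z0.
Proof.
  intros Hd E Hf; apply analytic_at_expands in Hf; destruct Hf as [a [r [Hr H]]].
  apply analytic_at_expands; exists a, (Rmin r d); split; [now apply Rmin_pos|].
  intros h Hh; rewrite <- E.
  - apply H; eapply Rlt_le_trans; [apply Hh|apply Rmin_l].
  - replace (z0 + h - z0)%C with h by ring.
    eapply Rlt_le_trans; [apply Hh|apply Rmin_r].
Qed.

Lemma expands_poly (f : C -> C) (a : nat -> C) (n : nat) (z0 : C) (r : R) :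
  (forall k, (n <= k)%nat -> a k = 0) ->
  (forall h, f (z0 + h)%C = Csum (fun k => a k * h ^ k)%C n) ->
  expands f z0 a r.
Proof.
  intros Ha Hf h _; rewrite Hf; apply cser_finite.
  intros k Hk; rewrite Ha by trivial; ring.
Qed.

Lemma analytic_at_const (c z0 : C) : analytic_at (fun _ => c) z0.
Proof.
  apply analytic_at_expands.
  exists (fun k => match k with O => c | _ => RtoC 0 end), 1; split; [lra|].
  apply (expands_poly _ _ 1).
  - intros [|k] Hk; [lia|reflexivity].
  - intros h; simpl; ring.
Qed.

Lemma analytic_at_id (z0 : C) : analytic_at (fun z => z) z0.
Proof.
  apply analytic_at_expands.
  exists (fun k => match k with O => z0 | S O => RtoC 1 | _ => RtoC 0 end), 1; split; [lra|].
  apply (expands_poly _ _ 2).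
  - intros [|[|k]] Hk; [lia|lia|reflexivity].
  - intros h; simpl; ring.
Qed.

Lemma analytic_at_plus (f g : C -> C) (z0 : C) :
  analytic_at f z0 -> analytic_at g z0 -> analytic_at (fun z => f z + g z)%C z0.
Proof.
  intros Hf Hg; apply analytic_at_expands in Hf; destruct Hf as [a [r [Hr Hf]]].
  apply analytic_at_expands in Hg; destruct Hg as [b [s [Hs Hg]]].
  apply analytic_at_expands; exists (fun k => a k + b k)%C, (Rmin r s).
  split; [now apply Rmin_pos|]; intros h Hh.
  eapply cser_ext; [|apply cser_plus; [apply Hf|apply Hg]].
  - intros k; simpl; ring.
  - eapply Rlt_le_trans; [apply Hh|apply Rmin_l].
  - eapply Rlt_le_trans; [apply Hh|apply Rmin_r].
Qed.

Lemma analytic_at_scal (c : C) (f : C -> C) (z0 : C) :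
  analytic_at f z0 -> analytic_at (fun z => c * f z)%C z0.
Proof.
  intros Hf; apply analytic_at_expands in Hf; destruct Hf as [a [r [Hr Hf]]].
  apply analytic_at_expands; exists (fun k => c * a k)%C, r; split; trivial.
  intros h Hh; eapply cser_ext; [|apply cser_scal, Hf, Hh]; intros k; simpl; ring.
Qed.

Lemma analytic_at_minus (f g : C -> C) (z0 : C) :
  analytic_at f z0 -> analytic_at g z0 -> analytic_at (fun z => f z - g z)%C z0.
Proof.
  intros Hf Hg; apply (analytic_at_ext (fun z => f z + (-(1)) * g z)%C _ _ 1 Rlt_0_1).
  - intros; ring.
  - now apply analytic_at_plus; [|apply analytic_at_scal].
Qed.

(** Squaring is composition with the polynomial [u * u], whose expansion at 0 is valid with any
    radius. *)
Lemma analytic_at_sqr (f : C -> C) (z0 : C) :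
  analytic_at f z0 -> analytic_at (fun z => f z * f z)%C z0.
Proof.
  intros Hf.
  apply (analytic_at_comp_series (fun u => u * u)%C f
    (fun k => match k with 2%nat => RtoC 1 | _ => RtoC 0 end) (Cmod (f z0) + 1)).
  - apply (expands_poly _ _ 3).
    + intros [|[|[|k]]] Hk; [lia|lia|lia|reflexivity].
    + intros h; simpl; ring.
  - lra.
  - trivial.
Qed.

(* polarization: [f g = ((f + g)^2 - (f - g)^2) / 4] *)
Lemma analytic_at_mult (f g : C -> C) (z0 : C) :
  analytic_at f z0 -> analytic_at g z0 -> analytic_at (fun z => f z * g z)%C z0.
Proof.
  intros Hf Hg.
  apply (analytic_at_ext (fun z => / 4 *
    ((f z + g z) * (f z + g z) - (f z - g z) * (f z - g z)))%C _ _ 1 Rlt_0_1).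
  - intros; field; intros E; apply RtoC_inj in E; lra.
  - apply analytic_at_scal, analytic_at_minus.
    + now apply (analytic_at_sqr (fun z => f z + g z)%C), analytic_at_plus.
    + now apply (analytic_at_sqr (fun z => f z - g z)%C), analytic_at_minus.
Qed.

Lemma analytic_at_pow (f : C -> C) (z0 : C) (n : nat) :
  analytic_at f z0 -> analytic_at (fun z => f z ^ n)%C z0.
Proof.
  intros Hf; induction n as [|n IH]; simpl.
  - apply analytic_at_const.
  - now apply analytic_at_mult.
Qed.

(** Absolute convergence provides a sum [l]; dropping its first term gives [l - 1 = u * l], which
    determines [l]. *)
Lemma cser_geom (u : C) : Cmod u < 1 -> cser (fun k => u ^ k)%C (/ (1 - u))%C.
Proof.
  intros Hu.
  assert (Hn : (1 - u)%C <> 0).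
  { intros E; replace u with (RtoC 1) in Hu; [rewrite Cmod_1 in Hu; lra|].
    replace u with (1 - (1 - u))%C by ring; rewrite E; ring. }
  destruct (cser_abs (fun k => u ^ k)%C (/ (1 - Cmod u))) as [H _].
  { intros n; rewrite (Rsum_ext _ (fun k => Cmod u ^ k)) by (intros; apply Cmod_pow).
    apply Rsum_geom_le; split; [apply Cmod_ge_0|trivial]. }
  set (l := C_Series (fun k => u ^ k)%C) in H.
  pose proof (proj1 (cser_shift _ _ 1) H) as H1.
  pose proof (cser_scal u _ _ H) as H2.
  assert (E : (l - Csum (fun k => u ^ k)%C 1)%C = (u * l)%C) by (apply (cser_unique _ _ _ H1 H2)).
  simpl in E.
  assert (El : ((1 - u) * l)%C = 1).
  { replace ((1 - u) * l)%C with (l - u * l)%C by ring; rewrite <- E; ring. }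
  assert (El2 : l = (/ (1 - u) * ((1 - u) * l))%C) by (field; trivial).
  rewrite El, Cmult_1_r in El2; rewrite <- El2; trivial.
Qed.

(** Near [z0] the reciprocal is [/ g z0] times the geometric series in [1 - g z / g z0], a quantity
    that vanishes at [z0]. *)
Lemma analytic_at_inv (g : C -> C) (z0 : C) :
  analytic_at g z0 -> g z0 <> 0 -> analytic_at (fun z => / g z)%C z0.
Proof.
  intros Hg H0.
  assert (Hp : 0 < Cmod (g z0)) by now apply Cmod_gt_0.
  destruct (analytic_at_continuous g z0 (Cmod (g z0)) Hg Hp) as [d [Hd Hc]].
  assert (Hnz : forall z, Cmod (z - z0) < d -> g z <> 0).
  { intros z Hz E; specialize (Hc z Hz); rewrite E in Hc.
    replace (0 - g z0)%C with (- g z0)%C in Hc by ring; rewrite Cmod_opp in Hc; lra. }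
  apply (analytic_at_ext (fun z => / g z0 * / (1 - (1 - / g z0 * g z)))%C _ _ d Hd).
  - intros z Hz; specialize (Hnz z Hz); field; auto.
  - apply analytic_at_scal.
    apply (analytic_at_comp_series (fun u => / (1 - u))%C (fun z => 1 - / g z0 * g z)%C
      (fun _ => RtoC 1) 1).
    + intros h Hh; replace (0 + h)%C with h by ring.
      eapply cser_ext; [|apply cser_geom, Hh]; intros k; simpl; ring.
    + replace (1 - / g z0 * g z0)%C with (RtoC 0) by (field; trivial).
      rewrite Cmod_0; lra.
    + apply analytic_at_minus; [apply analytic_at_const|now apply analytic_at_scal].
Qed.

(** * Polar form and complex roots *)

Lemma Cpow_cos_sin (x : R) (n : nat) :
  (((cos x, sin x) : C) ^ n)%C = (cos (INR n * x), sin (INR n * x)).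
Proof.
  induction n as [|n IH].
  - simpl; rewrite Rmult_0_l, cos_0, sin_0; reflexivity.
  - rewrite Cpow_S, IH, S_INR.
    replace ((INR n + 1) * x) with (x + INR n * x) by ring.
    rewrite cos_plus, sin_plus; unfold Cmult; simpl; f_equal; ring.
Qed.

Lemma Cmod_cos_sin (x : R) : Cmod (cos x, sin x) = 1.
Proof.
  unfold Cmod; simpl.
  rewrite !Rmult_1_r, Rplus_comm; unfold Rsqr.
  pose proof (sin2_cos2 x) as E; unfold Rsqr in E; rewrite E; apply sqrt_1.
Qed.

Lemma unit_polar (u : C) : Cmod u = 1 -> exists t, u = (cos t, sin t).
Proof.
  intros Hu.
  assert (E : Re u ^ 2 + Im u ^ 2 = 1) by (rewrite <- Cmod2_alt, Hu; ring).
  assert (Hr : -1 <= Re u <= 1) by nra.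
  assert (Es : forall y, 0 <= y -> y ^ 2 = Im u ^ 2 -> sqrt (1 - Rsqr (Re u)) = y).
  { intros y Hy Ey; replace (1 - Rsqr (Re u)) with (Rsqr y) by (unfold Rsqr; nra).
    now apply sqrt_Rsqr. }
  destruct (Rle_or_lt 0 (Im u)) as [Hi|Hi].
  - exists (acos (Re u)); rewrite cos_acos, sin_acos by trivial.
    rewrite (Es (Im u)) by (trivial; ring); now destruct u.
  - exists (- acos (Re u)); rewrite cos_neg, sin_neg, cos_acos, sin_acos by trivial.
    rewrite (Es (- Im u)) by (try ring; lra).
    rewrite Ropp_involutive; now destruct u.
Qed.

Lemma Cpow_root (c : C) (m : nat) : c <> 0 -> (1 <= m)%nat -> exists v, (v ^ m)%C = c.
Proof.
  intros Hc Hm; apply Cmod_gt_0 in Hc.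
  assert (Hc0 : RtoC (Cmod c) <> 0) by (intros E; apply RtoC_inj in E; lra).
  destruct (unit_polar (c / Cmod c)%C) as [t Ht].
  { rewrite Cmod_div, Cmod_RtoC_nonneg by (trivial; lra); field; lra. }
  assert (HI : INR m <> 0) by (apply not_0_INR; lia).
  exists (RtoC (exp (ln (Cmod c) / INR m)) * (cos (t / INR m), sin (t / INR m)))%C.
  rewrite Cpow_mult_l, Cpow_cos_sin, <- RtoC_pow, <- Rpower_pow by apply exp_pos.
  unfold Rpower; rewrite ln_exp.
  replace (INR m * (t / INR m)) with t by (field; trivial).
  replace (INR m * (ln (Cmod c) / INR m)) with (ln (Cmod c)) by (field; trivial).
  rewrite exp_ln, <- Ht by trivial; field; trivial.
Qed.

(** * Leading terms and local minima of the modulus *)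

Lemma least_index (P : nat -> Prop) (k : nat) : P k ->
  exists m, (m <= k)%nat /\ P m /\ forall j, (j < m)%nat -> ~ P j.
Proof.
  induction k as [k IH] using lt_wf_ind; intros Hk.
  destruct (classic (exists j, (j < k)%nat /\ P j)) as [[j [Hj HPj]]|Hno].
  - destruct (IH j Hj HPj) as [m [Hm H]]; exists m; split; [lia|exact H].
  - exists k; repeat split; trivial; intros j Hj HPj; apply Hno; exists j; auto.
Qed.

Lemma first_nonzero (a : nat -> C) (k : nat) :
  a k <> 0 -> (1 <= k)%nat ->
  exists m, (1 <= m)%nat /\ a m <> 0 /\ forall j, (1 <= j < m)%nat -> a j = 0.
Proof.
  intros Hk H1.
  destruct (least_index (fun m => (1 <= m)%nat /\ a m <> 0) k (conj H1 Hk))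
    as [m [_ [[Hm Ham] Hmin]]].
  exists m; repeat split; trivial; intros j Hj; apply NNPP; intros Haj.
  apply (Hmin j); [lia|split; [lia|trivial]].
Qed.

Lemma expands_leading (f : C -> C) (z0 : C) (a : nat -> C) (r : R) (m : nat) :
  0 < r -> expands f z0 a r -> (1 <= m)%nat -> (forall j, (1 <= j < m)%nat -> a j = 0) ->
  exists K rho, 0 <= K /\ 0 < rho < r /\
    forall h, Cmod h <= rho ->
      Cmod (f (z0 + h)%C - (f z0 + a m * h ^ m)) <= K * Cmod h ^ S m.
Proof.
  intros Hr H Hm Hj.
  destruct (expands_remainder f z0 a r (S m) Hr H) as [K [rho [HK [Hrho Hb]]]].
  exists K, rho; split; [trivial|split; [trivial|]]; intros h Hh.
  assert (E : Csum (fun k => a k * h ^ k)%C (S m) = (f z0 + a m * h ^ m)%C).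
  { assert (E1 : Csum (fun k => a k * h ^ k)%C m = f z0).
    { rewrite (expands_value f z0 a r Hr H); destruct m as [|m]; [lia|].
      replace (S m) with (1 + m)%nat by lia; rewrite Csum_split.
      rewrite (Csum_ext (fun k => a (1 + k)%nat * h ^ (1 + k))%C (fun _ => RtoC 0)).
      - rewrite Csum_zero; simpl; ring.
      - intros k Hk; rewrite Hj by lia; ring. }
    rewrite <- E1; reflexivity. }
  rewrite <- E; apply Hb, Hh.
Qed.

(** With [v] an [m]-th root of [- f z0 / a m], the leading term at [h = t * v] equals
    [- t ^ m * f z0]: it points straight at the origin, while the remainder is of order
    [t ^ (m + 1)]. *)
Lemma not_local_min (f : C -> C) (z0 : C) (a : nat -> C) (r : R) (k : nat) (eps : R) :
  0 < r -> expands f z0 a r -> f z0 <> 0 -> (1 <= k)%nat -> a k <> 0 -> 0 < eps ->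
  exists h, Cmod h < eps /\ Cmod (f (z0 + h)%C) < Cmod (f z0).
Proof.
  intros Hr H H0 Hk Hak He.
  destruct (first_nonzero a k Hak Hk) as [m [Hm [Ham Hj]]].
  destruct (expands_leading f z0 a r m Hr H Hm Hj) as [K [rho [HK [Hrho Hb]]]].
  destruct (Cpow_root (- f z0 / a m)%C m) as [v Hv]; trivial.
  { intros E; apply H0.
    replace (f z0) with (- (- f z0 / a m) * a m)%C by (field; trivial).
    rewrite E; ring. }
  apply Cmod_gt_0 in H0.
  assert (Hv0 : 0 <= Cmod v) by apply Cmod_ge_0.
  set (B := K * Cmod v ^ S m).
  assert (HB : 0 <= B) by (apply Rmult_le_pos; [trivial|apply pow_le; trivial]).
  (* The second entry keeps [t * v] within [rho] and [eps]; the third makes the remainder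
     [t ^ m * (t * B)] at most half of [t ^ m * Cmod (f z0)]. The added ones avoid division by
     zero. *)
  set (t := Rmin (1 / 2) (Rmin (Rmin rho eps / (2 * (Cmod v + 1))) (Cmod (f z0) / (2 * (B + 1))))).
  assert (Ht0 : 0 < t).
  { unfold t; repeat apply Rmin_pos; try lra; apply Rdiv_lt_0_compat; try lra.
    apply Rmin_pos; lra. }
  assert (Ht1 : t <= 1 / 2) by apply Rmin_l.
  assert (Ht2 : t * (2 * (Cmod v + 1)) <= Rmin rho eps).
  { apply Rle_trans with (Rmin rho eps / (2 * (Cmod v + 1)) * (2 * (Cmod v + 1))).
    - apply Rmult_le_compat_r; [lra|].
      unfold t; eapply Rle_trans; [apply Rmin_r|apply Rmin_l].
    - apply Req_le; field; lra. }
  assert (Ht3 : t * (2 * (B + 1)) <= Cmod (f z0)).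
  { apply Rle_trans with (Cmod (f z0) / (2 * (B + 1)) * (2 * (B + 1))).
    - apply Rmult_le_compat_r; [lra|].
      unfold t; eapply Rle_trans; [apply Rmin_r|apply Rmin_r].
    - apply Req_le; field; lra. }
  pose proof (Rmin_l rho eps); pose proof (Rmin_r rho eps).
  assert (Hmod : Cmod (RtoC t * v) = t * Cmod v)
    by (rewrite Cmod_mult, Cmod_RtoC_nonneg; lra).
  exists (RtoC t * v)%C; rewrite Hmod; split; [nra|].
  specialize (Hb (RtoC t * v)%C ltac:(rewrite Hmod; nra)).
  rewrite Hmod, Cpow_mult_l, Hv, <- RtoC_pow in Hb.
  replace (f z0 + a m * (RtoC (t ^ m) * (- f z0 / a m)))%C
    with (RtoC (1 - t ^ m) * f z0)%C in Hb by (rewrite RtoC_minus; field; trivial).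
  assert (Htm : 0 < t ^ m <= 1).
  { split; [now apply pow_lt|].
    rewrite <- (pow1 m); apply pow_incr; lra. }
  pose proof (Cmod_rev_triangle (f (z0 + RtoC t * v)%C) (RtoC (1 - t ^ m) * f z0)).
  assert (E1 : Cmod (RtoC (1 - t ^ m) * f z0) = (1 - t ^ m) * Cmod (f z0))
    by (rewrite Cmod_mult, Cmod_RtoC_nonneg; lra).
  rewrite E1 in *.
  rewrite Rpow_mult_distr in Hb.
  replace (K * (t ^ S m * Cmod v ^ S m)) with (t ^ m * (t * B)) in Hb
    by (unfold B; simpl; ring).
  nra.
Qed.

Lemma local_min_locally_constant (f : C -> C) (z0 : C) (eps : R) :
  analytic_at f z0 -> f z0 <> 0 -> 0 < eps ->
  (forall z, Cmod (z - z0) < eps -> Cmod (f z0) <= Cmod (f z)) ->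
  exists d, 0 < d /\ forall z, Cmod (z - z0) < d -> f z = f z0.
Proof.
  intros Hf H0 He Hmin.
  apply analytic_at_expands in Hf; destruct Hf as [a [r [Hr H]]].
  assert (Ha : forall k, (1 <= k)%nat -> a k = 0).
  { intros k Hk; apply NNPP; intros Hak.
    destruct (not_local_min f z0 a r k eps Hr H H0 Hk Hak He) as [h [Hh Hlt]].
    specialize (Hmin (z0 + h)%C).
    replace (z0 + h - z0)%C with h in Hmin by ring.
    specialize (Hmin Hh); lra. }
  exists r; split; trivial; intros z Hz.
  pose proof (H _ Hz) as Hs; replace (z0 + (z - z0))%C with z in Hs by ring.
  apply (cser_unique _ _ _ Hs).
  replace (f z0) with (Csum (fun k => a k * (z - z0) ^ k)%C 1).
  - apply cser_finite; intros k Hk; rewrite Ha by trivial; ring.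
  - simpl; rewrite (expands_value f z0 a r Hr H); ring.
Qed.

(** On a small circle of radius [t] the leading term has modulus [Cmod (a m) * t ^ m] and the
    remainder is at most half of it. This keeps the image of the circle away from [f z0]. *)
Lemma leading_lower_bound (f : C -> C) (z0 : C) :
  analytic_at f z0 ->
  (forall d, 0 < d -> exists z, Cmod (z - z0) < d /\ f z <> f z0) ->
  exists rho, 0 < rho /\ forall t, 0 < t <= rho ->
    exists e, 0 < e /\ forall z, Cmod (z - z0) = t -> e <= Cmod (f z - f z0).
Proof.
  intros Hf Hnc; apply analytic_at_expands in Hf; destruct Hf as [a [r [Hr H]]].
  destruct (classic (exists k, (1 <= k)%nat /\ a k <> 0)) as [[k [Hk Hak]]|Hn].
  - destruct (first_nonzero a k Hak Hk) as [m [Hm [Ham Hj]]].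
    destruct (expands_leading f z0 a r m Hr H Hm Hj) as [K [rho [HK [Hrho Hb]]]].
    apply Cmod_gt_0 in Ham.
    exists (Rmin rho (Cmod (a m) / (2 * (K + 1)))); split.
    { apply Rmin_pos; [lra|apply Rdiv_lt_0_compat; lra]. }
    intros t Ht.
    assert (Htr : t <= rho) by (eapply Rle_trans; [apply Ht|apply Rmin_l]).
    assert (HtK : t * (2 * (K + 1)) <= Cmod (a m)).
    { apply Rle_trans with (Cmod (a m) / (2 * (K + 1)) * (2 * (K + 1))).
      - apply Rmult_le_compat_r; [lra|]; eapply Rle_trans; [apply Ht|apply Rmin_r].
      - apply Req_le; field; lra. }
    assert (Htm : 0 < t ^ m) by (apply pow_lt; lra).
    exists (t ^ m * (Cmod (a m) / 2)); split; [nra|]; intros z Hz.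
    specialize (Hb (z - z0)%C ltac:(lra)).
    replace (z0 + (z - z0))%C with z in Hb by ring.
    rewrite Hz in Hb; simpl in Hb.
    replace (f z - (f z0 + a m * (z - z0) ^ m))%C
      with ((f z - f z0) - a m * (z - z0) ^ m)%C in Hb by ring.
    rewrite Cmod_minus_sym in Hb.
    pose proof (Cmod_rev_triangle (a m * (z - z0) ^ m) (f z - f z0)) as Ht2.
    rewrite Cmod_mult, Cmod_pow, Hz in Ht2.
    nra.
  - destruct (Hnc r Hr) as [z [Hz Hfz]]; exfalso; apply Hfz.
    pose proof (H _ Hz) as Hs; replace (z0 + (z - z0))%C with z in Hs by ring.
    apply (cser_unique _ _ _ Hs).
    replace (f z0) with (Csum (fun k => a k * (z - z0) ^ k)%C 1).
    + apply cser_finite; intros k Hk; replace (a k) with (RtoC 0); [ring|].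
      symmetry; apply NNPP; intros Hak; apply Hn; exists k; auto.
    + simpl; rewrite (expands_value f z0 a r Hr H); ring.
Qed.

(** If the infimum [- mu] is not attained, continuity gives each point of the disk a gauge [d] such
    that [F] is at least [- mu + d] within [d]. Points outside receive a gauge so small that it
    misses the disk. Compactness of the surrounding square makes [d] uniform, contradicting the
    infimum. *)
Lemma closed_disk_min (F : C -> R) (c : C) (r : R) :
  0 <= r -> (forall z, 0 <= F z) ->
  (forall z eps, Cmod (z - c) <= r -> 0 < eps ->
     exists d, 0 < d /\ forall z', Cmod (z' - z) < d -> Rabs (F z' - F z) < eps) ->
  exists z0, Cmod (z0 - c) <= r /\ forall z, Cmod (z - c) <= r -> F z0 <= F z.
Proof.
  intros Hr HF Hcont.
  set (E := fun x => exists z, Cmod (z - c) <= r /\ x = - F z).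
  destruct (completeness E) as [mu [Hub Hlub]].
  { exists 0; intros x [z [_ ->]]; specialize (HF z); lra. }
  { exists (- F c), c; split; trivial.
    replace (c - c)%C with (RtoC 0) by ring; rewrite Cmod_0; lra. }
  apply NNPP; intros Hno.
  assert (Hgt : forall z, Cmod (z - c) <= r -> - mu < F z).
  { intros z Hz.
    assert (- F z <= mu) as [Hlt|Heq] by (apply Hub; exists z; auto); [lra|].
    exfalso; apply Hno; exists z; split; trivial; intros z' Hz'.
    assert (- F z' <= mu) by (apply Hub; exists z'; auto); lra. }
  assert (Hd : forall u v, exists d : posreal, forall q, Cmod (q - c) <= r ->
    Rabs (Re q - u) < d -> Rabs (Im q - v) < d -> - mu + d <= F q).
  { intros u v; destruct (Rle_or_lt (Cmod ((u, v) - c)) r) as [Hin|Hout].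
    - specialize (Hgt _ Hin).
      destruct (Hcont (u, v) ((F (u, v) + mu) / 2) Hin ltac:(lra)) as [d [Hd Hq]].
      assert (Hp : 0 < Rmin (d / 2) ((F (u, v) + mu) / 2)) by (apply Rmin_pos; lra).
      exists (mkposreal _ Hp); simpl; intros q Hqc Hu Hv.
      pose proof (Rmin_l (d / 2) ((F (u, v) + mu) / 2)).
      pose proof (Rmin_r (d / 2) ((F (u, v) + mu) / 2)).
      assert (Hqq : Cmod (q - (u, v)) < d).
      { eapply Rle_lt_trans; [apply Cmod_le_Re_Im|].
        rewrite re_minus, im_minus; simpl; lra. }
      specialize (Hq q Hqq); apply Rabs_def2 in Hq; lra.
    - assert (Hp : 0 < (Cmod ((u, v) - c) - r) / 2) by lra.
      exists (mkposreal _ Hp); simpl; intros q Hqc Hu Hv; exfalso.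
      assert (Cmod ((u, v) - q) < Cmod ((u, v) - c) - r).
      { rewrite Cmod_minus_sym; eapply Rle_lt_trans; [apply Cmod_le_Re_Im|].
        rewrite re_minus, im_minus; simpl; lra. }
      pose proof (Cmod_triangle3 (u, v) q c); lra. }
  set (delta := fun u v => proj1_sig (constructive_indefinite_description _ (Hd u v))).
  assert (Hdelta : forall u v q, Cmod (q - c) <= r ->
    Rabs (Re q - u) < delta u v -> Rabs (Im q - v) < delta u v -> - mu + delta u v <= F q).
  { intros u v; unfold delta; apply proj2_sig. }
  destruct (compactness_value_2d (Re c - r) (Re c + r) (Im c - r) (Im c + r) delta)
    as [d Hcomp].
  assert (mu <= mu - d); [|pose proof (cond_pos d); lra].
  apply Hlub; intros x [q [Hq ->]].
  apply Rnot_lt_le; intros Hlt.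
  pose proof (re_le_Cmod (q - c)) as HR; pose proof (im_le_Cmod (q - c)) as HI.
  rewrite re_minus in HR; rewrite im_minus in HI.
  apply (Hcomp (Re q) (Im q)).
  - apply Rabs_le_between in HR; lra.
  - apply Rabs_le_between in HI; lra.
  - intros [u [v [_ [_ [Hu [Hv Hle]]]]]].
    specialize (Hdelta u v q Hq Hu Hv); lra.
Qed.

(** Connectedness of the unit interval in one-sided form: truth spreads to the right, falsity to the
    left. The supremum of the initial segments on which [A] holds can only be 1, and it is
    reached. *)
Lemma interval_connected (A : R -> Prop) :
  A 0 ->
  (forall t, 0 <= t < 1 -> A t -> exists d, 0 < d /\ forall s, t <= s < t + d -> A s) ->
  (forall t, 0 <= t <= 1 -> ~ A t -> exists d, 0 < d /\ forall s, t - d < s <= t -> ~ A s) ->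
  A 1.
Proof.
  intros H0 Hopen Hclosed.
  set (E := fun t => 0 <= t <= 1 /\ forall s, 0 <= s <= t -> A s).
  destruct (completeness E) as [T [Hub Hlub]].
  { exists 1; intros t [Ht _]; lra. }
  { exists 0; split; [lra|]; intros s Hs; replace s with 0 by lra; trivial. }
  assert (HT0 : 0 <= T) by (apply Hub; split; [lra|]; intros s Hs; replace s with 0 by lra; trivial).
  assert (HT1 : T <= 1) by (apply Hlub; intros t [Ht _]; lra).
  assert (Hbelow : forall s, 0 <= s < T -> A s).
  { intros s Hs; apply NNPP; intros Hn.
    assert (T <= s); [|lra].
    apply Hlub; intros t [Ht HA]; apply Rnot_lt_le; intros Hlt; apply Hn, HA; lra. }
  assert (HAT : A T).
  { apply NNPP; intros Hn; destruct (Hclosed T ltac:(lra) Hn) as [d [Hd Hs]].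
    destruct (Req_dec T 0) as [E0|E0]; [rewrite E0 in Hn; auto|].
    apply (Hs (Rmax 0 (T - d / 2))).
    - split; [eapply Rlt_le_trans; [|apply Rmax_r]; lra|apply Rmax_lub; lra].
    - apply Hbelow; split; [apply Rmax_l|apply Rmax_lub_lt; lra]. }
  destruct (Req_dec T 1) as [<-|HT]; trivial.
  destruct (Hopen T ltac:(lra) HAT) as [d [Hd Hs]].
  set (T' := Rmin 1 (T + d / 2)).
  assert (T < T') by (apply Rmin_glb_lt; lra).
  assert (T' <= T + d / 2) by apply Rmin_r.
  assert (T' <= 1) by apply Rmin_l.
  assert (T' <= T); [|lra].
  apply Hub; split; [lra|]; intros s Hs'.
  destruct (Rlt_or_le s T); [apply Hbelow; lra|apply Hs; lra].
Qed.

(** A minimum below [mu] is attained at an interior point [z0]. On the segment [p] from [z0] to the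
    boundary point [c + r] the modulus keeps this value: at each interior point of the segment where
    it is taken, [g] is locally constant, and continuity carries it to the end, where it contradicts
    the bound on the circle. *)
Lemma min_modulus_principle (g : C -> C) (c : C) (r mu : R) :
  0 <= r -> (forall z, Cmod (z - c) <= r -> analytic_at g z) ->
  (forall z, Cmod (z - c) <= r -> g z <> 0) ->
  (forall z, Cmod (z - c) = r -> mu <= Cmod (g z)) ->
  forall z, Cmod (z - c) <= r -> mu <= Cmod (g z).
Proof.
  intros Hr Hg Hnz Hmu z Hz; apply Rnot_lt_le; intros Hlt.
  assert (Hcont : forall z eps, Cmod (z - c) <= r -> 0 < eps ->
    exists d, 0 < d /\ forall z', Cmod (z' - z) < d ->
      Rabs (Cmod (g z') - Cmod (g z)) < eps).
  { intros z1 eps Hz1 He.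
    destruct (analytic_at_continuous g z1 eps (Hg z1 Hz1) He) as [d [Hd H]].
    exists d; split; trivial; intros z' Hz'; specialize (H z' Hz').
    pose proof (Cmod_rev_triangle (g z') (g z1)).
    pose proof (Cmod_rev_triangle (g z1) (g z')).
    rewrite (Cmod_minus_sym (g z1)) in *; apply Rabs_def1; lra. }
  destruct (closed_disk_min (fun z => Cmod (g z)) c r Hr (fun z => Cmod_ge_0 _) Hcont)
    as [z0 [Hz0 Hmin]].
  assert (Hlt0 : Cmod (g z0) < mu) by (specialize (Hmin z Hz); lra).
  set (p := fun t : R => (z0 + t * (c + r - z0))%C).
  assert (Hp : forall t, 0 <= t <= 1 -> Cmod (p t - c) <= (1 - t) * Cmod (z0 - c) + t * r).
  { intros t Ht; unfold p.
    replace (z0 + t * (c + r - z0) - c)%C with (RtoC (1 - t) * (z0 - c) + t * r)%C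
      by (rewrite RtoC_minus; ring).
    eapply Rle_trans; [apply Cmod_triangle|].
    rewrite !Cmod_mult, !Cmod_RtoC_nonneg by lra; lra. }
  assert (Hpp : forall s t, Cmod (p s - p t) = Rabs (s - t) * Cmod (c + r - z0)).
  { intros s t; unfold p.
    replace (z0 + s * (c + r - z0) - (z0 + t * (c + r - z0)))%C
      with (RtoC (s - t) * (c + r - z0))%C by (rewrite RtoC_minus; ring).
    now rewrite Cmod_mult, Cmod_R. }
  set (L := Cmod (c + r - z0)) in *.
  assert (HL : 0 <= L) by apply Cmod_ge_0.
  assert (Hpd : forall t d, 0 < d -> exists e, 0 < e /\
    forall s, Rabs (s - t) < e -> Cmod (p s - p t) < d).
  { intros t d Hd; exists (d / (L + 1)); split; [apply Rdiv_lt_0_compat; lra|].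
    intros s Hs; rewrite Hpp.
    apply (Rmult_lt_compat_r (L + 1)) in Hs; [|lra].
    unfold Rdiv in Hs; rewrite Rmult_assoc, Rinv_l in Hs by lra.
    pose proof (Rabs_pos (s - t)); nra. }
  assert (H1 : Cmod (g (p 1)) = Cmod (g z0)).
  { apply (interval_connected (fun t => Cmod (g (p t)) = Cmod (g z0))).
    - f_equal; f_equal; unfold p; ring.
    - intros t Ht HA.
      assert (Hz0r : Cmod (z0 - c) < r).
      { destruct Hz0; trivial; specialize (Hmu z0 H); lra. }
      assert (Hin : Cmod (p t - c) < r) by (specialize (Hp t ltac:(lra)); nra).
      destruct (local_min_locally_constant g (p t) (r - Cmod (p t - c))) as [d [Hd Hc]].
      + apply Hg; lra.
      + apply Hnz; lra.
      + lra.
      + intros z' Hz'; rewrite HA; apply Hmin.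
        pose proof (Cmod_triangle3 z' (p t) c); lra.
      + destruct (Hpd t d Hd) as [e [He Hs]]; exists e; split; trivial.
        intros s Hst; rewrite <- HA, (Hc (p s)); trivial.
        apply Hs, Rabs_def1; lra.
    - intros t Ht HA.
      assert (Hin : Cmod (p t - c) <= r) by (specialize (Hp t Ht); nra).
      assert (He : 0 < Rabs (Cmod (g (p t)) - Cmod (g z0))) by (apply Rabs_pos_lt; lra).
      destruct (Hcont (p t) _ Hin He) as [d [Hd Hc]].
      destruct (Hpd t d Hd) as [e [He' Hs]]; exists e; split; trivial.
      intros s Hst HAs; specialize (Hc (p s)).
      rewrite HAs, Rabs_minus_sym in Hc.
      assert (Cmod (p s - p t) < d) by (apply Hs, Rabs_def1; lra).
      specialize (Hc H); lra. }
  assert (Hmu1 : mu <= Cmod (g (p 1))); [|lra].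
  apply Hmu; unfold p.
  replace (z0 + RtoC 1 * (c + r - z0) - c)%C with (RtoC r) by ring.
  now rewrite Cmod_RtoC_nonneg.
Qed.

(** If [u] were omitted near [z0], then [f - u] would be zero-free on a small disk, with modulus at
    least [e / 2] on its circle and less than [e / 2] at the centre. *)
Lemma open_mapping (f : C -> C) (z0 : C) (R0 eps : R) :
  0 < R0 -> 0 < eps -> (forall z, Cmod (z - z0) < R0 -> analytic_at f z) ->
  (forall d, 0 < d -> exists z, Cmod (z - z0) < d /\ f z <> f z0) ->
  exists d, 0 < d /\ forall u, Cmod (u - f z0) < d ->
    exists z, Cmod (z - z0) < eps /\ f z = u.
Proof.
  intros HR He Hf Hnc.
  assert (E0 : Cmod (z0 - z0) = 0)
    by (replace (z0 - z0)%C with (RtoC 0) by ring; apply Cmod_0).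
  destruct (leading_lower_bound f z0) as [rho [Hrho Hlow]]; trivial.
  { apply Hf; lra. }
  set (t := Rmin rho (Rmin (R0 / 2) (eps / 2))).
  assert (Ht : 0 < t <= rho).
  { split; [unfold t; repeat apply Rmin_pos; lra|apply Rmin_l]. }
  assert (Ht2 : t <= R0 / 2) by (unfold t; eapply Rle_trans; [apply Rmin_r|apply Rmin_l]).
  assert (Ht3 : t <= eps / 2) by (unfold t; eapply Rle_trans; [apply Rmin_r|apply Rmin_r]).
  destruct (Hlow t Ht) as [e [Hep Hcirc]].
  exists (e / 2); split; [lra|]; intros u Hu.
  apply NNPP; intros Hno.
  assert (e / 2 <= Cmod (f z0 - u)); [|rewrite Cmod_minus_sym in Hu; lra].
  apply (min_modulus_principle (fun z => f z - u)%C z0 t (e / 2)); try lra.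
  - intros z Hz; apply analytic_at_minus; [apply Hf; lra|apply analytic_at_const].
  - intros z Hz E; apply Hno; exists z; split; [lra|now apply Ceq_minus].
  - intros z Hz; specialize (Hcirc z Hz).
    pose proof (Cmod_triangle3 (f z) u (f z0)); lra.
Qed.

(** * Blaschke factors *)

Lemma Cinv_nonzero (z : C) : z <> 0 -> (/ z)%C <> 0.
Proof. intros Hz E; apply C1_nz; rewrite <- (Cinv_r z Hz), E; ring. Qed.

Lemma one_plus_nonzero (u : C) : Cmod u < 1 -> (1 + u)%C <> 0.
Proof.
  intros Hu E; replace u with (- (1))%C in Hu.
  - rewrite Cmod_opp, Cmod_1 in Hu; lra.
  - replace u with ((1 + u) - 1)%C by ring; rewrite E; ring.
Qed.

(** For [Cmod u < 1] the right side is positive when [v] is inside the disk and zero when [v] is on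
    the circle; both mapping properties of Blaschke factors follow. *)
Lemma pick_identity (u v : C) :
  Cmod (1 - Cconj u * v) ^ 2 - Cmod (v - u) ^ 2 = (1 - Cmod u ^ 2) * (1 - Cmod v ^ 2).
Proof.
  rewrite !Cmod2_alt; destruct u as [a b], v as [c d]; simpl; ring.
Qed.

Lemma blaschke_den (a z : C) : Cmod a < 1 -> Cmod z <= 1 -> (1 - Cconj a * z)%C <> 0.
Proof.
  intros Ha Hz; replace (1 - Cconj a * z)%C with (1 + - (Cconj a * z))%C by ring.
  apply one_plus_nonzero; rewrite Cmod_opp, Cmod_mult, Cmod_conj.
  pose proof (Cmod_ge_0 a); pose proof (Cmod_ge_0 z); nra.
Qed.

Lemma blaschke_lt_1 (a z : C) : Cmod a < 1 -> Cmod z < 1 ->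
  Cmod ((z - a) / (1 - Cconj a * z)) < 1.
Proof.
  intros Ha Hz; pose proof (blaschke_den a z Ha ltac:(lra)) as Hd.
  rewrite Cmod_div by trivial; apply Cmod_gt_0 in Hd.
  pose proof (pick_identity a z) as Hp.
  pose proof (Cmod_ge_0 a); pose proof (Cmod_ge_0 z); pose proof (Cmod_ge_0 (z - a)).
  assert (0 < (1 - Cmod a ^ 2) * (1 - Cmod z ^ 2)) by (apply Rmult_lt_0_compat; nra).
  apply (Rmult_lt_reg_r (Cmod (1 - Cconj a * z))); trivial.
  unfold Rdiv; rewrite Rmult_assoc, Rinv_l, Rmult_1_r, Rmult_1_l by lra.
  apply Rsqr_incrst_0; [|trivial|lra]; rewrite !Rsqr_pow2; lra.
Qed.

Lemma blaschke_circle (a z : C) : Cmod a < 1 -> Cmod z = 1 ->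
  Cmod ((z - a) / (1 - Cconj a * z)) = 1.
Proof.
  intros Ha Hz; pose proof (blaschke_den a z Ha ltac:(lra)) as Hd.
  rewrite Cmod_div by trivial; apply Cmod_gt_0 in Hd.
  replace (Cmod (z - a)) with (Cmod (1 - Cconj a * z)); [field; lra|].
  apply Rsqr_inj; try apply Cmod_ge_0; rewrite !Rsqr_pow2.
  pose proof (pick_identity a z) as Hp; rewrite Hz in Hp; lra.
Qed.

Lemma blaschke_analytic (a : C) (f : C -> C) (z : C) :
  Cmod a < 1 -> analytic_at f z -> Cmod (f z) <= 1 ->
  analytic_at (fun z => (f z - a) / (1 - Cconj a * f z))%C z.
Proof.
  intros Ha Hf Hz.
  apply (analytic_at_mult (fun z => f z - a)%C (fun z => / (1 - Cconj a * f z))%C).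
  - apply analytic_at_minus; [trivial|apply analytic_at_const].
  - apply (analytic_at_inv (fun z => 1 - Cconj a * f z)%C); [|now apply blaschke_den].
    apply analytic_at_minus; [apply analytic_at_const|now apply analytic_at_scal].
Qed.

(** The minimum modulus principle for [g] and for [/ g] gives modulus one everywhere. Every interior
    point is then a local minimum of the modulus, so [g] is locally constant, and constant along
    each radius by connectedness. *)
Lemma unimodular_constant (g : C -> C) :
  (forall z, Cmod z <= 1 -> analytic_at g z) -> (forall z, Cmod z <= 1 -> g z <> 0) ->
  (forall z, Cmod z = 1 -> Cmod (g z) = 1) ->
  Cmod (g 0) = 1 /\ forall z, Cmod z < 1 -> g z = g 0.
Proof.
  intros Hg Hnz H1.
  assert (Em : forall z, (z - 0)%C = z) by (intros; ring).
  assert (Hge : forall z, Cmod z <= 1 -> 1 <= Cmod (g z)).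
  { intros z Hz; apply (min_modulus_principle g 0 1 1); try lra;
      try (intros z'; rewrite Em; auto).
    - intros Hz'; rewrite H1; lra.
    - now rewrite Em. }
  assert (Hle : forall z, Cmod z <= 1 -> Cmod (g z) <= 1).
  { intros z Hz.
    assert (Hi : 1 <= Cmod (/ g z)).
    { apply (min_modulus_principle (fun z => / g z)%C 0 1 1); try lra;
        try (intros z'; rewrite Em; intros Hz').
      - apply analytic_at_inv; auto.
      - now apply Cinv_nonzero, Hnz.
      - rewrite Cmod_inv, H1, Rinv_1 by (trivial; apply Hnz; lra); lra.
      - now rewrite Em. }
    pose proof (Hnz z Hz) as Hn.
    rewrite Cmod_inv in Hi by trivial; apply Cmod_gt_0 in Hn.
    apply (Rmult_le_compat_r (Cmod (g z))) in Hi; [|lra].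
    rewrite Rinv_l in Hi; lra. }
  assert (Heq : forall z, Cmod z <= 1 -> Cmod (g z) = 1)
    by (intros z Hz; apply Rle_antisym; auto).
  assert (H0 : Cmod 0 <= 1) by (rewrite Cmod_0; lra).
  split; [now apply Heq|]; intros z Hz.
  assert (Hloc : forall t, 0 <= t <= 1 -> exists e, 0 < e /\
    forall s, Rabs (s - t) < e -> g (s * z)%C = g (t * z)%C).
  { intros t Ht.
    assert (Htz : Cmod (t * z) < 1).
    { rewrite Cmod_mult, Cmod_RtoC_nonneg by lra; pose proof (Cmod_ge_0 z); nra. }
    destruct (local_min_locally_constant g (t * z)%C (1 - Cmod (t * z))) as [d [Hd Hc]].
    - apply Hg; lra.
    - apply Hnz; lra.
    - lra.
    - intros z' Hz'; pose proof (Cmod_rev_triangle z' (t * z)).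
      rewrite !Heq; lra.
    - exists d; split; trivial; intros s Hs; apply Hc.
      replace (s * z - t * z)%C with (RtoC (s - t) * z)%C by (rewrite RtoC_minus; ring).
      rewrite Cmod_mult, Cmod_R; pose proof (Rabs_pos (s - t)); pose proof (Cmod_ge_0 z); nra. }
  replace z with (RtoC 1 * z)%C at 1 by ring.
  apply (interval_connected (fun t => g (t * z)%C = g 0)).
  - f_equal; ring.
  - intros t Ht HA; destruct (Hloc t ltac:(lra)) as [e [He Hs]]; exists e; split; trivial.
    intros s Hst; rewrite Hs; trivial; apply Rabs_def1; lra.
  - intros t Ht HA; destruct (Hloc t Ht) as [e [He Hs]]; exists e; split; trivial.
    intros s Hst HAs; apply HA; rewrite <- HAs; symmetry; apply Hs, Rabs_def1; lra.
Qed.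

(** * The space H2 as a weighted sequence space *)

(** A first nonzero coefficient [c m] would make [Cmod (c m) * t ^ m] at most a constant times
    [t ^ (m + 1)] for all small [t]. *)
Lemma expands_zero (c : nat -> C) (z0 : C) (r : R) :
  0 < r -> expands (fun _ => RtoC 0) z0 c r -> forall k, c k = 0.
Proof.
  intros Hr H k.
  destruct (Nat.eq_dec k 0) as [->|Hk]; [symmetry; exact (expands_value _ _ _ _ Hr H)|].
  apply NNPP; intros Hck.
  destruct (first_nonzero c k Hck ltac:(lia)) as [m [Hm [Hcm Hj]]].
  destruct (expands_leading _ z0 c r m Hr H Hm Hj) as [K [rho [HK [Hrho Hb]]]].
  apply Cmod_gt_0 in Hcm.
  set (t := Rmin rho (Cmod (c m) / (2 * (K + 1)))).
  assert (Ht : 0 < t).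
  { apply Rmin_pos; [lra|apply Rdiv_lt_0_compat; lra]. }
  assert (HtK : t * (2 * (K + 1)) <= Cmod (c m)).
  { apply Rle_trans with (Cmod (c m) / (2 * (K + 1)) * (2 * (K + 1))).
    - apply Rmult_le_compat_r; [lra|apply Rmin_r].
    - apply Req_le; field; lra. }
  specialize (Hb (RtoC t)); rewrite Cmod_RtoC_nonneg in Hb by lra.
  specialize (Hb (Rmin_l _ _)).
  replace (0 - (0 + c m * t ^ m))%C with (- (c m * t ^ m))%C in Hb by ring.
  rewrite Cmod_opp, Cmod_mult, Cmod_pow, Cmod_RtoC_nonneg in Hb by lra.
  simpl in Hb; assert (0 < t ^ m) by now apply pow_lt.
  nra.
Qed.

Lemma disk_expansion_cser (f : disk -> C) (a : nat -> C) :
  disk_expansion f a <-> forall z : disk, cser (fun k => a k * (z : C) ^ k)%C (f z).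
Proof.
  unfold disk_expansion; split; intros H z; apply is_pseries_cser, H.
Qed.

Lemma disk_expansion_unique (f : disk -> C) (a b : nat -> C) :
  disk_expansion f a -> disk_expansion f b -> forall k, a k = b k.
Proof.
  intros Ha Hb k; apply Ceq_minus; revert k.
  apply (expands_zero (fun k => a k - b k)%C 0 1 Rlt_0_1); intros h Hh.
  pose proof (proj1 (disk_expansion_cser f a) Ha (exist _ h Hh)) as Ha'.
  pose proof (proj1 (disk_expansion_cser f b) Hb (exist _ h Hh)) as Hb'.
  simpl in Ha', Hb'.
  replace (RtoC 0) with (f (exist _ h Hh) + (-(1)) * f (exist _ h Hh))%C by ring.
  eapply cser_ext; [|apply (cser_plus _ _ _ _ Ha' (cser_scal (-(1)) _ _ Hb'))].
  intros k; simpl; ring.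
Qed.

Lemma taylor_coeff_eq (f : disk -> C) (a : nat -> C) :
  disk_expansion f a -> forall k, taylor_coeff f k = a k.
Proof.
  intros H k; unfold taylor_coeff.
  apply (iota_unique (V := C_CompleteNormedModule)).
  - intros c [b [Hb <-]]; exact (disk_expansion_unique f b a Hb H k).
  - exists a; auto.
Qed.

Lemma disk_expansion_plus (f g : disk -> C) (a b : nat -> C) :
  disk_expansion f a -> disk_expansion g b ->
  disk_expansion (plus f g) (fun k => a k + b k)%C.
Proof.
  rewrite !disk_expansion_cser; intros Ha Hb z.
  eapply cser_ext; [|exact (cser_plus _ _ _ _ (Ha z) (Hb z))]; intros k; simpl; ring.
Qed.

Lemma disk_expansion_scal (c : C) (f : disk -> C) (a : nat -> C) :
  disk_expansion f a -> disk_expansion (scal c f) (fun k => c * a k)%C.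
Proof.
  rewrite !disk_expansion_cser; intros Ha z.
  eapply cser_ext; [|exact (cser_scal c _ _ (Ha z))]; intros k; simpl; ring.
Qed.

Lemma finite_lower_bound (u : nat -> R) (n : nat) :
  (forall k, 0 < u k) -> exists c, 0 < c /\ forall k, (k <= n)%nat -> c <= u k.
Proof.
  intros Hu; induction n as [|n [c [Hc IH]]].
  - exists (u O); split; trivial; intros k Hk; replace k with O by lia; lra.
  - exists (Rmin c (u (S n))); split; [now apply Rmin_pos|]; intros k Hk.
    destruct (Nat.eq_dec k (S n)) as [->|]; [apply Rmin_r|].
    eapply Rle_trans; [apply Rmin_l|apply IH; lia].
Qed.

(** * Weights, norms and point evaluations *)

Section Weight.

Variable w : nat -> R.
Hypothesis hw : Hardy_weight w.

Lemma beta_pos (k : nat) : 0 < beta w k.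
Proof.
  induction k as [|k IH]; simpl; [lra|].
  apply Rmult_lt_0_compat; trivial; apply (proj1 hw); lia.
Qed.

(** Since the weights tend to 1, they eventually exceed [q], and from there on [beta w k / q ^ k]
    does not decrease; the finitely many earlier values have a positive lower bound. *)
Lemma beta_lower (q : R) : 0 < q < 1 -> exists c, 0 < c /\ forall k, c * q ^ k <= beta w k.
Proof.
  intros Hq.
  pose proof (proj2 hw) as Hl; apply is_lim_seq_spec in Hl.
  assert (Hp : 0 < 1 - q) by lra.
  destruct (Hl (mkposreal _ Hp)) as [N HN].
  destruct (finite_lower_bound (fun k => beta w k / q ^ k) N) as [c [Hc Hck]].
  { intros k; apply Rdiv_lt_0_compat; [apply beta_pos|apply pow_lt; lra]. }
  exists c; split; trivial.
  assert (Hall : forall k, c <= beta w k / q ^ k).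
  { induction k as [|k IH]; [apply Hck; lia|].
    destruct (Nat.le_gt_cases (S k) N) as [Hk|Hk]; [now apply Hck|].
    eapply Rle_trans; [exact IH|].
    specialize (HN (S k) ltac:(lia)); simpl in HN; apply Rabs_def2 in HN.
    simpl; replace (beta w k * w (S k) / (q * q ^ k))
      with ((beta w k / q ^ k) * (w (S k) / q)) by (field; split; [apply pow_nonzero|]; lra).
    rewrite <- (Rmult_1_r (beta w k / q ^ k)) at 1.
    apply Rmult_le_compat_l; [lra|].
    apply (Rmult_le_reg_r q); [lra|].
    unfold Rdiv; rewrite Rmult_assoc, Rinv_l; lra. }
  intros k; specialize (Hall k); assert (0 < q ^ k) by (apply pow_lt; lra).
  apply (Rmult_le_compat_r (q ^ k)) in Hall; [|lra].
  unfold Rdiv in Hall; rewrite Rmult_assoc, Rinv_l, Rmult_1_r in Hall; lra.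
Qed.

(** Partial sums of the squared norm [nrm2]. Estimates are stated for all of them at once, which
    yields membership in [l2] and the norm bound together through [l2_of_bound]. *)
Definition nsq (a : nat -> C) (n : nat) : R :=
  Rsum (fun k => (Cmod (a k))^2 * (beta w k)^2) n.

Definition l2 (a : nat -> C) : Prop :=
  ex_series (fun k => (Cmod (a k))^2 * (beta w k)^2).

Definition nrm2 (a : nat -> C) : R :=
  Series (fun k => (Cmod (a k))^2 * (beta w k)^2).

Lemma nsq_term_nonneg (a : nat -> C) (k : nat) : 0 <= (Cmod (a k))^2 * (beta w k)^2.
Proof. apply Rmult_le_pos; apply pow2_ge_0. Qed.

Lemma l2_of_bound (a : nat -> C) (M : R) :
  (forall n, nsq a n <= M) -> l2 a /\ nrm2 a <= M.
Proof. apply series_of_bounded, nsq_term_nonneg. Qed.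

Lemma nsq_le_nrm2 (a : nat -> C) (n : nat) : l2 a -> nsq a n <= nrm2 a.
Proof. intros H; apply Rsum_le_Series; trivial; apply nsq_term_nonneg. Qed.

Lemma nrm2_nonneg (a : nat -> C) : l2 a -> 0 <= nrm2 a.
Proof. intros H; exact (nsq_le_nrm2 a 0 H). Qed.

Lemma nsq_nonneg (a : nat -> C) (n : nat) : 0 <= nsq a n.
Proof. apply Rsum_nonneg, nsq_term_nonneg. Qed.

Lemma l2_ext (a b : nat -> C) : (forall k, a k = b k) -> l2 a -> l2 b.
Proof. intros H; apply ex_series_ext; intros k; now rewrite H. Qed.

Lemma l2_coef_le (a : nat -> C) (M : R) (k : nat) :
  0 <= M -> nsq a (S k) <= M ^ 2 -> Cmod (a k) * beta w k <= M.
Proof.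
  intros HM H; unfold nsq in H; simpl Rsum in H.
  pose proof (nsq_nonneg a k) as H0; unfold nsq in H0.
  apply Rsqr_incr_0_var; trivial; unfold Rsqr.
  simpl in *; nra.
Qed.

(** Point evaluations are bounded, with one constant [E] on the whole disk of radius [rho]. A
    coefficient is at most [M / beta w k], and [beta_lower] with [q] halfway between [rho] and 1
    makes the series geometric of ratio [rho / q]. *)
Lemma l2_eval (rho : R) :
  0 <= rho < 1 -> exists E, 0 <= E /\ forall a M, 0 <= M -> (forall n, nsq a n <= M ^ 2) ->
    forall z, Cmod z <= rho ->
      cser (fun k => a k * z ^ k)%C (C_Series (fun k => a k * z ^ k)%C) /\
      Cmod (C_Series (fun k => a k * z ^ k)%C) <= E * M.
Proof.
  intros Hrho.
  destruct (beta_lower ((1 + rho) / 2) ltac:(lra)) as [c [Hc Hb]].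
  set (q := (1 + rho) / 2) in *.
  assert (Hq : 0 <= rho / q < 1).
  { split; [apply Rdiv_le_0_compat; unfold q; lra|].
    apply (Rdiv_lt_1 rho); unfold q; lra. }
  exists (/ c * / (1 - rho / q)).
  assert (0 < / c) by now apply Rinv_0_lt_compat.
  assert (0 < / (1 - rho / q)) by (apply Rinv_0_lt_compat; lra).
  split; [apply Rmult_le_pos; lra|].
  intros a M HM Ha z Hz; apply cser_abs; intros n.
  replace (/ c * / (1 - rho / q) * M) with ((/ c * M) * / (1 - rho / q)) by ring.
  apply geom_bound_sum; trivial; [apply Rmult_le_pos; lra|]; intros k.
  rewrite Cmod_mult, Cmod_pow.
  pose proof (l2_coef_le a M k HM (Ha (S k))) as H1; specialize (Hb k).
  assert (Hqk : 0 < q ^ k) by (apply pow_lt; unfold q; lra).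
  assert (H2 : Cmod (a k) * (c * q ^ k) <= M).
  { eapply Rle_trans; [|exact H1]; apply Rmult_le_compat_l; [apply Cmod_ge_0|trivial]. }
  replace ((rho / q) ^ k) with (rho ^ k * / q ^ k).
  2: { unfold Rdiv; rewrite Rpow_mult_distr, pow_inv; reflexivity. }
  assert (H3 : Cmod (a k) <= / c * M * / q ^ k).
  { apply (Rmult_le_reg_r (c * q ^ k)); [apply Rmult_lt_0_compat; lra|].
    eapply Rle_trans; [exact H2|]; apply Req_le; field; split; lra. }
  replace (/ c * M * (rho ^ k * / q ^ k)) with ((/ c * M * / q ^ k) * rho ^ k) by ring.
  apply Rmult_le_compat; trivial.
  - apply Cmod_ge_0.
  - apply pow_le, Cmod_ge_0.
  - apply pow_incr; split; [apply Cmod_ge_0|trivial].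
Qed.

Definition fn (a : nat -> C) : disk -> C :=
  fun z => C_Series (fun k => a k * (z : C) ^ k)%C.

Lemma l2_sqrt_bound (a : nat -> C) : l2 a -> forall n, nsq a n <= sqrt (nrm2 a) ^ 2.
Proof.
  intros H n; rewrite pow2_sqrt by now apply nrm2_nonneg.
  now apply nsq_le_nrm2.
Qed.

Lemma fn_expansion (a : nat -> C) : l2 a -> disk_expansion (fn a) a.
Proof.
  intros Ha; apply disk_expansion_cser; intros [z Hz]; unfold fn; simpl.
  destruct (l2_eval (Cmod z)) as [E [_ HE]]; [split; [apply Cmod_ge_0|trivial]|].
  apply (HE a (sqrt (nrm2 a))); [apply sqrt_pos|now apply l2_sqrt_bound|lra].
Qed.

Lemma H2_fn (a : nat -> C) : l2 a -> H2 w (fn a).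
Proof. intros Ha; exists a; split; trivial; now apply fn_expansion. Qed.

Lemma disk_expansion_fn (f : disk -> C) (a : nat -> C) : disk_expansion f a -> f = fn a.
Proof.
  intros H; apply functional_extensionality; intros z; symmetry.
  apply cser_C_Series; now apply disk_expansion_cser.
Qed.

Lemma H2_coef (f : disk -> C) :
  H2 w f -> disk_expansion f (taylor_coeff f) /\ l2 (taylor_coeff f).
Proof.
  intros [a [Ha Hl]].
  assert (E : taylor_coeff f = a)
    by (apply functional_extensionality; now apply taylor_coeff_eq).
  rewrite E; auto.
Qed.

Lemma taylor_coeff_fn (a : nat -> C) : l2 a -> taylor_coeff (fn a) = a.
Proof.
  intros Ha; apply functional_extensionality; now apply taylor_coeff_eq, fn_expansion.
Qed.

Lemma H2_ext (f g : disk -> C) :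
  H2 w f -> H2 w g -> (forall k, taylor_coeff f k = taylor_coeff g k) -> f = g.
Proof.
  intros Hf Hg H; apply H2_coef in Hf; apply H2_coef in Hg.
  rewrite (disk_expansion_fn f _ (proj1 Hf)), (disk_expansion_fn g _ (proj1 Hg)).
  f_equal; now apply functional_extensionality.
Qed.

Lemma Cmod_plus_sq (x y : C) : Cmod (x + y) ^ 2 <= 2 * Cmod x ^ 2 + 2 * Cmod y ^ 2.
Proof.
  pose proof (Cmod_triangle x y); pose proof (Cmod_ge_0 (x + y)).
  pose proof (Cmod_ge_0 x); pose proof (Cmod_ge_0 y).
  apply Rle_trans with ((Cmod x + Cmod y) ^ 2); [apply pow_incr; lra|].
  pose proof (pow2_ge_0 (Cmod x - Cmod y)); nra.
Qed.

Lemma l2_plus (a b : nat -> C) : l2 a -> l2 b -> l2 (fun k => a k + b k)%C.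
Proof.
  intros Ha Hb; apply (l2_of_bound _ (2 * nrm2 a + 2 * nrm2 b)); intros n.
  apply Rle_trans with (2 * nsq a n + 2 * nsq b n).
  - unfold nsq; rewrite <- !Rsum_scal, <- Rsum_plus; apply Rsum_le; intros k _.
    pose proof (Cmod_plus_sq (a k) (b k)); pose proof (pow2_ge_0 (beta w k)); nra.
  - pose proof (nsq_le_nrm2 a n Ha); pose proof (nsq_le_nrm2 b n Hb); lra.
Qed.

Lemma nsq_scal (c : C) (a : nat -> C) (n : nat) :
  nsq (fun k => c * a k)%C n = Cmod c ^ 2 * nsq a n.
Proof.
  unfold nsq; rewrite <- Rsum_scal; apply Rsum_ext; intros k _.
  rewrite Cmod_mult; ring.
Qed.

Lemma l2_scal (c : C) (a : nat -> C) : l2 a -> l2 (fun k => c * a k)%C.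
Proof.
  intros Ha; apply (l2_of_bound _ (Cmod c ^ 2 * nrm2 a)); intros n; rewrite nsq_scal.
  apply Rmult_le_compat_l; [apply pow2_ge_0|now apply nsq_le_nrm2].
Qed.

Lemma l2_finite (a : nat -> C) (N : nat) : (forall k, (N <= k)%nat -> a k = 0) -> l2 a.
Proof.
  intros H; apply (l2_of_bound _ (nsq a N)); intros n.
  destruct (Nat.le_ge_cases n N) as [Hn|Hn].
  - apply Rsum_mono; trivial; apply nsq_term_nonneg.
  - unfold nsq; replace n with (N + (n - N))%nat by lia; rewrite Rsum_split.
    rewrite (Rsum_ext (fun k => _) (fun _ => 0 * 0) (n - N)).
    + rewrite Rsum_scal; lra.
    + intros k _; rewrite H by lia; rewrite Cmod_0; ring.
Qed.

Lemma H2_plus (f g : disk -> C) : H2 w f -> H2 w g -> H2 w (plus f g).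
Proof.
  intros [a [Ha La]] [b [Hb Lb]]; exists (fun k => a k + b k)%C; split.
  - now apply disk_expansion_plus.
  - now apply l2_plus.
Qed.

Lemma H2_scal (c : C) (f : disk -> C) : H2 w f -> H2 w (scal c f).
Proof.
  intros [a [Ha La]]; exists (fun k => c * a k)%C; split.
  - now apply disk_expansion_scal.
  - now apply l2_scal.
Qed.

Lemma minus_scal (f g : disk -> C) : minus f g = plus f (scal (-(1))%C g).
Proof.
  apply functional_extensionality; intros z.
  change (f z + - g z = f z + (-(1)) * g z)%C; ring.
Qed.

Lemma H2_minus (f g : disk -> C) : H2 w f -> H2 w g -> H2 w (minus f g).
Proof. intros Hf Hg; rewrite minus_scal; now apply H2_plus, H2_scal. Qed.

Lemma H2_zero : H2 w zero.
Proof.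
  exists (fun _ => RtoC 0); split.
  - apply disk_expansion_cser; intros z.
    apply cser_zero; intros k; ring.
  - apply (l2_finite _ 0); auto.
Qed.

Lemma coef_plus (f g : disk -> C) (k : nat) : H2 w f -> H2 w g ->
  taylor_coeff (plus f g) k = (taylor_coeff f k + taylor_coeff g k)%C.
Proof.
  intros Hf Hg; apply H2_coef in Hf; apply H2_coef in Hg.
  now apply (taylor_coeff_eq _ (fun k => taylor_coeff f k + taylor_coeff g k)%C),
    disk_expansion_plus.
Qed.

Lemma coef_scal (c : C) (f : disk -> C) (k : nat) : H2 w f ->
  taylor_coeff (scal c f) k = (c * taylor_coeff f k)%C.
Proof.
  intros Hf; apply H2_coef in Hf.
  now apply (taylor_coeff_eq _ (fun k => c * taylor_coeff f k)%C), disk_expansion_scal.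
Qed.

Lemma coef_minus (f g : disk -> C) (k : nat) : H2 w f -> H2 w g ->
  taylor_coeff (minus f g) k = (taylor_coeff f k - taylor_coeff g k)%C.
Proof.
  intros Hf Hg; rewrite minus_scal, coef_plus, coef_scal; trivial; [ring|].
  now apply H2_scal.
Qed.

(** * Inner product and completeness *)

Lemma Rsum_sq_zero (x : nat -> R) (n : nat) :
  Rsum (fun k => x k ^ 2) n <= 0 -> forall k, (k < n)%nat -> x k = 0.
Proof.
  induction n as [|n IH]; intros H k Hk; [lia|]; simpl in H.
  assert (0 <= Rsum (fun k => x k ^ 2) n) by (apply Rsum_nonneg; intros; apply pow2_ge_0).
  simpl in *; destruct (Nat.eq_dec k n) as [->|]; [nra|].
  apply IH; [nra|lia].
Qed.

(** The weighted inequality between arithmetic and geometric mean, with weights [B / A] and [A / B];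
    if [A] or [B] is zero, every term vanishes. *)
Lemma Cauchy_Schwarz_sum (x y : nat -> R) (A B : R) (n : nat) :
  0 <= A -> 0 <= B ->
  Rsum (fun k => x k ^ 2) n <= A ^ 2 -> Rsum (fun k => y k ^ 2) n <= B ^ 2 ->
  Rsum (fun k => x k * y k) n <= A * B.
Proof.
  intros HA HB Hx Hy.
  destruct HA as [HA|<-].
  2: { rewrite (Rsum_ext _ (fun k => 0 * y k)), Rsum_scal; [lra|]; intros k Hk.
       rewrite (Rsum_sq_zero x n); trivial; rewrite pow_i in Hx; [trivial|lia]. }
  destruct HB as [HB|<-].
  2: { rewrite (Rsum_ext _ (fun k => 0 * x k)), Rsum_scal; [lra|]; intros k Hk.
       rewrite (Rsum_sq_zero y n); trivial; [ring|rewrite pow_i in Hy; [trivial|lia]]. }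
  apply Rle_trans with
    (Rsum (fun k => (B / A / 2) * x k ^ 2 + (A / B / 2) * y k ^ 2) n).
  - apply Rsum_le; intros k _.
    assert (0 <= (B * x k - A * y k) ^ 2 / (2 * A * B)).
    { apply Rdiv_le_0_compat; [apply pow2_ge_0|].
      apply Rmult_lt_0_compat; lra. }
    replace (B / A / 2 * x k ^ 2 + A / B / 2 * y k ^ 2)
      with ((B * x k - A * y k) ^ 2 / (2 * A * B) + x k * y k) by (field; lra).
    lra.
  - rewrite Rsum_plus, !Rsum_scal.
    assert (0 < B / A / 2) by (repeat apply Rdiv_lt_0_compat; lra).
    assert (0 < A / B / 2) by (repeat apply Rdiv_lt_0_compat; lra).
    apply Rle_trans with (B / A / 2 * A ^ 2 + A / B / 2 * B ^ 2); [nra|].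
    apply Req_le; field; lra.
Qed.

Definition ips (a b : nat -> C) : C :=
  C_Series (fun k => (a k * Cconj (b k) * RtoC ((beta w k)^2))%C).

Lemma ips_cser (a b : nat -> C) : l2 a -> l2 b ->
  cser (fun k => (a k * Cconj (b k) * RtoC ((beta w k)^2))%C) (ips a b) /\
  Cmod (ips a b) <= sqrt (nrm2 a) * sqrt (nrm2 b).
Proof.
  intros Ha Hb; apply cser_abs; intros n.
  rewrite (Rsum_ext _ (fun k => (Cmod (a k) * beta w k) * (Cmod (b k) * beta w k))).
  - apply Cauchy_Schwarz_sum; try apply sqrt_pos.
    + rewrite (Rsum_ext _ (fun k => (Cmod (a k))^2 * (beta w k)^2)) by (intros; ring).
      now apply l2_sqrt_bound.
    + rewrite (Rsum_ext _ (fun k => (Cmod (b k))^2 * (beta w k)^2)) by (intros; ring).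
      now apply l2_sqrt_bound.
  - intros k _; rewrite !Cmod_mult, Cmod_conj, Cmod_RtoC_nonneg by apply pow2_ge_0; ring.
Qed.

Lemma H2_ip_cser (f g : disk -> C) : H2 w f -> H2 w g ->
  cser (fun k => (taylor_coeff f k * Cconj (taylor_coeff g k) * RtoC ((beta w k)^2))%C)
    (H2_ip w f g).
Proof.
  intros Hf Hg; apply H2_coef in Hf; apply H2_coef in Hg.
  exact (proj1 (ips_cser _ _ (proj2 Hf) (proj2 Hg))).
Qed.

Lemma ip_plus_l (f g h : disk -> C) : H2 w f -> H2 w g -> H2 w h ->
  H2_ip w (plus f g) h = (H2_ip w f h + H2_ip w g h)%C.
Proof.
  intros Hf Hg Hh; apply cser_C_Series.
  eapply cser_ext; [|apply (cser_plus _ _ _ _ (H2_ip_cser f h Hf Hh) (H2_ip_cser g h Hg Hh))].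
  intros k; simpl; rewrite coef_plus by trivial; ring.
Qed.

Lemma ip_scal_l (c : C) (f h : disk -> C) : H2 w f -> H2 w h ->
  H2_ip w (scal c f) h = (c * H2_ip w f h)%C.
Proof.
  intros Hf Hh; apply cser_C_Series.
  eapply cser_ext; [|apply (cser_scal c _ _ (H2_ip_cser f h Hf Hh))].
  intros k; simpl; rewrite coef_scal by trivial; ring.
Qed.

Lemma cser_conj (u : nat -> C) (l : C) : cser u l -> cser (fun k => Cconj (u k)) (Cconj l).
Proof.
  intros H eps He; destruct (H eps He) as [N HN]; exists N; intros n Hn.
  assert (E : Csum (fun k => Cconj (u k)) n = Cconj (Csum u n)).
  { clear; induction n as [|n IH]; simpl.
    - unfold Cconj; simpl; rewrite Ropp_0; reflexivity.
    - rewrite IH, Cplus_conj; reflexivity. }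
  rewrite E, <- Cminus_conj, Cmod_conj; auto.
Qed.

Lemma RtoC_conj (x : R) : Cconj (RtoC x) = RtoC x.
Proof. unfold Cconj, RtoC; simpl; f_equal; ring. Qed.

Lemma ip_conj (f g : disk -> C) : H2 w f -> H2 w g ->
  H2_ip w f g = Cconj (H2_ip w g f).
Proof.
  intros Hf Hg; apply cser_C_Series.
  eapply cser_ext; [|apply (cser_conj _ _ (H2_ip_cser g f Hg Hf))].
  intros k; simpl; rewrite !Cmult_conj, Cconj_conj, RtoC_conj; ring.
Qed.

Lemma ip_plus_r (f g h : disk -> C) : H2 w f -> H2 w g -> H2 w h ->
  H2_ip w h (plus f g) = (H2_ip w h f + H2_ip w h g)%C.
Proof.
  intros Hf Hg Hh; rewrite ip_conj, ip_plus_l by (trivial; now apply H2_plus).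
  rewrite Cplus_conj, <- !ip_conj by trivial; reflexivity.
Qed.

Lemma ip_scal_r (c : C) (f h : disk -> C) : H2 w f -> H2 w h ->
  H2_ip w h (scal c f) = (Cconj c * H2_ip w h f)%C.
Proof.
  intros Hf Hh; rewrite ip_conj, ip_scal_l by (trivial; now apply H2_scal).
  rewrite Cmult_conj, <- ip_conj by trivial; reflexivity.
Qed.

Lemma ip_norm_coef (f : disk -> C) : ip_norm (H2_ip w) f = sqrt (nrm2 (taylor_coeff f)).
Proof. apply H2_norm_eq. Qed.

Lemma ip_self (f : disk -> C) : H2 w f -> H2_ip w f f = RtoC (nrm2 (taylor_coeff f)).
Proof.
  intros Hf; pose proof (H2_coef f Hf) as [_ Hl].
  apply cser_C_Series.
  apply cser_Re_Im.
  - eapply is_series_ext; [|apply (Series_correct _ Hl)]; intros k.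
    rewrite <- Cmod2_conj, <- RtoC_mult; reflexivity.
  - eapply is_series_ext with (a := fun _ => 0).
    + intros k; rewrite <- Cmod2_conj, <- RtoC_mult; reflexivity.
    + apply is_series_Rsum; apply (is_lim_seq_ext (fun _ => 0)); [|apply is_lim_seq_const].
      intros n; rewrite (Rsum_ext _ (fun _ => 0 * 0)) by (intros; ring).
      rewrite Rsum_scal; ring.
Qed.

Lemma ip_norm_sq (f : disk -> C) : H2 w f -> ip_norm (H2_ip w) f ^ 2 = Re (H2_ip w f f).
Proof.
  intros Hf; rewrite ip_norm_coef, ip_self by trivial; simpl Re.
  apply pow2_sqrt, nrm2_nonneg, H2_coef, Hf.
Qed.

Lemma ip_norm_ge_0 (f : disk -> C) : 0 <= ip_norm (H2_ip w) f.
Proof. apply sqrt_pos. Qed.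

Lemma ip_Cauchy_Schwarz (f g : disk -> C) : H2 w f -> H2 w g ->
  Cmod (H2_ip w f g) <= ip_norm (H2_ip w) f * ip_norm (H2_ip w) g.
Proof.
  intros Hf Hg; rewrite !ip_norm_coef; apply H2_coef in Hf; apply H2_coef in Hg.
  exact (proj2 (ips_cser _ _ (proj2 Hf) (proj2 Hg))).
Qed.

Lemma nrm2_zero (a : nat -> C) : l2 a -> nrm2 a <= 0 -> forall k, a k = 0.
Proof.
  intros Ha H k; pose proof (nsq_le_nrm2 a (S k) Ha).
  pose proof (l2_coef_le a 0 k (Rle_refl 0)) as Hk.
  assert (Cmod (a k) * beta w k <= 0) by (apply Hk; simpl; lra).
  pose proof (beta_pos k); pose proof (Cmod_ge_0 (a k)).
  apply Cmod_eq_0; nra.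
Qed.

Lemma ip_self_zero (f : disk -> C) : H2 w f -> Re (H2_ip w f f) <= 0 -> f = zero.
Proof.
  intros Hf H; rewrite ip_self in H by trivial; simpl in H.
  destruct (H2_coef f Hf) as [He Hl].
  rewrite (disk_expansion_fn f _ He); apply functional_extensionality; intros z.
  apply cser_C_Series; change (@zero disk_fun_ModuleSpace z) with (RtoC 0).
  apply cser_zero; intros k; rewrite (nrm2_zero _ Hl) by trivial; ring.
Qed.

(** The limit is taken coefficient by coefficient; on each finite section the Cauchy estimate then
    passes to the limit in one of its two indices. *)
Lemma l2_complete (A : nat -> nat -> C) :
  (forall eps, 0 < eps -> exists N, forall m n, (N <= m)%nat -> (N <= n)%nat ->
    forall K, nsq (fun k => A m k - A n k)%C K <= eps) ->
  exists l, forall eps, 0 < eps -> exists N, forall n, (N <= n)%nat ->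
    forall K, nsq (fun k => A n k - l k)%C K <= eps.
Proof.
  intros HA.
  assert (Hcoef : forall k (eps : posreal), exists N, forall n m,
    (N <= n)%nat -> (N <= m)%nat -> Cmod (A n k - A m k) < eps).
  { intros k eps; pose proof (beta_pos k) as Hb.
    assert (He : 0 < eps * beta w k / 2)
      by (apply Rdiv_lt_0_compat; [apply Rmult_lt_0_compat; trivial; apply cond_pos|lra]).
    destruct (HA ((eps * beta w k / 2) ^ 2)) as [N HN]; [now apply pow_lt|].
    exists N; intros n m Hn Hm.
    pose proof (l2_coef_le _ _ k (Rlt_le _ _ He) (HN n m Hn Hm (S k))) as H; simpl in H.
    apply (Rmult_lt_reg_r (beta w k)); trivial; lra. }
  set (l := fun k => (real (Lim_seq (fun n => Re (A n k))), real (Lim_seq (fun n => Im (A n k)))) : C).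
  assert (HR : forall k, is_lim_seq (fun n => Re (A n k)) (Re (l k))).
  { intros k; apply Lim_seq_correct', ex_lim_seq_cauchy_corr; intros eps.
    destruct (Hcoef k eps) as [N HN]; exists N; intros n m Hn Hm.
    rewrite <- re_minus; eapply Rle_lt_trans; [apply re_le_Cmod|auto]. }
  assert (HI : forall k, is_lim_seq (fun n => Im (A n k)) (Im (l k))).
  { intros k; apply Lim_seq_correct', ex_lim_seq_cauchy_corr; intros eps.
    destruct (Hcoef k eps) as [N HN]; exists N; intros n m Hn Hm.
    rewrite <- im_minus; eapply Rle_lt_trans; [apply im_le_Cmod|auto]. }
  clearbody l; exists l; intros eps He; destruct (HA eps He) as [N HN]; exists N; intros n Hn K.
  assert (Hlim : is_lim_seq (fun m => nsq (fun k => A n k - A m k)%C K)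
    (nsq (fun k => A n k - l k)%C K)).
  { unfold nsq; clear HN; induction K as [|K IH]; cbn [Rsum]; [apply is_lim_seq_const|].
    apply is_lim_seq_plus'; trivial.
    apply (is_lim_seq_ext (fun m =>
      ((Re (A n K) - Re (A m K)) * (Re (A n K) - Re (A m K)) +
       (Im (A n K) - Im (A m K)) * (Im (A n K) - Im (A m K))) * beta w K ^ 2)).
    - intros m; rewrite Cmod2_alt, re_minus, im_minus; ring.
    - rewrite Cmod2_alt, re_minus, im_minus.
      replace ((Re (A n K) - Re (l K)) ^ 2 + (Im (A n K) - Im (l K)) ^ 2) with
        ((Re (A n K) - Re (l K)) * (Re (A n K) - Re (l K)) +
         (Im (A n K) - Im (l K)) * (Im (A n K) - Im (l K))) by ring.
      apply is_lim_seq_mult'; [|apply is_lim_seq_const].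
      apply is_lim_seq_plus'; apply is_lim_seq_mult'; apply is_lim_seq_minus';
        first [exact (HR K)|exact (HI K)|apply is_lim_seq_const]. }
  apply (is_lim_seq_le_loc _ _ (Finite _) (Finite eps)) with (3 := is_lim_seq_const eps)
    (2 := Hlim).
  exists N; intros m Hm; now apply HN.
Qed.

End Weight.

(** * Hilbert space geometry of H2 *)

(** Increasing enumeration of the indices other than [p], used to single out one term of a sum. *)
Definition skip (p i : nat) : nat := if (i <? p)%nat then i else S i.

Lemma Csum_skip (u : nat -> C) (p m : nat) : (p <= m)%nat ->
  Csum u (S m) = (Csum (fun i => u (skip p i)) m + u p)%C.
Proof.
  induction m as [|m IH]; intros Hp.
  - replace p with O by lia; reflexivity.
  - destruct (Nat.eq_dec p (S m)) as [->|Hn].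
    + change (Csum u (S m) + u (S m) = Csum (fun i => u (skip (S m) i)) (S m) + u (S m))%C.
      f_equal; apply Csum_ext; intros k Hk; unfold skip.
      now rewrite (proj2 (Nat.ltb_lt k (S m)) Hk).
    + change (Csum u (S m) + u (S m) =
        Csum (fun i => u (skip p i)) m + u (skip p m) + u p)%C.
      rewrite IH by lia.
      assert (E : skip p m = S m).
      { unfold skip; now rewrite (proj2 (Nat.ltb_ge m p)) by lia. }
      rewrite E; ring.
Qed.

(** Gaussian elimination on the last equation: an unknown [p] that occurs in it is eliminated and
    recovered as [L]; if none occurs, the last unknown is set to zero. *)
Lemma homogeneous_system (n : nat) (c : nat -> nat -> C) :
  exists x : nat -> C, (exists i, (i <= n)%nat /\ x i <> 0) /\
    forall j, (j < n)%nat -> Csum (fun i => x i * c i j)%C (S n) = 0.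
Proof.
  revert c; induction n as [|n IH]; intros c.
  - exists (fun _ => RtoC 1); split; [|lia].
    exists O; split; trivial; apply C1_nz.
  - destruct (classic (exists p, (p <= S n)%nat /\ c p n <> 0)) as [[p [Hp Hcp]]|Hno].
    + destruct (IH (fun i j => c (skip p i) j - c (skip p i) n / c p n * c p j)%C)
        as [y [[i0 [Hi0 Hy]] Hsys]].
      set (L := (- Csum (fun i => y i * (c (skip p i) n / c p n)) (S n))%C).
      set (x := fun i => if (i =? p)%nat then L else
        if (i <? p)%nat then y i else y (pred i)).
      assert (Hxs : forall i, x (skip p i) = y i).
      { intros i; unfold x, skip; destruct (Nat.ltb_spec i p) as [Hi|Hi].
        - destruct (Nat.eqb_spec i p); [lia|].
          now rewrite (proj2 (Nat.ltb_lt i p)) by lia.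
        - destruct (Nat.eqb_spec (S i) p); [lia|].
          now rewrite (proj2 (Nat.ltb_ge (S i) p)) by lia. }
      assert (Hxp : x p = L) by (unfold x; now rewrite Nat.eqb_refl).
      assert (Hsum : forall j, Csum (fun i => x i * c i j)%C (S (S n)) =
        Csum (fun i => y i * (c (skip p i) j - c (skip p i) n / c p n * c p j))%C (S n)).
      { intros j; rewrite (Csum_skip _ p) by lia; rewrite Hxp.
        rewrite (Csum_ext _ (fun i => y i * c (skip p i) j)%C) by (intros; now rewrite Hxs).
        rewrite (Csum_ext (fun i => y i * (c (skip p i) j - _))%C
          (fun i => y i * c (skip p i) j - c p j * (y i * (c (skip p i) n / c p n)))%C)
          by (intros; ring).
        rewrite Csum_minus, Csum_scal; unfold L; ring. }
      exists x; split.
      * exists (skip p i0); rewrite Hxs; split; trivial.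
        unfold skip; destruct (Nat.ltb_spec i0 p); lia.
      * intros j Hj; rewrite Hsum; destruct (Nat.eq_dec j n) as [->|].
        -- rewrite (Csum_ext _ (fun _ => RtoC 0)); [apply Csum_zero|].
           intros i _; field; trivial.
        -- apply Hsys; lia.
    + destruct (IH c) as [y [[i0 [Hi0 Hy]] Hsys]].
      exists (fun i => if (i =? S n)%nat then RtoC 0 else y i); split.
      * exists i0; split; [lia|]; destruct (Nat.eqb_spec i0 (S n)); [lia|trivial].
      * intros j Hj.
        change (Csum (fun i => (if (i =? S n)%nat then RtoC 0 else y i) * c i j) (S n) +
          (if (S n =? S n)%nat then RtoC 0 else y (S n)) * c (S n) j = 0)%C.
        rewrite Nat.eqb_refl, (Csum_ext _ (fun i => y i * c i j)%C).
        2: { intros k Hk; destruct (Nat.eqb_spec k (S n)); [lia|trivial]. }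
        destruct (Nat.eq_dec j n) as [->|].
        -- rewrite (Csum_ext _ (fun _ => RtoC 0)); [rewrite Csum_zero; ring|].
           intros i Hi; replace (c i n) with (RtoC 0); [ring|].
           symmetry; apply NNPP; intros Hc; apply Hno; exists i; split; [lia|trivial].
        -- rewrite Hsys by lia; ring.
Qed.

Lemma sum_n_scal_eval (c : nat -> C) (e : nat -> disk -> C) (n : nat) (z : disk) :
  sum_n (G := disk_fun_ModuleSpace) (fun i => scal (c i) (e i)) n z =
  Csum (fun i => c i * e i z)%C (S n).
Proof.
  induction n as [|n IH].
  - rewrite sum_O; simpl; change (c O * e O z = 0 + c O * e O z)%C; ring.
  - rewrite sum_Sn.
    change (sum_n (G := disk_fun_ModuleSpace) (fun i => scal (c i) (e i)) n z + c (S n) * e (S n) z =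
      Csum (fun i => c i * e i z) (S n) + c (S n) * e (S n) z)%C.
    now rewrite IH.
Qed.

Lemma finite_dimensional_dependent (E : (disk -> C) -> Prop) :
  finite_dimensional E ->
  exists n, forall g : nat -> disk -> C, (forall i, E (g i)) ->
    exists x : nat -> C, (exists i, (i <= n)%nat /\ x i <> 0) /\
      forall z, Csum (fun i => x i * g i z)%C (S n) = 0.
Proof.
  (* The spanning family has [n + 1] members, so any [n + 2] vectors are dependent. This number
     depends on [E] only, hence applies to families chosen afterwards. *)
  intros [n [e [_ He]]]; exists (S n); intros g Hg.
  assert (Hc : forall i, exists c : nat -> C,
    forall z, g i z = Csum (fun j => c j * e j z)%C (S n)).
  { intros i; destruct (He (g i) (Hg i)) as [c Hc]; exists c; intros z.
    rewrite Hc; apply sum_n_scal_eval. }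
  set (c := fun i => proj1_sig (constructive_indefinite_description _ (Hc i))).
  assert (Hc' : forall i z, g i z = Csum (fun j => c i j * e j z)%C (S n)).
  { intros i; unfold c; apply proj2_sig. }
  destruct (homogeneous_system (S n) c) as [x [Hx Hsys]].
  exists x; split; trivial; intros z.
  rewrite (Csum_ext _ (fun i => Csum (fun j => x i * (c i j * e j z))%C (S n))).
  2: { intros i _; now rewrite Hc', Csum_scal. }
  rewrite Csum_swap, (Csum_ext _ (fun _ => RtoC 0)); [apply Csum_zero|].
  intros j Hj; rewrite (Csum_ext _ (fun i => e j z * (x i * c i j))%C) by (intros; ring).
  rewrite Csum_scal, Hsys by trivial; ring.
Qed.

Section Weight.

Variable w : nat -> R.
Hypothesis hw : Hardy_weight w.

Lemma norm_plus_sq (f g : disk -> C) : H2 w f -> H2 w g ->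
  ip_norm (H2_ip w) (plus f g) ^ 2 =
  ip_norm (H2_ip w) f ^ 2 + 2 * Re (H2_ip w f g) + ip_norm (H2_ip w) g ^ 2.
Proof.
  intros Hf Hg; rewrite !(ip_norm_sq w) by (trivial; now apply H2_plus).
  rewrite ip_plus_l, !ip_plus_r, (ip_conj w g f) by (trivial; now apply H2_plus).
  rewrite !re_plus, re_conj; ring.
Qed.

Lemma norm_triangle (f g : disk -> C) : H2 w f -> H2 w g ->
  ip_norm (H2_ip w) (plus f g) <= ip_norm (H2_ip w) f + ip_norm (H2_ip w) g.
Proof.
  intros Hf Hg.
  pose proof (ip_norm_ge_0 w f); pose proof (ip_norm_ge_0 w g).
  apply Rsqr_incr_0_var; [|lra]; rewrite !Rsqr_pow2, norm_plus_sq by trivial.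
  pose proof (ip_Cauchy_Schwarz w f g Hf Hg).
  pose proof (re_le_Cmod (H2_ip w f g)) as Hr; apply Rabs_le_between in Hr.
  nra.
Qed.

Lemma norm_scal (c : C) (f : disk -> C) : H2 w f ->
  ip_norm (H2_ip w) (scal c f) = Cmod c * ip_norm (H2_ip w) f.
Proof.
  intros Hf.
  pose proof (ip_norm_ge_0 w f); pose proof (ip_norm_ge_0 w (scal c f)).
  pose proof (Cmod_ge_0 c).
  apply Rsqr_inj; trivial; [now apply Rmult_le_pos|].
  rewrite !Rsqr_pow2, Rpow_mult_distr, !(ip_norm_sq w) by (trivial; now apply H2_scal).
  rewrite (ip_scal_l w), (ip_scal_r w), Cmult_assoc by (trivial; now apply H2_scal).
  rewrite <- Cmod2_conj, re_scal_l; reflexivity.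
Qed.

Lemma parallelogram (f g y : disk -> C) : H2 w f -> H2 w g -> H2 w y ->
  ip_norm (H2_ip w) (minus f g) ^ 2 +
  4 * ip_norm (H2_ip w) (minus (scal (/ 2)%C (plus f g)) y) ^ 2 =
  2 * ip_norm (H2_ip w) (minus f y) ^ 2 + 2 * ip_norm (H2_ip w) (minus g y) ^ 2.
Proof.
  intros Hf Hg Hy.
  set (a := minus f y); set (b := minus g y).
  assert (Ha : H2 w a) by now apply H2_minus.
  assert (Hb : H2 w b) by now apply H2_minus.
  replace (minus f g) with (plus a (scal (-(1))%C b)).
  2: { apply functional_extensionality; intros z.
       change ((f z + - y z) + -(1) * (g z + - y z) = f z + - g z)%C; ring. }
  replace (minus (scal (/ 2)%C (plus f g)) y) with (scal (/ 2)%C (plus a b)).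
  2: { apply functional_extensionality; intros z.
       change (/ 2 * ((f z + - y z) + (g z + - y z)) = / 2 * (f z + g z) + - y z)%C.
       field; intros E; apply RtoC_inj in E; lra. }
  rewrite (norm_scal _ _ (H2_plus w a b Ha Hb)), Rpow_mult_distr.
  rewrite (norm_plus_sq _ _ Ha (H2_scal w _ b Hb)), (norm_plus_sq a b Ha Hb), (norm_scal _ b Hb).
  rewrite (ip_scal_r w) by trivial.
  replace (Cconj (- (1)))%C with (RtoC (-1))
    by (unfold Cconj, Copp; simpl; unfold RtoC; f_equal; ring).
  rewrite re_scal_l.
  replace (Cmod (- (1))) with 1 by (now rewrite Cmod_opp, Cmod_1).
  replace (Cmod (/ 2)) with (/ 2).
  2: { rewrite Cmod_inv, Cmod_RtoC_nonneg; [trivial|lra|].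
       intros E; apply RtoC_inj in E; lra. }
  field.
Qed.

Lemma coef_norm_sq (f : disk -> C) (n : nat) : H2 w f ->
  nsq w (taylor_coeff f) n <= ip_norm (H2_ip w) f ^ 2.
Proof.
  intros Hf; rewrite ip_norm_coef; apply l2_sqrt_bound; now apply H2_coef.
Qed.

Lemma norm_le_of_nsq (f : disk -> C) (M : R) : H2 w f -> 0 <= M ->
  (forall n, nsq w (taylor_coeff f) n <= M ^ 2) -> ip_norm (H2_ip w) f <= M.
Proof.
  intros Hf HM H; rewrite ip_norm_coef.
  rewrite <- (sqrt_pow2 M) by trivial; apply sqrt_le_1_alt.
  now apply (l2_of_bound w).
Qed.

Lemma H2_complete (x : nat -> disk -> C) :
  (forall n, H2 w (x n)) ->
  (forall eps, 0 < eps -> exists N, forall m n, (N <= m)%nat -> (N <= n)%nat ->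
     ip_norm (H2_ip w) (minus (x m) (x n)) <= eps) ->
  exists l, H2 w l /\ forall eps, 0 < eps -> exists N, forall n, (N <= n)%nat ->
    ip_norm (H2_ip w) (minus (x n) l) <= eps.
Proof.
  intros Hx HC.
  destruct (l2_complete w hw (fun n => taylor_coeff (x n))) as [l Hl].
  { intros eps He; destruct (HC (sqrt eps) (sqrt_lt_R0 _ He)) as [N HN].
    exists N; intros m n Hm Hn K; specialize (HN m n Hm Hn).
    unfold nsq; rewrite (Rsum_ext _ (fun k => Cmod (taylor_coeff (minus (x m) (x n)) k) ^ 2 * beta w k ^ 2))
      by (intros; now rewrite (coef_minus w)).
    eapply Rle_trans; [apply (coef_norm_sq _ K); now apply H2_minus|].
    rewrite <- (pow2_sqrt eps) by lra; apply pow_incr; split; trivial; apply ip_norm_ge_0. }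
  assert (Hll : l2 w l).
  { destruct (Hl 1 Rlt_0_1) as [N HN]; specialize (HN N (le_n N)).
    assert (Hd : l2 w (fun k => taylor_coeff (x N) k - l k)%C)
      by now apply (l2_of_bound w _ 1).
    apply (l2_ext w (fun k => taylor_coeff (x N) k + (-(1)) * (taylor_coeff (x N) k - l k))%C).
    - intros k; ring.
    - apply l2_plus; [now apply (H2_coef w)|now apply l2_scal]. }
  exists (fn l); split; [now apply H2_fn|]; intros eps He.
  destruct (Hl (eps ^ 2) (pow_lt _ _ He)) as [N HN]; exists N; intros n Hn.
  apply norm_le_of_nsq; [|lra|].
  - apply H2_minus; trivial; now apply H2_fn.
  - intros K; eapply Rle_trans; [|apply (HN n Hn K)]; apply Req_le, Rsum_ext; intros k _.
    rewrite (coef_minus w), (taylor_coeff_fn w hw); trivial; now apply H2_fn.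
Qed.

Lemma norm_minus_sym (f g : disk -> C) : H2 w f -> H2 w g ->
  ip_norm (H2_ip w) (minus f g) = ip_norm (H2_ip w) (minus g f).
Proof.
  intros Hf Hg; replace (minus f g) with (scal (-(1))%C (minus g f)).
  - rewrite norm_scal, Cmod_opp, Cmod_1 by (now apply H2_minus); ring.
  - apply functional_extensionality; intros z.
    change (-(1) * (g z + - f z) = f z + - g z)%C; ring.
Qed.

(** Midpoints of elements of [M] stay in [M], so by the parallelogram law a sequence minimizing the
    distance to [y] is Cauchy. Its limit is a nearest point, and the first variation there gives
    orthogonality. *)
Lemma orthogonal_projection (M : (disk -> C) -> Prop) :
  (forall x, M x -> H2 w x) -> (exists x, M x) ->
  (forall x y, M x -> M y -> M (plus x y)) -> (forall (c : C) x, M x -> M (scal c x)) ->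
  (forall m, H2 w m ->
    (forall eps, 0 < eps -> exists x, M x /\ ip_norm (H2_ip w) (minus x m) < eps) -> M m) ->
  forall y, H2 w y -> exists m, M m /\ forall x, M x -> H2_ip w x (minus y m) = 0.
Proof.
  intros HM [x0 Hx0] Hplus Hscal Hclosed y Hy.
  set (N := ip_norm (H2_ip w)).
  (* Squared distances are negated because [completeness] provides suprema. *)
  set (E := fun r => exists x, M x /\ r = - N (minus x y) ^ 2).
  destruct (completeness E) as [d' [Hub Hlub]].
  { exists 0; intros r [x [_ ->]]; pose proof (pow2_ge_0 (N (minus x y))); lra. }
  { exists (- N (minus x0 y) ^ 2), x0; auto. }
  set (d := - d').
  assert (Hd : forall x, M x -> d <= N (minus x y) ^ 2).
  { intros x Hx; unfold d; assert (- N (minus x y) ^ 2 <= d') by (apply Hub; exists x; auto).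
    lra. }
  assert (Hinf : forall n, exists x, M x /\ N (minus x y) ^ 2 <= d + / (INR n + 1)).
  { intros n; assert (Hn : 0 < / (INR n + 1)) by (apply RinvN_pos).
    apply NNPP; intros Hno; assert (d' <= d' - / (INR n + 1)); [|lra].
    apply Hlub; intros r [x [Hx ->]]; apply Rnot_lt_le; intros Hlt.
    apply Hno; exists x; split; trivial; unfold d; lra. }
  set (x := fun n => proj1_sig (constructive_indefinite_description _ (Hinf n))).
  assert (Hx : forall n, M (x n) /\ N (minus (x n) y) ^ 2 <= d + / (INR n + 1)).
  { intros n; unfold x; apply proj2_sig. }
  destruct (H2_complete x) as [m [Hm Hlim]].
  { intros n; apply HM, Hx. }
  { intros eps He.
    assert (He2 : 0 < eps ^ 2 / 4) by (apply Rdiv_lt_0_compat; [now apply pow_lt|lra]).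
    destruct (archimed_cor1 _ He2) as [K [HK HK0]]; exists K; intros i j Hi Hj.
    assert (HKi : forall i, (K <= i)%nat -> / (INR i + 1) <= eps ^ 2 / 4).
    { intros k Hk; apply Rlt_le; eapply Rle_lt_trans; [|exact HK].
      apply Rinv_le_contravar; [now apply lt_0_INR|].
      apply le_INR in Hk; lra. }
    pose proof (HKi i Hi); pose proof (HKi j Hj).
    pose proof (parallelogram (x i) (x j) y (HM _ (proj1 (Hx i))) (HM _ (proj1 (Hx j))) Hy) as Hpar.
    fold N in Hpar.
    match type of Hpar with _ + 4 * ?A = _ =>
      assert (d <= A) by exact (Hd (scal (/ 2)%C (plus (x i) (x j)))
        (Hscal _ _ (Hplus _ _ (proj1 (Hx i)) (proj1 (Hx j))))) end.
    pose proof (proj2 (Hx i)); pose proof (proj2 (Hx j)).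
    apply Rsqr_incr_0_var; [|lra]; rewrite !Rsqr_pow2; fold N; lra. }
  assert (HMm : M m).
  { apply Hclosed; trivial; intros eps He.
    destruct (Hlim (eps / 2)) as [K HK]; [lra|].
    exists (x K); split; [apply Hx|specialize (HK K (le_n K)); lra]. }
  assert (Hmd : N (minus m y) ^ 2 <= d).
  { apply Rnot_lt_le; intros Hlt.
    assert (HN0 : 0 <= N (minus m y)) by apply ip_norm_ge_0.
    assert (Hd0 : 0 <= d).
    { apply Ropp_le_cancel; rewrite Ropp_0; unfold d; rewrite Ropp_involutive.
      apply Hlub; intros r [x1 [_ ->]]; pose proof (pow2_ge_0 (N (minus x1 y))); lra. }
    assert (Hs : sqrt d < N (minus m y)).
    { rewrite <- (sqrt_pow2 (N (minus m y))) by trivial; apply sqrt_lt_1_alt; lra. }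
    set (eta := N (minus m y) - sqrt d).
    assert (Heta : 0 < eta) by (unfold eta; lra).
    destruct (Hlim (eta / 2)) as [K HK]; [lra|].
    assert (Hq : 0 < eta * eta / 4) by (apply Rdiv_lt_0_compat; [nra|lra]).
    destruct (archimed_cor1 _ Hq) as [K' [HK' HK0]].
    specialize (HK (K + K')%nat ltac:(lia)).
    destruct (Hx (K + K')%nat) as [HxM Hxd].
    set (f := x (K + K')%nat) in *.
    assert (Hinv : / (INR (K + K') + 1) < eta * eta / 4).
    { eapply Rle_lt_trans; [|exact HK']; apply Rinv_le_contravar; [now apply lt_0_INR|].
      assert (INR K' <= INR (K + K')) by (apply le_INR; lia); lra. }
    assert (Htri : N (minus m y) <= N (minus m f) + N (minus f y)).
    { replace (minus m y) with (plus (minus m f) (minus f y)).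
      - apply norm_triangle; apply H2_minus; auto.
      - apply functional_extensionality; intros z.
        change ((m z + - f z) + (f z + - y z) = m z + - y z)%C; ring. }
    assert (Hmf : N (minus m f) <= eta / 2) by (unfold N; rewrite norm_minus_sym; auto).
    assert (Hfy : N (minus f y) < sqrt d + eta / 2).
    { pose proof (sqrt_pos d) as Hsd; pose proof (pow2_sqrt d Hd0) as Esd.
      apply Rsqr_incrst_0; [|apply ip_norm_ge_0|lra].
      rewrite !Rsqr_pow2; nra. }
    unfold eta in *; lra. }
  exists m; split; trivial; intros f Hf.
  set (q := H2_ip w f (minus m y)).
  assert (HmH : H2 w (minus m y)) by now apply H2_minus.
  assert (Hq : q = 0).
  (* Moving from the nearest point by [c * f] with [c = - t * Cconj q] changes the squared distance
     by [- 2 t |q|^2 + t^2 |q|^2 |f|^2], which cannot be negative. *)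
  { assert (Hvar : forall t, 0 < t -> 2 * Cmod q ^ 2 <= t * Cmod q ^ 2 * N f ^ 2).
    { intros t Ht.
      set (c := (RtoC (- t) * Cconj q)%C).
      assert (H1 : d <= N (scal c f) ^ 2 + 2 * Re (H2_ip w (scal c f) (minus m y))
        + N (minus m y) ^ 2).
      { eapply Rle_trans; [exact (Hd _ (Hplus _ _ (Hscal c f Hf) HMm))|].
        apply Req_le; unfold N; rewrite <- norm_plus_sq by (trivial; now apply H2_scal, HM).
        f_equal; f_equal; apply functional_extensionality; intros z.
        change (c * f z + m z + - y z = c * f z + (m z + - y z))%C; ring. }
      unfold N in H1; rewrite norm_scal, (ip_scal_l w) in H1 by auto.
      fold q in H1; fold N in H1.
      assert (Ec : Cmod c = t * Cmod q).
      { unfold c; rewrite Cmod_mult, Cmod_conj, Cmod_R, Rabs_Ropp, Rabs_pos_eq; lra. }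
      assert (Er : Re (c * q) = - t * Cmod q ^ 2).
      { unfold c; replace (RtoC (- t) * Cconj q * q)%C with (RtoC (- t) * (q * Cconj q))%C by ring.
        rewrite <- Cmod2_conj, <- RtoC_mult; reflexivity. }
      rewrite Ec, Er in H1.
      apply (Rmult_le_reg_l t); trivial; nra. }
    apply Cmod_eq_0; destruct (Rle_lt_or_eq_dec _ _ (Cmod_ge_0 q)) as [Hp|]; [|auto].
    exfalso; specialize (Hvar (/ (N f ^ 2 + 1))).
    pose proof (pow2_ge_0 (N f)).
    specialize (Hvar ltac:(apply Rinv_0_lt_compat; lra)).
    apply (Rmult_le_compat_l (N f ^ 2 + 1)) in Hvar; [|lra].
    replace ((N f ^ 2 + 1) * (/ (N f ^ 2 + 1) * Cmod q ^ 2 * N f ^ 2))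
      with (Cmod q ^ 2 * N f ^ 2) in Hvar by (field; lra).
    assert (0 < Cmod q ^ 2) by now apply pow_lt.
    nra. }
  replace (minus y m) with (scal (-(1))%C (minus m y)).
  - rewrite (ip_scal_r w) by auto; fold q; rewrite Hq; ring.
  - apply functional_extensionality; intros z.
    change (-(1) * (m z + - y z) = y z + - m z)%C; ring.
Qed.

(** * Reproducing kernels and collisions *)

Definition kernel_coef (z : C) (k : nat) : C := (Cconj z ^ k * RtoC (/ (beta w k) ^ 2))%C.

Lemma kernel_coef_l2 (z : C) : Cmod z < 1 -> l2 w (kernel_coef z).
Proof.
  intros Hz; pose proof (Cmod_ge_0 z).
  destruct (beta_lower w hw ((1 + Cmod z) / 2) ltac:(lra)) as [c [Hc Hb]].
  set (q := (1 + Cmod z) / 2) in *.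
  assert (Hq : 0 <= Cmod z / q < 1).
  { split; [apply Rdiv_le_0_compat; unfold q; lra|].
    apply (Rdiv_lt_1 (Cmod z)); unfold q; lra. }
  assert (Hq2 : 0 <= (Cmod z / q) ^ 2 < 1) by (split; nra).
  assert (Hic : 0 <= / c ^ 2) by (apply Rlt_le, Rinv_0_lt_compat; now apply pow_lt).
  apply (l2_of_bound w _ (/ c ^ 2 * / (1 - (Cmod z / q) ^ 2))); intros n.
  apply geom_bound_sum; trivial; intros k; unfold kernel_coef.
  pose proof (beta_pos w hw k) as Hbk; specialize (Hb k).
  assert (Hqk : 0 < q ^ k) by (apply pow_lt; unfold q; lra).
  rewrite Cmod_mult, Cmod_pow, Cmod_conj, Cmod_RtoC_nonneg
    by (apply Rlt_le, Rinv_0_lt_compat; now apply pow_lt).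
  rewrite <- pow_mult, Nat.mul_comm, pow_mult.
  replace ((Cmod z / q) ^ k) with (Cmod z ^ k * / q ^ k)
    by (unfold Rdiv; rewrite Rpow_mult_distr, pow_inv; reflexivity).
  replace ((Cmod z ^ k * / beta w k ^ 2) ^ 2 * beta w k ^ 2)
    with ((Cmod z ^ k) ^ 2 * (/ beta w k) ^ 2) by (field; lra).
  replace (/ c ^ 2 * (Cmod z ^ k * / q ^ k) ^ 2)
    with ((Cmod z ^ k) ^ 2 * (/ (c * q ^ k)) ^ 2) by (field; lra).
  apply Rmult_le_compat_l; [apply pow2_ge_0|].
  apply pow_incr; split; [apply Rlt_le, Rinv_0_lt_compat; trivial|].
  apply Rinv_le_contravar; trivial; now apply Rmult_lt_0_compat.
Qed.

Lemma ip_kernel (f : disk -> C) (z : disk) : H2 w f ->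
  H2_ip w f (fn (kernel_coef z)) = f z.
Proof.
  intros Hf; destruct z as [z Hz]; simpl.
  pose proof (kernel_coef_l2 z Hz) as Hl.
  apply cser_C_Series.
  destruct (H2_coef w f Hf) as [He _].
  eapply cser_ext; [|exact (proj1 (disk_expansion_cser _ _) He (exist _ z Hz))].
  intros k; rewrite (taylor_coeff_fn w hw) by trivial; unfold kernel_coef; simpl.
  rewrite Cmult_conj, Cpow_conj, Cconj_conj, RtoC_conj.
  change (taylor_coeff f k * z ^ k = taylor_coeff f k * (z ^ k * RtoC (/ beta w k ^ 2)) * RtoC (beta w k ^ 2))%C.
  replace (taylor_coeff f k * (z ^ k * RtoC (/ beta w k ^ 2)) * RtoC (beta w k ^ 2))%C
    with (taylor_coeff f k * z ^ k * RtoC (/ beta w k ^ 2 * beta w k ^ 2))%C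
    by (rewrite RtoC_mult; ring).
  rewrite Rinv_l; [ring|].
  apply pow_nonzero; pose proof (beta_pos w hw k); lra.
Qed.

Lemma disk_expansion_Csum (g : nat -> disk -> C) (a : nat -> nat -> C) (x : nat -> C) (n : nat) :
  (forall i, disk_expansion (g i) (a i)) ->
  disk_expansion (fun z => Csum (fun i => x i * g i z)%C n)
    (fun k => Csum (fun i => x i * a i k)%C n).
Proof.
  intros H; apply disk_expansion_cser; intros z.
  eapply cser_ext; [|apply (cser_Csum (fun i k => x i * (a i k * (z : C) ^ k))%C)].
  - intros k; simpl; rewrite Cmult_comm, <- Csum_scal; apply Csum_ext; intros; ring.
  - intros i _; apply cser_scal; exact (proj1 (disk_expansion_cser _ _) (H i) z).
Qed.

Fixpoint root_prod (r : nat -> C) (m : nat) (z : C) : C :=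
  match m with O => RtoC 1 | S m => ((z - r m) * root_prod r m z)%C end.

Lemma root_prod_zero (r : nat -> C) (m j : nat) : (j < m)%nat -> root_prod r m (r j) = 0.
Proof.
  induction m as [|m IH]; intros Hj; [lia|]; simpl.
  destruct (Nat.eq_dec j m) as [->|]; [ring|rewrite IH by lia; ring].
Qed.

Lemma root_prod_nonzero (r : nat -> C) (m : nat) (z : C) :
  (forall j, (j < m)%nat -> z <> r j) -> root_prod r m z <> 0.
Proof.
  induction m as [|m IH]; intros H; simpl; [apply C1_nz|].
  apply Cmult_neq_0; [apply Cminus_eq_contra, H; lia|apply IH; auto with arith].
Qed.

(** The relations for the monomials extend to all polynomials. A polynomial that vanishes at every
    [b j] and at every [a j] except [a i0] isolates [x i0]. *)
Lemma point_differences_independent (x a b : nat -> C) (n : nat) :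
  (forall i j, (i <= n)%nat -> (j <= n)%nat -> i <> j -> a i <> a j) ->
  (forall i j, (i <= n)%nat -> (j <= n)%nat -> a i <> b j) ->
  (forall k, Csum (fun i => x i * (a i ^ k - b i ^ k))%C (S n) = 0) ->
  forall i, (i <= n)%nat -> x i = 0.
Proof.
  intros Haa Hab H i0 Hi0; apply NNPP; intros Hx.
  (* The roots are the [a j] followed by the [b j]; slot [i0] repeats a [b], so that [a i0] is not a
     root. *)
  set (r := fun j => if (j =? i0)%nat then b j else
    if (j <=? n)%nat then a j else b (j - S n)%nat).
  (* One more factor [z - r m] combines the relations for [k + 1] and for [k]. *)
  assert (HP : forall m k, Csum (fun i => x i *
    (a i ^ k * root_prod r m (a i) - b i ^ k * root_prod r m (b i)))%C (S n) = 0).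
  { induction m as [|m IH]; intros k.
    - rewrite <- (H k); apply Csum_ext; intros i _; simpl; ring.
    - rewrite (Csum_ext _ (fun i =>
        x i * (a i ^ S k * root_prod r m (a i) - b i ^ S k * root_prod r m (b i)) -
        r m * (x i * (a i ^ k * root_prod r m (a i) - b i ^ k * root_prod r m (b i))))%C)
        by (intros; simpl; ring).
      rewrite Csum_minus, Csum_scal, !IH; ring. }
  specialize (HP (S n + S n)%nat O).
  assert (Hb : forall i, (i <= n)%nat -> root_prod r (S n + S n) (b i) = 0).
  { intros i Hi; replace (b i) with (r (S n + i)%nat); [apply root_prod_zero; lia|].
    unfold r; destruct (Nat.eqb_spec (S n + i) i0); [lia|].
    destruct (Nat.leb_spec (S n + i) n); [lia|].
    f_equal; lia. }
  assert (Ha : forall i, (i <= n)%nat -> i <> i0 -> root_prod r (S n + S n) (a i) = 0).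
  { intros i Hi Hne; replace (a i) with (r i); [apply root_prod_zero; lia|].
    unfold r; destruct (Nat.eqb_spec i i0); [lia|].
    destruct (Nat.leb_spec i n); [trivial|lia]. }
  assert (Hnz : root_prod r (S n + S n) (a i0) <> 0).
  { apply root_prod_nonzero; intros j Hj; unfold r.
    destruct (Nat.eqb_spec j i0) as [->|]; [auto|].
    destruct (Nat.leb_spec j n); [auto|apply Hab; lia]. }
  rewrite (Csum_skip _ i0) in HP by trivial.
  rewrite (Csum_ext _ (fun _ => RtoC 0)) in HP.
  - rewrite Csum_zero, Hb in HP by trivial; simpl Cpow in HP.
    apply (Cmult_neq_0 _ _ Hx Hnz); rewrite <- HP; ring.
  - intros i Hi.
    assert (Hs : (skip i0 i <= n)%nat /\ skip i0 i <> i0)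
      by (unfold skip; destruct (Nat.ltb_spec i i0); lia).
    rewrite Ha, Hb by apply Hs; ring.
Qed.

(** By adjointness the squared norm of [T' g] is the pairing of [T (T' g)] with [g], which is
    zero. *)
Lemma adjoint_kernel (T T' : (disk -> C) -> disk -> C) (g : disk -> C) :
  is_adjoint (H2 w) (H2_ip w) T T' -> H2 w g ->
  (forall x, H2 w x -> H2_ip w (T x) g = 0) -> kernel (H2 w) T' g.
Proof.
  intros [[HS _] Hadj] Hg H; split; trivial.
  apply (ip_self_zero w hw); [now apply HS|].
  rewrite <- Hadj by auto; rewrite H by auto; simpl; lra.
Qed.

(* [K_a - K_b] lies in the kernel of the adjoint as soon as [psi a = psi b]. *)
Lemma no_infinite_collisions (psi : disk -> disk) (T' : (disk -> C) -> disk -> C)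
    (a b : nat -> disk) :
  (forall f, H2 w f -> H2 w (composition_operator psi f)) ->
  is_adjoint (H2 w) (H2_ip w) (composition_operator psi) T' ->
  finite_dimensional (kernel (H2 w) T') ->
  (forall i, psi (a i) = psi (b i)) ->
  (forall i j, i <> j -> (a i : C) <> a j) ->
  (forall i j, (a i : C) <> b j) -> False.
Proof.
  intros HT Hadj Hfin Hab Haa Hdis.
  destruct (finite_dimensional_dependent _ Hfin) as [n Hn].
  set (g := fun i => minus (fn (kernel_coef (a i))) (fn (kernel_coef (b i)))).
  assert (HK : forall z : disk, l2 w (kernel_coef z))
    by (intros [z Hz]; now apply kernel_coef_l2).
  assert (Hg : forall i, H2 w (g i)) by (intros i; apply H2_minus; now apply H2_fn).
  destruct (Hn g) as [x [[i0 [Hi0 Hx]] Hsum]].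
  { intros i; apply (adjoint_kernel (composition_operator psi)); trivial; intros f Hf.
    unfold g; rewrite minus_scal, (ip_plus_r w), (ip_scal_r w), !ip_kernel; auto.
    - unfold composition_operator; rewrite Hab.
      replace (Cconj (- (1))) with (- (1))%C; [ring|].
      unfold Cconj, Copp; simpl; f_equal; ring.
    - now apply H2_fn.
    - now apply H2_fn.
    - apply H2_scal; now apply H2_fn. }
  apply Hx; clear Hx; revert i0 Hi0.
  assert (E : forall k, Csum (fun i => x i * taylor_coeff (g i) k)%C (S n) = 0).
  { intros k.
    apply (disk_expansion_unique (fun _ => RtoC 0)
      (fun k => Csum (fun i => x i * taylor_coeff (g i) k)%C (S n)) (fun _ => RtoC 0)).
    - pose proof (disk_expansion_Csum g (fun i => taylor_coeff (g i)) x (S n)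
        (fun i => proj1 (H2_coef w _ (Hg i)))) as H.
      apply disk_expansion_cser; intros z.
      rewrite <- (Hsum z); exact (proj1 (disk_expansion_cser _ _) H z).
    - apply disk_expansion_cser; intros z.
      apply cser_zero; intros j; ring. }
  (* Kernel coefficients contain powers of [Cconj (a i)], so it is the conjugated relation that
     concerns powers of [a i] and [b i]. *)
  assert (HC : forall i, (i <= n)%nat -> Cconj (x i) = 0).
  { apply (point_differences_independent (fun i => Cconj (x i)) (fun i => a i) (fun i => b i)); auto.
    intros k; specialize (E k).
    assert (Hbk : RtoC (beta w k ^ 2) <> 0).
    { intros H; apply RtoC_inj in H; pose proof (beta_pos w hw k); nra. }
    rewrite (Csum_ext _ (fun i => RtoC (/ beta w k ^ 2) *
      Cconj (Cconj (x i) * ((a i : C) ^ k - (b i : C) ^ k)))%C) in E.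
    2: { intros i _; unfold g; rewrite (coef_minus w) by now apply H2_fn.
         rewrite !(taylor_coeff_fn w hw) by trivial; unfold kernel_coef.
         rewrite Cmult_conj, Cminus_conj, !Cpow_conj, Cconj_conj; ring. }
    rewrite Csum_scal in E.
    assert (E2 : Csum (fun i => Cconj (Cconj (x i) * ((a i : C) ^ k - (b i : C) ^ k)))%C
      (S n) = 0).
    { rewrite <- (Cmult_1_l (Csum _ _)), <- (Cinv_r (RtoC (beta w k ^ 2))) by trivial.
      rewrite <- Cmult_assoc, <- RtoC_inv, E; [ring|].
      intros H; apply Hbk; now rewrite H. }
    rewrite <- (Cconj_conj (Csum _ _)).
    replace (RtoC 0) with (Cconj 0) by (rewrite RtoC_conj; reflexivity).
    f_equal; rewrite <- E2; clear; induction (S n) as [|m IH]; simpl.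
    - apply RtoC_conj.
    - rewrite Cplus_conj, IH; reflexivity. }
  intros i Hi; rewrite <- (Cconj_conj (x i)), HC by trivial; apply RtoC_conj.
Qed.

End Weight.

(** * Fredholm composition operators come from automorphisms *)

Lemma CV_radius_gt (a : nat -> R) (R0 x : R) :
  (forall y, Rabs y < R0 -> ex_series (fun k => a k * y ^ k)) ->
  Rabs x < R0 -> Rbar_lt (Rabs x) (CV_radius a).
Proof.
  intros H Hx.
  destruct (Rbar_lt_le_dec (Rabs x) (CV_radius a)) as [Hlt|Hle]; trivial; exfalso.
  pose proof (Rabs_pos x).
  assert (Hy : Rabs ((Rabs x + R0) / 2) = (Rabs x + R0) / 2) by (apply Rabs_pos_eq; lra).
  apply (CV_disk_outside a ((Rabs x + R0) / 2)).
  - rewrite Hy; eapply Rbar_le_lt_trans; [exact Hle|simpl; lra].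
  - apply ex_series_lim_0, H; rewrite Hy; lra.
Qed.

Lemma Rsum_le_Series_eventually (u : nat -> R) (k0 m : nat) :
  (forall k, (k0 <= k)%nat -> 0 <= u k) -> ex_series u -> Rsum u (k0 + m) <= Series u.
Proof.
  intros Hu Hex.
  pose proof (proj1 (is_series_Rsum u _) (Series_correct u Hex)) as Hl.
  apply (is_lim_seq_le_loc (fun _ => Rsum u (k0 + m)) (Rsum u) (Finite _) (Finite _));
    [|apply is_lim_seq_const|exact Hl].
  exists (k0 + m)%nat; intros n Hn.
  replace n with ((k0 + m) + (n - (k0 + m)))%nat by lia; rewrite (Rsum_split u (k0 + m)).
  assert (0 <= Rsum (fun k => u (k0 + m + k)%nat) (n - (k0 + m))); [|lra].
  apply Rsum_nonneg; intros k; apply Hu; lia.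
Qed.

(** The quotient of factorials is what the [q]-th derivative multiplies the coefficient of index
    [k + q] by. *)
Lemma fact_ratio_ge (q k : nat) :
  (INR k + 1) ^ q <= INR (fact (k + q)) / INR (fact k).
Proof.
  pose proof (INR_fact_lt_0 k) as Hk.
  induction q as [|q IH].
  - rewrite Nat.add_0_r; simpl; apply Req_le; field; lra.
  - rewrite Nat.add_succ_r, fact_simpl, mult_INR, S_INR, plus_INR.
    pose proof (pos_INR k); pose proof (pos_INR q).
    replace ((INR k + INR q + 1) * INR (fact (k + q)) / INR (fact k))
      with ((INR k + INR q + 1) * (INR (fact (k + q)) / INR (fact k))) by (field; lra).
    change ((INR k + 1) ^ S q) with ((INR k + 1) * (INR k + 1) ^ q).
    apply Rmult_le_compat; trivial; [lra|apply pow_le; lra|lra].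
Qed.

(* The [q]-th derivative of the left-hand side has coefficients bounded below,
   hence blows up at [1], while that of the right-hand side stays bounded. *)
Lemma singular_at_one (A B : nat -> R) (r c : R) (q k0 : nat) :
  0 < r -> (forall y, Rabs y < 1 -> ex_series (fun k => A k * y ^ k)) ->
  (forall y, Rabs y < r -> ex_series (fun k => B k * y ^ k)) ->
  (forall x, 0 <= x < 1 -> 1 - r < x -> PSeries A x = PSeries B (x - 1)) ->
  0 < c -> (forall k, (k0 <= k)%nat -> c / (INR k + 1) ^ q <= A k) -> False.
Proof.
  intros Hr HA HB Heq Hc Hlow.
  set (A' := PS_derive_n q A); set (B' := PS_derive_n q B).
  (* A lower bound for the differentiated coefficients, from [k + q + 1 <= (k + 1) * (q + 1)]. *)
  set (c' := c / (INR q + 1) ^ q).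
  assert (Hq0 : 0 < (INR q + 1) ^ q) by (apply pow_lt; pose proof (pos_INR q); lra).
  assert (Hc' : 0 < c') by now apply Rdiv_lt_0_compat.
  assert (HA'low : forall k, (k0 <= k)%nat -> c' <= A' k).
  { intros k Hk; specialize (Hlow (k + q)%nat ltac:(lia)).
    unfold A', PS_derive_n.
    pose proof (fact_ratio_ge q k) as Hf.
    pose proof (pos_INR k); pose proof (pos_INR q); rewrite plus_INR in Hlow.
    assert (H1 : 0 < (INR k + 1) ^ q) by (apply pow_lt; lra).
    assert (H2 : 0 < (INR k + INR q + 1) ^ q) by (apply pow_lt; lra).
    assert (H3 : 0 < c / (INR k + INR q + 1) ^ q) by now apply Rdiv_lt_0_compat.
    apply Rle_trans with ((INR k + 1) ^ q * (c / (INR k + INR q + 1) ^ q)).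
    - unfold c'; apply (Rmult_le_reg_r ((INR q + 1) ^ q * (INR k + INR q + 1) ^ q)).
      { now apply Rmult_lt_0_compat. }
      replace (c / (INR q + 1) ^ q * ((INR q + 1) ^ q * (INR k + INR q + 1) ^ q))
        with (c * (INR k + INR q + 1) ^ q) by (field; lra).
      replace ((INR k + 1) ^ q * (c / (INR k + INR q + 1) ^ q) *
        ((INR q + 1) ^ q * (INR k + INR q + 1) ^ q))
        with (c * ((INR k + 1) * (INR q + 1)) ^ q)
        by (rewrite Rpow_mult_distr; field; lra).
      apply Rmult_le_compat_l; [lra|]; apply pow_incr; split; nra.
    - apply Rmult_le_compat; lra. }
  assert (HrB : forall y, Rabs y < r -> Rbar_lt (Rabs y) (CV_radius B))
    by (intros y Hy; now apply (CV_radius_gt B r)).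
  assert (HrA : forall y, Rabs y < 1 -> Rbar_lt (Rabs y) (CV_radius A))
    by (intros y Hy; now apply (CV_radius_gt A 1)).
  (* The two functions agree on an open interval around [x], hence so do their [q]-th derivatives
     there; excluding [x = 0] leaves room on the left. *)
  assert (Heq' : forall x, 0 < x < 1 -> 1 - r < x -> PSeries A' x = PSeries B' (x - 1)).
  { intros x Hx Hxr.
    unfold A', B'; rewrite <- !Derive_n_PSeries.
    - replace (x - 1) with (x + -1) by ring.
      rewrite <- (Derive_n_comp_trans (PSeries B) q x (-1)).
      apply Derive_n_ext_loc.
      assert (Hd : 0 < Rmin x (Rmin (1 - x) (x - (1 - r)))) by (repeat apply Rmin_pos; lra).
      exists (mkposreal _ Hd); intros y Hy; apply Rabs_def2 in Hy; simpl in Hy.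
      unfold minus, plus, opp in Hy; simpl in Hy.
      pose proof (Rmin_l x (Rmin (1 - x) (x - (1 - r)))).
      pose proof (Rmin_r x (Rmin (1 - x) (x - (1 - r)))).
      pose proof (Rmin_l (1 - x) (x - (1 - r))); pose proof (Rmin_r (1 - x) (x - (1 - r))).
      replace (y + -1) with (y - 1) by ring; apply Heq; lra.
    - apply HrB, Rabs_def1; lra.
    - apply HrA, Rabs_def1; lra. }
  assert (HcB : continuity_pt (PSeries B') 0).
  { apply PSeries_continuity; unfold B'; rewrite CV_radius_derive_n.
    apply HrB; rewrite Rabs_R0; trivial. }
  destruct (HcB 1 Rlt_0_1) as [d [Hd Hcont]].
  set (M := Rabs (PSeries B' 0) + 1).
  assert (HM : forall x, 0 < x < 1 -> 1 - r < x -> 1 - d < x -> PSeries A' x <= M).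
  { intros x Hx Hxr Hxd; rewrite Heq' by trivial.
    specialize (Hcont (x - 1)); unfold D_x, no_cond, dist in Hcont; simpl in Hcont.
    unfold Rdist in Hcont.
    assert (H1 : Rabs (PSeries B' (x - 1) - PSeries B' 0) < 1).
    { apply Hcont; split; [split; [trivial|lra]|apply Rabs_def1; lra]. }
    apply Rabs_def2 in H1; unfold M; pose proof (Rle_abs (PSeries B' 0)); lra. }
  set (Sm := Rsum (fun k => Rabs (A' k)) k0).
  assert (Hlower : forall x m, 0 < x < 1 -> c' * (INR m * x ^ (k0 + m)) - Sm <= PSeries A' x).
  { intros x m Hx.
    assert (Hex : ex_series (fun k => A' k * x ^ k)).
    { apply (ex_pseries_R A' x), (CV_radius_inside A' x).
      unfold A'; rewrite CV_radius_derive_n; apply HrA, Rabs_def1; lra. }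
    unfold PSeries; eapply Rle_trans; [|apply (Rsum_le_Series_eventually _ k0 m); trivial].
    - rewrite Rsum_split.
      assert (- Sm <= Rsum (fun k => A' k * x ^ k) k0).
      { unfold Sm; replace (- Rsum (fun k => Rabs (A' k)) k0)
          with (Rsum (fun k => (-1) * Rabs (A' k)) k0) by (rewrite Rsum_scal; ring).
        apply Rsum_le; intros k _.
        assert (0 <= x ^ k <= 1).
        { split; [apply pow_le; lra|rewrite <- (pow1 k); apply pow_incr; lra]. }
        pose proof (Rabs_pos (A' k)); pose proof (Rle_abs (- A' k)); rewrite Rabs_Ropp in *.
        nra. }
      assert (Hconst : forall v n, Rsum (fun _ => v) n = INR n * v).
      { intros v n; induction n as [|n IH]; [simpl; ring|].
        rewrite S_INR; simpl Rsum; rewrite IH; ring. }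
      assert (c' * (INR m * x ^ (k0 + m)) <= Rsum (fun k => A' (k0 + k)%nat * x ^ (k0 + k)) m).
      { replace (c' * (INR m * x ^ (k0 + m))) with (INR m * (c' * x ^ (k0 + m))) by ring.
        rewrite <- Hconst; apply Rsum_le; intros k Hk.
        specialize (HA'low (k0 + k)%nat ltac:(lia)).
        apply Rmult_le_compat; trivial; [lra|apply pow_le; lra|].
        replace (k0 + m)%nat with ((k0 + k) + (m - k))%nat by lia; rewrite pow_add.
        rewrite <- (Rmult_1_r (x ^ (k0 + k))) at 2.
        apply Rmult_le_compat_l; [apply pow_le; lra|].
        rewrite <- (pow1 (m - k)); apply pow_incr; lra. }
      lra.
    - intros k Hk; specialize (HA'low k Hk).
      apply Rmult_le_pos; [lra|apply pow_le; lra]. }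
  (* Enough terms are kept that [c' * INR (S m) / 2] exceeds [M + Sm]. The point [1 - e] is then so
     close to 1 that [(1 - e) ^ n >= 1 / 2] by Bernoulli's inequality, and the lower bound
     contradicts [HM]. *)
  destruct (nfloor_ex (Rmax 0 (2 * (M + Sm + 1) / c'))) as [m [_ Hm]]; [apply Rmax_l|].
  assert (Hm' : 2 * (M + Sm + 1) < c' * (INR m + 1)).
  { assert (2 * (M + Sm + 1) / c' < INR m + 1) as H
      by (eapply Rle_lt_trans; [apply Rmax_r|exact Hm]).
    apply (Rmult_lt_compat_r c') in H; trivial.
    unfold Rdiv in H; rewrite Rmult_assoc, Rinv_l in H; lra. }
  rewrite <- S_INR in Hm'.
  set (n := (k0 + S m)%nat) in *.
  assert (HnR : 0 <= INR n) by apply pos_INR.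
  set (e := Rmin (/ (2 * (INR n + 1))) (Rmin (r / 2) (d / 2))).
  assert (He0 : 0 < e).
  { unfold e; repeat apply Rmin_pos; try lra; apply Rinv_0_lt_compat; lra. }
  assert (He1 : e * (2 * (INR n + 1)) <= 1).
  { apply Rle_trans with (/ (2 * (INR n + 1)) * (2 * (INR n + 1))).
    - apply Rmult_le_compat_r; [lra|apply Rmin_l].
    - apply Req_le; field; lra. }
  assert (He2 : e <= r / 2) by (unfold e; eapply Rle_trans; [apply Rmin_r|apply Rmin_l]).
  assert (He3 : e <= d / 2) by (unfold e; eapply Rle_trans; [apply Rmin_r|apply Rmin_r]).
  assert (He4 : e <= 1 / 2) by nra.
  assert (Hpow : forall j, 1 - INR j * e <= (1 - e) ^ j).
  { induction j as [|j IH]; [simpl; lra|].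
    rewrite S_INR; change ((1 - e) ^ S j) with ((1 - e) * (1 - e) ^ j).
    pose proof (pos_INR j).
    destruct (Rle_or_lt 0 (1 - INR j * e)); [nra|].
    assert (0 <= (1 - e) ^ j) by (apply pow_le; lra); nra. }
  specialize (Hpow n).
  specialize (HM (1 - e) ltac:(lra) ltac:(lra) ltac:(lra)).
  specialize (Hlower (1 - e) (S m) ltac:(lra)); fold n in Hlower.
  assert (1 / 2 <= (1 - e) ^ n) by nra.
  pose proof (pos_INR (S m)).
  assert (c' * (INR (S m) * (1 / 2)) <= c' * (INR (S m) * (1 - e) ^ n)).
  { apply Rmult_le_compat_l; [lra|]; apply Rmult_le_compat_l; lra. }
  lra.
Qed.

(** The term of index [i0] decays most slowly. Every later one has a further factor [1 / (k + 1)],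
    so together they are at most half of it once [k + 1 >= 2 * D]. *)
Lemma leading_inverse_power (x : nat -> C) (n i0 p : nat) :
  (i0 <= n)%nat -> x i0 = 1 -> (forall i, (i < i0)%nat -> x i = 0) ->
  exists k0, forall k, (k0 <= k)%nat ->
    / 2 / (INR k + 1) ^ (p + i0) <=
    Re (Csum (fun i => x i * RtoC (/ (INR k + 1) ^ (p + i)))%C (S n)).
Proof.
  intros Hi0 Hx Hz.
  set (D := Rsum (fun j => Cmod (x (skip i0 j))) n).
  assert (HD : 0 <= D) by (apply Rsum_nonneg; intros; apply Cmod_ge_0).
  destruct (nfloor_ex (2 * D)) as [k0 [_ Hk0]]; [lra|].
  exists k0; intros k Hk; apply le_INR in Hk.
  assert (Hk1 : 1 <= INR k + 1) by (pose proof (pos_INR k); lra).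
  rewrite (Csum_skip _ i0), Hx, Cmult_1_l, re_plus by trivial.
  set (y := / (INR k + 1) ^ (p + i0)).
  assert (Hy : 0 < y) by (apply Rinv_0_lt_compat, pow_lt; lra).
  change (Re (RtoC y)) with y.
  assert (Hrest : Cmod (Csum (fun i => x (skip i0 i) *
    RtoC (/ (INR k + 1) ^ (p + skip i0 i)))%C n) <= y / 2).
  { eapply Rle_trans; [apply Cmod_Csum|].
    apply Rle_trans with (Rsum (fun j => (y / (INR k + 1)) * Cmod (x (skip i0 j))) n).
    - apply Rsum_le; intros j Hj; rewrite Cmod_mult, Rmult_comm.
      destruct (Nat.lt_ge_cases j i0) as [Hji|Hji].
      + replace (x (skip i0 j)) with (RtoC 0).
        * rewrite Cmod_0; lra.
        * symmetry; apply Hz; unfold skip; now rewrite (proj2 (Nat.ltb_lt j i0)).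
      + apply Rmult_le_compat_r; [apply Cmod_ge_0|].
        assert (E : skip i0 j = S j) by (unfold skip; now rewrite (proj2 (Nat.ltb_ge j i0))).
        rewrite E, Cmod_RtoC_nonneg by (apply Rlt_le, Rinv_0_lt_compat, pow_lt; lra).
        replace (y / (INR k + 1)) with (/ (INR k + 1) ^ S (p + i0)).
        * apply Rinv_le_contravar; [apply pow_lt; lra|apply Rle_pow; [lra|lia]].
        * unfold y; simpl; field; split; [apply pow_nonzero|]; lra.
    - rewrite Rsum_scal; fold D.
      apply (Rmult_le_reg_r (INR k + 1)); [lra|].
      replace (y / (INR k + 1) * D * (INR k + 1)) with (y * D) by (field; lra).
      replace (y / 2 * (INR k + 1)) with (y * ((INR k + 1) / 2)) by field.
      apply Rmult_le_compat_l; lra. }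
  pose proof (re_le_Cmod (Csum (fun i => x (skip i0 i) *
    RtoC (/ (INR k + 1) ^ (p + skip i0 i)))%C n)) as Hre.
  apply Rabs_le_between in Hre.
  unfold Rdiv in *; fold y; lra.
Qed.

Lemma Rsum_inv_sq_le (n : nat) : Rsum (fun k => / (INR k + 1) ^ 2) n <= 2.
Proof.
  assert (H : Rsum (fun k => / (INR k + 1) ^ 2) n <= 2 - 2 / (INR n + 1)).
  { induction n as [|n IH]; [simpl; lra|].
    change (Rsum (fun k => / (INR k + 1) ^ 2) n + / (INR n + 1) ^ 2 <= 2 - 2 / (INR (S n) + 1)).
    rewrite S_INR; pose proof (pos_INR n).
    assert (/ (INR n + 1) ^ 2 <= 2 / (INR n + 1) - 2 / (INR n + 1 + 1)); [|lra].
    replace (2 / (INR n + 1) - 2 / (INR n + 1 + 1))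
      with (/ ((INR n + 1) * ((INR n + 1 + 1) / 2))) by (field; lra).
    apply Rinv_le_contravar; nra. }
  pose proof (pos_INR n); assert (0 < 2 / (INR n + 1)) by (apply Rdiv_lt_0_compat; lra); lra.
Qed.

Lemma disk_val_inj (u v : disk) : (u : C) = v -> u = v.
Proof.
  destruct u as [u Hu], v as [v Hv]; simpl; intros <-; f_equal; apply proof_irrelevance.
Qed.

Lemma Cmod_scal_unit (zeta : C) (x : R) : Cmod zeta = 1 -> 0 <= x -> Cmod (x * zeta) = x.
Proof. intros H Hx; rewrite Cmod_mult, H, Cmod_RtoC_nonneg; lra. Qed.

Lemma unit_mult_conj (z : C) : Cmod z = 1 -> (z * Cconj z)%C = 1.
Proof. intros H; rewrite <- Cmod2_conj, H; f_equal; ring. Qed.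

Lemma small_distinct (e : R) : 0 < e -> exists t : nat -> R,
  (forall n, 0 < t n < e) /\ forall i j, t i = t j -> i = j.
Proof.
  intros He; exists (fun n => e / (INR n + 2)); split.
  - intros n; pose proof (pos_INR n); split; [apply Rdiv_lt_0_compat; lra|].
    apply (Rmult_lt_reg_r (INR n + 2)); [lra|].
    unfold Rdiv; rewrite Rmult_assoc, Rinv_l by lra; nra.
  - intros i j E; pose proof (pos_INR i); pose proof (pos_INR j).
    apply INR_eq, (Rplus_eq_reg_r 2), Rinv_eq_reg, (Rmult_eq_reg_l e); [exact E|lra].
Qed.

(** * Injectivity, boundary modulus and surjectivity *)

Section Fredholm_to_automorphism.

Variable w : nat -> R.
Hypothesis hw : Hardy_weight w.
Hypothesis hgrowth : polynomial_growth w.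

(** By Bernoulli's inequality each factor is at most [1 + p / (k + 1) <= ((k + 2) / (k + 1)) ^ p]
    for a suitable [p], and these bounds telescope. *)
Lemma beta_polynomial_bound : exists p : nat, forall k, beta w k <= (INR k + 1) ^ p.
Proof.
  destruct hgrowth as [M HM].
  destruct (nfloor_ex (Rmax 0 M)) as [p [_ Hp]]; [apply Rmax_l|].
  assert (HMp : M <= INR (S p)) by (rewrite S_INR; pose proof (Rmax_r 0 M); lra).
  exists (S p); induction k as [|k IH].
  - simpl beta; rewrite Rplus_0_l, pow1; lra.
  - simpl beta; rewrite S_INR.
    specialize (HM (S k) ltac:(lia)); rewrite S_INR in HM.
    pose proof (pos_INR k) as Hk.
    pose proof (beta_pos w hw k) as Hb.
    assert (Hw : w (S k) <= 1 + INR (S p) * / (INR k + 1)).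
    { pose proof (Rle_abs (w (S k) - 1)).
      assert ((INR k + 1 + 1) * (w (S k) - 1) <= INR (S p)).
      { eapply Rle_trans; [|exact HMp]; eapply Rle_trans; [|exact HM].
        apply Rmult_le_compat_l; lra. }
      destruct (Rle_or_lt (w (S k) - 1) 0).
      - assert (0 <= INR (S p) * / (INR k + 1)); [|lra].
        apply Rmult_le_pos; [apply pos_INR|apply Rlt_le, Rinv_0_lt_compat; lra].
      - apply (Rmult_le_reg_r (INR k + 1)); [lra|].
        rewrite Rmult_plus_distr_r, Rmult_assoc, Rinv_l by lra; nra. }
    assert (Hbern : 1 + INR (S p) * / (INR k + 1) <= (1 + / (INR k + 1)) ^ S p)
      by (apply poly, Rinv_0_lt_compat; lra).
    assert (0 < w (S k)) by (apply (proj1 hw); lia).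
    apply Rle_trans with ((INR k + 1) ^ S p * (1 + / (INR k + 1)) ^ S p).
    + apply Rmult_le_compat; lra.
    + rewrite <- Rpow_mult_distr; apply Req_le; f_equal; field; lra.
Qed.

Variable phi : C -> C.
Hypothesis hanalytic : analytic_on_closed_disk phi.
Hypothesis hclosed : forall z : C, Cmod z <= 1 -> Cmod (phi z) <= 1.
Hypothesis hopen : forall z : C, Cmod z < 1 -> Cmod (phi z) < 1.

Let psi := disk_restriction phi hopen.
Let T := composition_operator psi.

Lemma phi_analytic (z : C) : Cmod z <= 1 -> analytic_at phi z.
Proof. destruct hanalytic as [U [_ [HU Ha]]]; intros Hz; apply Ha, HU, Hz. Qed.

Hypothesis hF : Fredholm (H2 w) (H2_ip w) T.

Lemma no_collision_sequences (a b : nat -> C) :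
  (forall i, Cmod (a i) < 1) -> (forall i, Cmod (b i) < 1) ->
  (forall i, phi (a i) = phi (b i)) ->
  (forall i j, i <> j -> a i <> a j) -> (forall i j, a i <> b j) -> False.
Proof.
  intros Ha Hb Hab Haa Hdis.
  destruct hF as [[HT _] [_ [_ [T' [Hadj Hfin]]]]].
  apply (no_infinite_collisions w hw psi T' (fun i => exist _ (a i) (Ha i))
    (fun i => exist _ (b i) (Hb i))); trivial.
  intros i; apply disk_val_inj; simpl; auto.
Qed.

(** Local constancy would make every point near [z0] collide with [z0]. The second sequence is
    constant here, which is why [no_collision_sequences] asks for distinct terms only in the
    first. *)
Lemma phi_not_locally_constant (z0 : C) : Cmod z0 < 1 ->
  forall d, 0 < d -> exists z, Cmod (z - z0) < d /\ phi z <> phi z0.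
Proof.
  intros Hz0 d Hd; apply NNPP; intros Hno.
  assert (Hc : forall z, Cmod (z - z0) < d -> phi z = phi z0).
  { intros z Hz; apply NNPP; intros Hne; apply Hno; exists z; auto. }
  set (e := Rmin d (1 - Cmod z0)).
  assert (He : 0 < e) by (apply Rmin_pos; lra).
  destruct (small_distinct e He) as [t [Ht Htinj]].
  assert (Hte : forall n, Cmod (z0 + t n - z0) = t n).
  { intros n; replace (z0 + t n - z0)%C with (RtoC (t n)) by ring.
    apply Cmod_RtoC_nonneg, Rlt_le, Ht. }
  pose proof (Rmin_l d (1 - Cmod z0)) as Hr1; pose proof (Rmin_r d (1 - Cmod z0)) as Hr2.
  fold e in Hr1, Hr2.
  apply (no_collision_sequences (fun n => z0 + t n)%C (fun _ => z0)).
  - intros n; pose proof (Ht n).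
    eapply Rle_lt_trans; [apply Cmod_triangle|].
    rewrite Cmod_RtoC_nonneg by lra; lra.
  - trivial.
  - intros n; apply Hc; rewrite Hte; pose proof (Ht n); lra.
  - intros i j Hij E; apply Hij, Htinj, RtoC_inj.
    replace (RtoC (t i)) with ((z0 + t i) - z0)%C by ring; rewrite E; ring.
  - intros i _ E; specialize (Hte i); rewrite E in Hte.
    replace (z0 - z0)%C with (RtoC 0) in Hte by ring; rewrite Cmod_0 in Hte.
    pose proof (Ht i); lra.
Qed.

Lemma phi_injective (z1 z2 : C) : Cmod z1 < 1 -> Cmod z2 < 1 -> phi z1 = phi z2 -> z1 = z2.
Proof.
  intros H1 H2 E; apply NNPP; intros Hne.
  assert (Hr : 0 < Cmod (z1 - z2)) by (apply Cmod_gt_0; now apply Cminus_eq_contra).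
  set (r := Cmod (z1 - z2)) in *.
  (* Preimages within [r / 2] of [z1] cannot coincide with preimages within [r / 2] of [z2]. *)
  assert (Hloc : forall z0, Cmod z0 < 1 -> exists d, 0 < d /\ forall u, Cmod (u - phi z0) < d ->
    exists z, (Cmod (z - z0) < r / 2 /\ Cmod z < 1) /\ phi z = u).
  { intros z0 Hz0.
    destruct (open_mapping phi z0 (1 - Cmod z0) (Rmin (r / 2) (1 - Cmod z0)))
      as [d [Hd Hopen]].
    - lra.
    - apply Rmin_pos; lra.
    - intros z Hz; apply phi_analytic.
      pose proof (Cmod_rev_triangle z z0); lra.
    - now apply phi_not_locally_constant.
    - exists d; split; trivial; intros u Hu; destruct (Hopen u Hu) as [z [Hz Ez]].
      exists z; split; trivial.
      pose proof (Rmin_l (r / 2) (1 - Cmod z0)); pose proof (Rmin_r (r / 2) (1 - Cmod z0)).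
      pose proof (Cmod_rev_triangle z z0); split; lra. }
  destruct (Hloc z1 H1) as [d1 [Hd1 Ho1]]; destruct (Hloc z2 H2) as [d2 [Hd2 Ho2]].
  set (d := Rmin d1 d2).
  assert (Hd : 0 < d) by now apply Rmin_pos.
  destruct (small_distinct d Hd) as [t [Ht Htinj]].
  set (u := fun n => (phi z1 + t n)%C).
  assert (Hu : forall n, Cmod (u n - phi z1) < d).
  { intros n; unfold u; replace (phi z1 + t n - phi z1)%C with (RtoC (t n)) by ring.
    rewrite Cmod_RtoC_nonneg; [|apply Rlt_le]; apply Ht. }
  assert (Hu_inj : forall i j, u i = u j -> i = j).
  { intros i j E'; apply Htinj, RtoC_inj.
    replace (RtoC (t i)) with (u i - phi z1)%C by (unfold u; ring).
    rewrite E'; unfold u; ring. }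
  assert (Ha : forall n, exists z, (Cmod (z - z1) < r / 2 /\ Cmod z < 1) /\ phi z = u n).
  { intros n; apply Ho1; eapply Rlt_le_trans; [apply Hu|apply Rmin_l]. }
  assert (Hb : forall n, exists z, (Cmod (z - z2) < r / 2 /\ Cmod z < 1) /\ phi z = u n).
  { intros n; apply Ho2; rewrite <- E; eapply Rlt_le_trans; [apply Hu|apply Rmin_r]. }
  set (a := fun n => proj1_sig (constructive_indefinite_description _ (Ha n))).
  set (b := fun n => proj1_sig (constructive_indefinite_description _ (Hb n))).
  assert (Ha' : forall n, (Cmod (a n - z1) < r / 2 /\ Cmod (a n) < 1) /\ phi (a n) = u n)
    by (intros n; unfold a; apply proj2_sig).
  assert (Hb' : forall n, (Cmod (b n - z2) < r / 2 /\ Cmod (b n) < 1) /\ phi (b n) = u n)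
    by (intros n; unfold b; apply proj2_sig).
  apply (no_collision_sequences a b).
  - apply Ha'.
  - apply Hb'.
  - intros i; rewrite (proj2 (Ha' i)), (proj2 (Hb' i)); reflexivity.
  - intros i j Hij Eij; apply Hij, Hu_inj.
    rewrite <- (proj2 (Ha' i)), <- (proj2 (Ha' j)), Eij; reflexivity.
  - intros i j Eij; pose proof (proj1 (proj1 (Ha' i))) as Hai.
    pose proof (proj1 (proj1 (Hb' j))) as Hbj; rewrite <- Eij in Hbj.
    pose proof (Cmod_triangle3 z1 (a i) z2) as Htri.
    rewrite (Cmod_minus_sym z1 (a i)) in Htri; fold r in Htri; lra.
Qed.

(** Because the range is closed, [y] can be projected onto it; the residual is orthogonal to the
    range and hence is annihilated by the adjoint. *)
Lemma range_plus_cokernel (y : disk -> C) : H2 w y ->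
  forall T', is_adjoint (H2 w) (H2_ip w) T T' ->
  exists x, H2 w x /\ kernel (H2 w) T' (minus y (T x)).
Proof.
  intros Hy T' Hadj.
  destruct hF as [[HT [HTp [HTs _]]] [Hcl _]].
  destruct (orthogonal_projection w hw (fun g => exists x, H2 w x /\ T x = g)) with (y := y)
    as [m [[x [Hx Em]] Horth]]; trivial.
  - intros g [x [Hx <-]]; now apply HT.
  - exists (T zero), zero; split; trivial; now apply H2_zero.
  - intros g1 g2 [x1 [Hx1 <-]] [x2 [Hx2 <-]]; exists (plus x1 x2); split.
    + now apply H2_plus.
    + now apply HTp.
  - intros c g [x1 [Hx1 <-]]; exists (scal c x1); split.
    + now apply H2_scal.
    + now apply HTs.
  - intros m Hm Happ; apply Hcl; trivial; intros eps He.
    destruct (Happ eps He) as [g [[x [Hx <-]] Hlt]]; exists x; auto.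
  - exists x; split; trivial; rewrite Em.
    apply (adjoint_kernel w hw T); trivial.
    + apply H2_minus; trivial; rewrite <- Em; now apply HT.
    + intros x1 Hx1; apply Horth; exists x1; auto.
Qed.

Lemma phi_unimodular (zeta : C) : Cmod zeta = 1 -> Cmod (phi zeta) = 1.
Proof.
  intros Hzeta.
  destruct (hclosed zeta ltac:(lra)) as [Hlt|]; [exfalso|trivial].
  destruct hF as [_ [_ [_ [T' [Hadj Hfin]]]]].
  destruct beta_polynomial_bound as [p Hp].
  (* The exponent puts these functions into [H2]: multiplied by [beta w k], a coefficient has
     modulus at most [1 / (k + 1)]. The powers of [Cconj zeta] place the singularity at [zeta]. *)
  set (gc := fun i k => (RtoC (/ (INR k + 1) ^ (p + 1 + i)) * Cconj zeta ^ k)%C).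
  assert (Hk1 : forall k, 1 <= INR k + 1) by (intros k; pose proof (pos_INR k); lra).
  assert (Hgc : forall i, l2 w (gc i)).
  { intros i; apply (l2_of_bound w _ 2); intros n.
    eapply Rle_trans; [|apply (Rsum_inv_sq_le n)]; apply Rsum_le; intros k _.
    specialize (Hk1 k); specialize (Hp k); pose proof (beta_pos w hw k).
    unfold gc; rewrite Cmod_mult, Cmod_pow, Cmod_conj, Hzeta, pow1, Rmult_1_r.
    assert (0 < (INR k + 1) ^ p) by (apply pow_lt; lra).
    rewrite Cmod_RtoC_nonneg by (apply Rlt_le, Rinv_0_lt_compat, pow_lt; lra).
    rewrite <- Rpow_mult_distr, <- (pow_inv (INR k + 1) 2); apply pow_incr; split.
    - apply Rmult_le_pos; [|lra]; apply Rlt_le, Rinv_0_lt_compat, pow_lt; lra.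
    - apply Rle_trans with (/ (INR k + 1) ^ (p + 1) * (INR k + 1) ^ p).
      + apply Rmult_le_compat; trivial; try lra.
        * apply Rlt_le, Rinv_0_lt_compat, pow_lt; lra.
        * apply Rinv_le_contravar; [apply pow_lt; lra|apply Rle_pow; [lra|lia]].
      + apply Req_le; rewrite pow_add; field; lra. }
  assert (Hxi : forall i, exists x, H2 w x /\ kernel (H2 w) T' (minus (fn (gc i)) (T x))).
  { intros i; apply range_plus_cokernel; trivial; now apply H2_fn. }
  set (xi := fun i => proj1_sig (constructive_indefinite_description _ (Hxi i))).
  assert (Hxi' : forall i, H2 w (xi i) /\ kernel (H2 w) T' (minus (fn (gc i)) (T (xi i))))
    by (intros i; unfold xi; apply proj2_sig).
  destruct (finite_dimensional_dependent _ Hfin) as [n Hn].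
  destruct (Hn (fun i => minus (fn (gc i)) (T (xi i))) (fun i => proj2 (Hxi' i)))
    as [x0 [Hx0 Hsum0]].
  destruct Hx0 as [i1 [Hi1 Hx0]].
  (* The relation is normalized at its first nonzero coefficient, which belongs to the most slowly
     decaying function. *)
  destruct (least_index (fun i => x0 i <> 0) i1 Hx0) as [i0 [Hi0 [Hnz Hmin]]].
  assert (Hfirst : forall i, (i < i0)%nat -> x0 i = 0)
    by (intros i Hi; apply NNPP; exact (Hmin i Hi)).
  set (x := fun i => (/ x0 i0 * x0 i)%C).
  assert (Hx1 : x i0 = 1) by (unfold x; field; trivial).
  assert (Hxz : forall i, (i < i0)%nat -> x i = 0)
    by (intros i Hi; unfold x; rewrite (Hfirst i) by trivial; ring).
  assert (Hsum : forall z, Csum (fun i => x i * fn (gc i) z)%C (S n) =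
    Csum (fun i => x i * xi i (psi z))%C (S n)).
  { intros z; apply Ceq_minus; rewrite <- Csum_minus.
    rewrite (Csum_ext _ (fun i => / x0 i0 * (x0 i * (fn (gc i) z - xi i (psi z))))%C)
      by (intros; unfold x; ring).
    rewrite Csum_scal.
    assert (E := Hsum0 z).
    change (Csum (fun i => x0 i * (fn (gc i) z - xi i (psi z)))%C (S n) = 0) in E.
    rewrite E; ring. }
  set (fa := fun k => Csum (fun i => x i * taylor_coeff (xi i) k)%C (S n)).
  pose proof (disk_expansion_Csum xi (fun i => taylor_coeff (xi i)) x (S n)
    (fun i => proj1 (H2_coef w _ (proj1 (Hxi' i))))) as Hfa.
  fold fa in Hfa.
  (* A total function on [C], meaningful inside the disk. Since [phi zeta] lies there, [fe (phi z)]
     is analytic at [zeta] itself, although [zeta] is on the circle. *)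
  set (fe := fun u => C_Series (fun k => fa k * u ^ k)%C).
  assert (Hfe : forall z : disk, fe z = Csum (fun i => x i * xi i z)%C (S n)).
  { intros z; apply cser_C_Series; exact (proj1 (disk_expansion_cser _ _) Hfa z). }
  assert (Hana : analytic_at (fun z => fe (phi z)) zeta).
  { apply (analytic_at_comp_series fe phi fa 1); trivial.
    - intros h Hh; replace (0 + h)%C with h by ring.
      change (cser (fun k => fa k * h ^ k)%C (fe (exist (fun z => Cmod z < 1) h Hh : disk))).
      rewrite Hfe; exact (proj1 (disk_expansion_cser _ _) Hfa (exist _ h Hh)).
    - apply phi_analytic; lra. }
  apply analytic_at_expands in Hana; destruct Hana as [b [r [Hr Hb]]].
  set (cc := fun k => Csum (fun i => x i * RtoC (/ (INR k + 1) ^ (p + 1 + i)))%C (S n)).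
  (* Along the radius through [zeta] the powers of [zeta] and [Cconj zeta] cancel, leaving a power
     series in the real variable [t]. *)
  assert (Hcz : forall t, Rabs t < 1 ->
    cser (fun k => cc k * RtoC t ^ k)%C (Csum (fun i => x i * C_Series (fun k => gc i k * (t * zeta) ^ k))%C (S n))).
  { intros t Ht.
    assert (Htz : Cmod (t * zeta) < 1) by (rewrite Cmod_mult, Cmod_R, Hzeta; lra).
    pose proof (disk_expansion_Csum (fun i => fn (gc i)) gc x (S n)
      (fun i => fn_expansion w hw _ (Hgc i))) as He.
    pose proof (proj1 (disk_expansion_cser _ _) He (exist _ _ Htz)) as Hs; simpl in Hs.
    eapply cser_ext; [|exact Hs]; intros k; simpl.
    change ((Csum (fun i => x i * gc i k) (S n) * (t * zeta) ^ k)%C = (cc k * RtoC t ^ k)%C).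
    rewrite Cpow_mult_l.
    replace (cc k) with (Csum (fun i => x i * gc i k)%C (S n) * zeta ^ k)%C; [ring|].
    unfold cc; rewrite Cmult_comm, <- Csum_scal; apply Csum_ext; intros i _; unfold gc.
    replace (zeta ^ k * (x i * (RtoC (/ (INR k + 1) ^ (p + 1 + i)) * Cconj zeta ^ k)))%C
      with (x i * RtoC (/ (INR k + 1) ^ (p + 1 + i)) * (zeta * Cconj zeta) ^ k)%C
      by (rewrite Cpow_mult_l; ring).
    rewrite unit_mult_conj, Cpow_1_l by trivial; ring. }
  destruct (leading_inverse_power x n i0 (p + 1) ltac:(lia) Hx1 Hxz) as [k0 Hk0].
  assert (Hbz : forall t, Rabs t < r ->
    cser (fun k => (b k * zeta ^ k) * RtoC t ^ k)%C (fe (phi (zeta + t * zeta)%C))).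
  { intros t Ht; assert (Htz : Cmod (t * zeta) < r) by (rewrite Cmod_mult, Cmod_R, Hzeta; lra).
    eapply cser_ext; [|exact (Hb _ Htz)]; intros k; simpl.
    rewrite Cpow_mult_l; ring. }
  assert (Hre : forall (u : nat -> C) t l, cser (fun k => u k * RtoC t ^ k)%C l ->
    is_series (fun k => Re (u k) * t ^ k) (Re l)).
  { intros u t l H; apply cser_Re in H; eapply is_series_ext; [|exact H]; intros k; cbv beta.
    rewrite <- RtoC_pow, re_scal_r; reflexivity. }
  apply (singular_at_one (fun k => Re (cc k)) (fun k => Re (b k * zeta ^ k)) r (/ 2)
    (p + 1 + i0) k0 Hr).
  - intros y Hy; eexists; apply Hre, Hcz, Hy.
  - intros y Hy; eexists; apply Hre, Hbz, Hy.
  - intros t Ht Htr; unfold PSeries.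
    rewrite (is_series_unique _ _ (Hre _ _ _ (Hcz t ltac:(apply Rabs_def1; lra)))).
    rewrite (is_series_unique _ _ (Hre _ _ _ (Hbz (t - 1) ltac:(apply Rabs_def1; lra)))).
    f_equal; replace (zeta + RtoC (t - 1) * zeta)%C with (t * zeta)%C
      by (rewrite RtoC_minus; ring).
    assert (Htz : Cmod (t * zeta) < 1) by (rewrite Cmod_scal_unit; lra).
    pose proof (Hsum (exist _ _ Htz)) as E.
    change (phi (t * zeta)%C) with (psi (exist _ _ Htz) : C).
    rewrite Hfe; exact E.
  - lra.
  - exact Hk0.
Qed.

(** For an omitted [u] the Blaschke factor at [u] after [phi] would be zero-free and unimodular on
    the circle, so of modulus one at 0; but [phi 0] is inside the disk. *)
Lemma fredholm_surjective (u : C) : Cmod u < 1 -> exists z, Cmod z < 1 /\ phi z = u.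
Proof.
  intros Hu; apply NNPP; intros Hno.
  assert (H0 : Cmod 0 < 1) by (rewrite Cmod_0; lra).
  destruct (unimodular_constant (fun z => (phi z - u) / (1 - Cconj u * phi z))%C) as [H1 _].
  - intros z Hz; apply (blaschke_analytic u phi z Hu); [now apply phi_analytic|now apply hclosed].
  - intros z Hz; apply Cmult_neq_0; [|apply Cinv_nonzero, blaschke_den; auto].
    apply Cminus_eq_contra; intros E; destruct Hz as [Hz|Hz].
    + apply Hno; exists z; auto.
    + pose proof (phi_unimodular z Hz) as Hp; rewrite E in Hp; lra.
  - intros z Hz; apply blaschke_circle; [trivial|now apply phi_unimodular].
  - pose proof (blaschke_lt_1 u (phi 0) Hu (hopen 0 H0)); lra.
Qed.

Lemma fredholm_automorphism : disk_automorphism phi.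
Proof.
  split; [intros z Hz; apply phi_analytic; lra|].
  split; [exact hopen|].
  split; [exact phi_injective|exact fredholm_surjective].
Qed.

End Fredholm_to_automorphism.

(** * Boundedness of Moebius composition operators *)

(* [mob s n k] is the coefficient of [z^k] in [((z + s) / (1 + s z))^n]. *)
Fixpoint mob (s : R) (n : nat) : nat -> R :=
  match n with
  | O => fun k => match k with O => 1 | S _ => 0 end
  | S n => fix row (k : nat) : R :=
      match k with
      | O => s * mob s n O
      | S k => - s * row k + mob s n k + s * mob s n (S k)
      end
  end.

Lemma mob_0 (s : R) (n : nat) : mob s (S n) 0 = s * mob s n 0.
Proof. reflexivity. Qed.

(** Comparison of coefficients in [(1 + s z) tau_s^(n + 1) = (z + s) tau_s^n], the origin of the
    recursion. *)
Lemma mob_S (s : R) (n k : nat) :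
  mob s (S n) (S k) = - s * mob s (S n) k + mob s n k + s * mob s n (S k).
Proof. reflexivity. Qed.

Lemma mob_at_0 (n k : nat) : mob 0 n k = if (n =? k)%nat then 1 else 0.
Proof.
  revert k; induction n as [|n IH]; intros [|k]; try reflexivity.
  - rewrite mob_0; simpl; ring.
  - rewrite mob_S, !IH.
    change (S n =? S k)%nat with (n =? k)%nat; ring.
Qed.

(** The operator [(1 - z^2) d/dz] acting on coefficients; the absent predecessor of index 0 counts
    as zero. *)
Definition shift_diff (u : nat -> R) (k : nat) : R :=
  (INR k + 1) * u (S k) - (INR k - 1) * match k with O => 0 | S j => u j end.

Lemma shift_diff_Rsum (f : nat -> R) (v : nat -> nat -> R) (N k : nat) :
  shift_diff (fun k => Rsum (fun n => f n * v n k) N) k =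
  Rsum (fun n => f n * shift_diff (v n) k) N.
Proof.
  induction N as [|N IH]; cbn [Rsum].
  - unfold shift_diff; cbn [Rsum]; destruct k; ring.
  - rewrite <- IH; unfold shift_diff; cbn [Rsum]; destruct k; ring.
Qed.

Lemma is_derive_Rplus (f g : R -> R) (x df dg : R) :
  is_derive f x df -> is_derive g x dg -> is_derive (fun t => f t + g t) x (df + dg).
Proof. exact (is_derive_plus (K := R_AbsRing) (V := R_NormedModule) f g x df dg). Qed.

Lemma is_derive_Rmult (f g : R -> R) (x df dg : R) :
  is_derive f x df -> is_derive g x dg ->
  is_derive (fun t => f t * g t) x (df * g x + f x * dg).
Proof.
  intros Hf Hg; exact (is_derive_mult f g x df dg Hf Hg Rmult_comm).
Qed.

Lemma is_derive_Rconst (c x : R) : is_derive (fun _ => c) x 0.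
Proof. exact (is_derive_const (K := R_AbsRing) (V := R_NormedModule) c x). Qed.

Lemma is_derive_Rid (x : R) : is_derive (fun t => t) x 1.
Proof. exact (is_derive_id (K := R_AbsRing) x). Qed.

Lemma is_derive_Rext (f g : R -> R) (x d : R) :
  (forall t, f t = g t) -> is_derive f x d -> is_derive g x d.
Proof. exact (is_derive_ext f g x d). Qed.

Lemma is_derive_eq (f : R -> R) (x d d' : R) : is_derive f x d -> d = d' -> is_derive f x d'.
Proof. intros H <-; exact H. Qed.

(* The coefficients of [f o tau_s] solve [(1 - s^2) d/ds = (1 - z^2) d/dz]. *)
Lemma mob_is_derive (s : R) (n k : nat) : Rabs s < 1 ->
  is_derive (fun s => mob s n k) s (shift_diff (mob s n) k / (1 - s ^ 2)).
Proof.
  intros Hs.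
  assert (H1 : 1 - s ^ 2 <> 0) by (apply Rabs_def2 in Hs; nra).
  revert k; induction n as [|n IHn].
  - intros k.
    apply (is_derive_eq (fun s => mob s 0 k) s 0); [exact (is_derive_Rconst (mob 0 0 k) s)|].
    unfold shift_diff; destruct k as [|[|k]]; simpl mob; simpl INR; field; trivial.
  - induction k as [|k IHk].
    + pose proof (is_derive_Rmult _ _ _ _ _ (is_derive_Rid s) (IHn O)) as Hd.
      apply (is_derive_eq _ _ _ _ Hd).
      unfold shift_diff; rewrite mob_S, mob_0; simpl INR; field; trivial.
    + pose proof (is_derive_Rplus _ _ _ _ _ (is_derive_Rplus _ _ _ _ _
        (is_derive_Rmult _ _ _ _ _ (is_derive_Rmult _ _ _ _ _ (is_derive_Rconst (-1) s)
          (is_derive_Rid s)) IHk) (IHn k))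
        (is_derive_Rmult _ _ _ _ _ (is_derive_Rid s) (IHn (S k)))) as Hd.
      refine (is_derive_eq _ _ _ _ (is_derive_Rext _ (fun s => mob s (S n) (S k)) _ _ _ Hd) _).
      * intros t; rewrite mob_S; ring.
      * unfold shift_diff; rewrite !S_INR.
        destruct k as [|k]; rewrite ?mob_S, ?mob_0; simpl INR; field; trivial.
Qed.

(** The decay is uniform in [s] because the pole [- 1 / s] of [tau_s] has modulus at least [1 / a].
    The constant may depend on [n], as only finitely many powers occur at a time. *)
Lemma mob_decay (a rho : R) (n : nat) : 0 <= a < rho -> rho < 1 ->
  exists K, 0 <= K /\ forall s k, Rabs s <= a -> Rabs (mob s n k) <= K * rho ^ k.
Proof.
  intros Ha Hr; induction n as [|n [K [HK IH]]].
  - exists 1; split; [lra|]; intros s k _; destruct k as [|k]; simpl mob.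
    + rewrite Rabs_R1; simpl; lra.
    + rewrite Rabs_R0; apply Rmult_le_pos; [lra|apply pow_le; lra].
  (* The new constant [K'] solves [a * K' + 2 * K = K' * rho], which closes the inner induction on
     [k]. *)
  - exists (K * (2 / (rho - a))).
    assert (H2 : 2 <= 2 / (rho - a)).
    { apply (Rmult_le_reg_r (rho - a)); [lra|].
      unfold Rdiv; rewrite Rmult_assoc, Rinv_l; lra. }
    assert (HK' : K <= K * (2 / (rho - a))) by nra.
    split; [lra|]; intros s k Hs.
    assert (E : (K * (2 / (rho - a))) * (rho - a) = K * 2) by (field; lra).
    set (K' := K * (2 / (rho - a))) in *.
    pose proof (Rabs_pos s).
    induction k as [|k IHk].
    + rewrite mob_0, Rabs_mult; specialize (IH s O Hs); simpl in *.
      pose proof (Rabs_pos (mob s n 0)); nra.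
    + rewrite mob_S.
      pose proof (IH s k Hs) as I1; pose proof (IH s (S k) Hs) as I2.
      assert (Hrk : 0 <= rho ^ k) by (apply pow_le; lra).
      eapply Rle_trans; [apply Rabs_triang|].
      eapply Rle_trans; [apply Rplus_le_compat_r, Rabs_triang|].
      rewrite !Rabs_mult, Rabs_Ropp.
      assert (J0 : Rabs s * Rabs (mob s (S n) k) <= a * (K' * rho ^ k))
        by (apply Rmult_le_compat; trivial; apply Rabs_pos).
      assert (J2 : Rabs s * Rabs (mob s n (S k)) <= a * (K * rho ^ S k))
        by (apply Rmult_le_compat; trivial; apply Rabs_pos).
      apply Rle_trans with (a * (K' * rho ^ k) + K * rho ^ k + a * (K * rho ^ S k)); [lra|].
      simpl pow in *.
      assert (a * (K * rho) <= K).
      { replace (a * (K * rho)) with (K * (a * rho)) by ring.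
        rewrite <- (Rmult_1_r K) at 2; apply Rmult_le_compat_l; trivial; nra. }
      assert (a * K' + K + a * (K * rho) <= K' * rho) by nra.
      replace (a * (K' * rho ^ k) + K * rho ^ k + a * (K * (rho * rho ^ k)))
        with ((a * K' + K + a * (K * rho)) * rho ^ k) by ring.
      replace (K' * (rho * rho ^ k)) with (K' * rho * rho ^ k) by ring.
      now apply Rmult_le_compat_r.
Qed.

Lemma is_derive_Rsum (u u' : nat -> R -> R) (s : R) (n : nat) :
  (forall k, is_derive (u k) s (u' k s)) ->
  is_derive (fun s => Rsum (fun k => u k s) n) s (Rsum (fun k => u' k s) n).
Proof.
  intros H; induction n as [|n IH]; simpl.
  - apply is_derive_Rconst.
  - now apply (is_derive_Rplus (fun s => Rsum (fun k => u k s) n) (u n)).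
Qed.

(** The function [exp (- L * s) * (F s + eta / L)] has nonpositive derivative, so its value at [a]
    is at most its value at 0. *)
Lemma gronwall (F F' : R -> R) (a L eta : R) :
  0 <= a -> 0 < L -> (forall s, 0 <= s <= a -> is_derive F s (F' s)) ->
  (forall s, 0 <= s <= a -> F' s <= L * F s + eta) ->
  F a + eta / L <= exp (L * a) * (F 0 + eta / L).
Proof.
  intros Ha HL HF Hle.
  set (G := fun s => exp (- L * s) * (F s + eta / L)).
  set (G' := fun s => exp (- L * s) * (F' s - L * F s - eta)).
  assert (HG : forall s, 0 <= s <= a -> is_derive G s (G' s)).
  { intros s Hs; unfold G.
    assert (He : is_derive (fun s => exp (- L * s)) s (- L * exp (- L * s)))
      by (auto_derive; trivial; ring).
    assert (HFs : is_derive (fun s => F s + eta / L) s (F' s)).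
    { apply (is_derive_eq _ _ _ _ (is_derive_Rplus _ _ _ _ _ (HF s Hs)
        (is_derive_Rconst (eta / L) s))); ring. }
    apply (is_derive_eq _ _ _ _ (is_derive_Rmult _ _ _ _ _ He HFs)).
    unfold G'; field; lra. }
  destruct (MVT_gen G 0 a G') as [c [Hc E]].
  { intros s Hs; rewrite Rmin_left, Rmax_right in Hs by trivial; apply HG; lra. }
  { intros s Hs; rewrite Rmin_left, Rmax_right in Hs by trivial.
    apply continuity_pt_filterlim, (ex_derive_continuous (K := R_AbsRing) (V := R_NormedModule)).
    exists (G' s); now apply HG. }
  rewrite Rmin_left, Rmax_right in Hc by trivial.
  assert (HG'c : G' c <= 0).
  { unfold G'; specialize (Hle c Hc); pose proof (exp_pos (- L * c)); nra. }
  assert (HGa : G a <= G 0) by nra.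
  unfold G in HGa; rewrite Rmult_0_r, exp_0, Rmult_1_l in HGa.
  pose proof (exp_pos (L * a)).
  apply (Rmult_le_compat_l (exp (L * a))) in HGa; [|lra].
  rewrite <- Rmult_assoc, <- exp_plus in HGa.
  replace (L * a + - L * a) with 0 in HGa by ring.
  rewrite exp_0, Rmult_1_l in HGa; exact HGa.
Qed.

(** Bernoulli's inequality for [(/ q) ^ j]. It absorbs the factor [INR j] of the boundary term in
    the energy estimate. *)
Lemma linear_times_geom_bounded (q : R) : 0 < q < 1 -> exists c, 0 <= c /\
  forall j, INR j * q ^ j <= c.
Proof.
  intros Hq.
  assert (Hd : 0 < / q - 1).
  { apply (Rmult_lt_reg_r q); [lra|].
    rewrite Rmult_minus_distr_r, Rinv_l by lra; lra. }
  exists (/ (/ q - 1)); split; [now apply Rlt_le, Rinv_0_lt_compat|]; intros j.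
  pose proof (poly j (/ q - 1) Hd) as Hb.
  replace (1 + (/ q - 1)) with (/ q) in Hb by ring; rewrite pow_inv in Hb.
  assert (Hqj : 0 < q ^ j) by (apply pow_lt; lra).
  apply (Rmult_le_reg_r (/ q - 1)); trivial; rewrite Rinv_l by lra.
  apply (Rmult_le_compat_r (q ^ j)) in Hb; [|lra].
  rewrite Rinv_l in Hb by lra; nra.
Qed.

(** Summation by parts: the product [u_k u_(k+1)] occurs with weight [(k + 1) b_k] at index [k] and
    with weight [- k b_(k+1)] at index [k + 1]. The last summand makes up for index [j + 1], which
    is absent from the left side. *)
Lemma energy_identity (u b : nat -> R) (j : nat) :
  Rsum (fun k => u k * shift_diff u k * b k) (S j) =
  Rsum (fun k => u (S k) * u k * ((INR k + 1) * b k - INR k * b (S k))) (S j) +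
  INR j * (u j * u (S j)) * b (S j).
Proof.
  induction j as [|j IH].
  - simpl; unfold shift_diff; simpl; ring.
  - change (Rsum (fun k => u k * shift_diff u k * b k) (S (S j)))
      with (Rsum (fun k => u k * shift_diff u k * b k) (S j) +
        u (S j) * shift_diff u (S j) * b (S j)).
    rewrite IH.
    change (Rsum (fun k => u (S k) * u k * ((INR k + 1) * b k - INR k * b (S k))) (S (S j)))
      with (Rsum (fun k => u (S k) * u k * ((INR k + 1) * b k - INR k * b (S k))) (S j) +
        u (S (S j)) * u (S j) * ((INR (S j) + 1) * b (S j) - INR (S j) * b (S (S j)))).
    unfold shift_diff; rewrite S_INR; ring.
Qed.

(** * The energy estimate *)

Section Moebius_bounded.

Variable w : nat -> R.
Hypothesis hw : Hardy_weight w.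
Hypothesis hgrowth : polynomial_growth w.

Lemma weight_lower : exists m, 0 < m /\ forall k, m <= w (S k).
Proof.
  destruct hw as [Hpos Hlim].
  apply is_lim_seq_spec in Hlim.
  assert (Hh : 0 < 1 / 2) by lra.
  destruct (Hlim (mkposreal _ Hh)) as [N HN]; simpl in HN.
  destruct (finite_lower_bound (fun k => w (S k)) N) as [c [Hc Hck]].
  { intros k; apply Hpos; lia. }
  exists (Rmin c (1 / 2)); split; [apply Rmin_pos; lra|]; intros k.
  destruct (Nat.le_gt_cases k N) as [Hk|Hk].
  - eapply Rle_trans; [apply Rmin_l|auto].
  - eapply Rle_trans; [apply Rmin_r|].
    specialize (HN (S k) ltac:(lia)); apply Rabs_def2 in HN; lra.
Qed.

(** The reciprocal weights also tend to 1, so this is [beta_lower] for them. *)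
Lemma beta_upper (q : R) : 0 < q < 1 -> exists c, 0 < c /\ forall k, beta w k * q ^ k <= c.
Proof.
  intros Hq.
  assert (Hb : forall k, beta (fun k => / w k) k = / beta w k).
  { induction k as [|k IH]; simpl; [lra|].
    rewrite IH, Rinv_mult; reflexivity. }
  assert (hw' : Hardy_weight (fun k => / w k)).
  { split; [intros k Hk; apply Rinv_0_lt_compat, (proj1 hw), Hk|].
    pose proof (is_lim_seq_inv _ _ (proj2 hw)) as H; simpl in H.
    rewrite Rinv_1 in H; apply H; intros E; inversion E; lra. }
  destruct (beta_lower _ hw' q Hq) as [c [Hc Hck]].
  exists (/ c); split; [now apply Rinv_0_lt_compat|]; intros k.
  specialize (Hck k); rewrite Hb in Hck.
  pose proof (beta_pos w hw k) as Hbk.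
  apply (Rmult_le_reg_l c); trivial; rewrite Rinv_r by lra.
  apply (Rmult_le_compat_l (beta w k)) in Hck; [|lra].
  rewrite Rinv_r in Hck by lra; lra.
Qed.

(** With [w (k + 1) = 1 + d] the defect is [beta_k^2 (1 - 2 k d - k d^2)]. Polynomial growth bounds
    both [k |d|] and [|d|] by [M], and the lower bound on the weights trades one factor [beta_k] for
    [beta_(k+1)]. *)
Lemma weight_defect : exists C, 0 < C /\ forall k,
  Rabs ((INR k + 1) * beta w k ^ 2 - INR k * beta w (S k) ^ 2) <= C * (beta w k * beta w (S k)).
Proof.
  destruct hgrowth as [M HM]; destruct weight_lower as [m [Hm Hw]].
  assert (HM0 : 0 <= M).
  { eapply Rle_trans; [|apply (HM 1%nat); lia].
    apply Rmult_le_pos; [pose proof (pos_INR 1); lra|apply Rabs_pos]. }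
  exists ((1 + 2 * M + M * M) / m); split; [apply Rdiv_lt_0_compat; nra|]; intros k.
  specialize (HM (S k) ltac:(lia)); rewrite S_INR in HM; specialize (Hw k).
  pose proof (beta_pos w hw k) as Hb; pose proof (pos_INR k) as Hk.
  simpl beta; set (d := w (S k) - 1) in *.
  assert (Ew : w (S k) = 1 + d) by (unfold d; ring).
  pose proof (Rabs_pos d) as Hd0.
  assert (Hkd : INR k * Rabs d <= M) by nra.
  assert (Hd1 : Rabs d <= M) by nra.
  replace ((INR k + 1) * beta w k ^ 2 - INR k * (beta w k * w (S k)) ^ 2)
    with (beta w k ^ 2 * (1 - 2 * (INR k * d) - INR k * d * d)) by (rewrite Ew; ring).
  rewrite Rabs_mult, (Rabs_pos_eq (beta w k ^ 2)) by apply pow2_ge_0.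
  assert (Hin : Rabs (1 - 2 * (INR k * d) - INR k * d * d) <= 1 + 2 * M + M * M).
  { assert (H1 : Rabs (INR k * d) <= M) by (rewrite Rabs_mult, Rabs_pos_eq; lra).
    assert (H2 : Rabs (INR k * d * d) <= M * M).
    { rewrite Rabs_mult; apply Rmult_le_compat; trivial; apply Rabs_pos. }
    apply Rabs_le_between in H1; apply Rabs_le_between in H2; apply Rabs_le_between; lra. }
  apply Rle_trans with (beta w k ^ 2 * (1 + 2 * M + M * M)).
  - apply Rmult_le_compat_l; [apply pow2_ge_0|exact Hin].
  - replace ((1 + 2 * M + M * M) / m * (beta w k * (beta w k * w (S k))))
      with (beta w k ^ 2 * (1 + 2 * M + M * M) * (w (S k) / m)) by (field; lra).
    rewrite <- (Rmult_1_r (beta w k ^ 2 * (1 + 2 * M + M * M))) at 1.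
    apply Rmult_le_compat_l; [apply Rmult_le_pos; [apply pow2_ge_0|nra]|].
    apply (Rmult_le_reg_r m); trivial; unfold Rdiv; rewrite Rmult_assoc, Rinv_l; lra.
Qed.

(** The inequality [2 x y <= x^2 + y^2] turns the cross terms into energy; the shifted sum reaches
    one index too far, and that term is counted with the boundary. *)
Lemma energy_inequality : exists C, 0 < C /\ forall u j,
  Rsum (fun k => u k * shift_diff u k * beta w k ^ 2) (S j) <=
  C * Rsum (fun k => u k ^ 2 * beta w k ^ 2) (S j) +
  (C * (u (S j) ^ 2 * beta w (S j) ^ 2) +
   INR j * Rabs (u j * u (S j)) * beta w (S j) ^ 2).
Proof.
  destruct weight_defect as [C [HC Hdef]]; exists C; split; trivial; intros u j.
  rewrite (energy_identity u (fun k => beta w k ^ 2)).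
  set (e := fun k => u k ^ 2 * beta w k ^ 2).
  assert (He : forall k, 0 <= e k) by (intros k; apply Rmult_le_pos; apply pow2_ge_0).
  assert (H1 : Rsum (fun k => u (S k) * u k *
    ((INR k + 1) * beta w k ^ 2 - INR k * beta w (S k) ^ 2)) (S j) <=
    Rsum (fun k => C / 2 * (e k + e (S k))) (S j)).
  { apply Rsum_le; intros k _; eapply Rle_trans; [apply Rle_abs|].
    rewrite Rabs_mult.
    apply Rle_trans with (Rabs (u (S k) * u k) * (C * (beta w k * beta w (S k)))).
    - apply Rmult_le_compat_l; [apply Rabs_pos|apply Hdef].
    - unfold e; rewrite Rabs_mult, <- (pow2_abs (u k)), <- (pow2_abs (u (S k))).
      pose proof (pow2_ge_0 (Rabs (u k) * beta w k - Rabs (u (S k)) * beta w (S k))) as Hsq.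
      assert (0 <= C / 2 * (Rabs (u k) * beta w k - Rabs (u (S k)) * beta w (S k)) ^ 2)
        by (apply Rmult_le_pos; lra).
      lra. }
  rewrite Rsum_scal, Rsum_plus in H1.
  assert (H2 : Rsum (fun k => e (S k)) (S j) <= Rsum e (S j) + e (S j)).
  { pose proof (Rsum_split e 1 (S j)) as Hs.
    change (Rsum e (1 + S j)) with (Rsum e (S j) + e (S j)) in Hs.
    change (Rsum (fun k => e (1 + k)%nat) (S j)) with (Rsum (fun k => e (S k)) (S j)) in Hs.
    simpl (Rsum e 1) in Hs; specialize (He O); lra. }
  assert (H3 : INR j * (u j * u (S j)) * beta w (S j) ^ 2 <=
    INR j * Rabs (u j * u (S j)) * beta w (S j) ^ 2).
  { apply Rmult_le_compat_r; [apply pow2_ge_0|].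
    apply Rmult_le_compat_l; [apply pos_INR|apply Rle_abs]. }
  change (fun k => u k ^ 2 * beta w k ^ 2) with e.
  change (u (S j) ^ 2 * beta w (S j) ^ 2) with (e (S j)).
  pose proof (Rsum_nonneg e (S j) He); pose proof (He (S j)).
  nra.
Qed.

Lemma mob_bounded_real (a : R) : 0 <= a < 1 -> exists B, 0 < B /\
  forall (f : nat -> R) N m,
    Rsum (fun k => Rsum (fun n => f n * mob a n k) N ^ 2 * beta w k ^ 2) m <=
    B * Rsum (fun n => f n ^ 2 * beta w n ^ 2) N.
Proof.
  intros Ha; destruct energy_inequality as [C [HC Hen]].
  assert (Ha2 : 0 < 1 - a ^ 2) by nra.
  (* The growth rate [2 * C / (1 - s ^ 2)] of the energy on [[0, a]] is largest at [s = a]. *)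
  set (L := 2 * C / (1 - a ^ 2)).
  assert (HL : 0 < L) by (apply Rdiv_lt_0_compat; lra).
  exists (exp (L * a)); split; [apply exp_pos|]; intros f N m.
  set (u := fun k s => Rsum (fun n => f n * mob s n k) N).
  set (E := fun m s => Rsum (fun k => u k s ^ 2 * beta w k ^ 2) m).
  assert (E_mono : forall m1 m2 s, (m1 <= m2)%nat -> E m1 s <= E m2 s).
  { intros m1 m2 s H; apply Rsum_mono; trivial; intros k.
    apply Rmult_le_pos; apply pow2_ge_0. }
  set (F := Rsum (fun n => f n ^ 2 * beta w n ^ 2) N).
  (* At [s = 0] the Moebius map is the identity, so the evolution starts from the coefficients
     [f]. *)
  assert (Hu0 : forall k, u k 0 = if (k <? N)%nat then f k else 0).
  { intros k; unfold u; clear; induction N as [|N IH]; [reflexivity|].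
    simpl Rsum; rewrite IH, mob_at_0.
    destruct (Nat.ltb_spec k N), (Nat.ltb_spec k (S N)), (Nat.eqb_spec N k); try lia;
      subst; ring. }
  assert (HE0 : forall m, E m 0 <= F).
  { intros m'; destruct (Nat.le_ge_cases m' N) as [Hm|Hm].
    - apply Rle_trans with (Rsum (fun n => f n ^ 2 * beta w n ^ 2) m').
      + apply Rsum_le; intros k Hk; rewrite Hu0, (proj2 (Nat.ltb_lt k N)) by lia; lra.
      + apply Rsum_mono; trivial; intros; apply Rmult_le_pos; apply pow2_ge_0.
    - unfold E; replace m' with (N + (m' - N))%nat by lia; rewrite Rsum_split.
      rewrite (Rsum_ext (fun k => u (N + k)%nat 0 ^ 2 * _) (fun _ => 0 * 0)).
      + rewrite Rsum_scal, Rmult_0_l, Rplus_0_r.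
        apply Rsum_le; intros k Hk; rewrite Hu0, (proj2 (Nat.ltb_lt k N)) by lia; lra.
      + intros k _; rewrite Hu0, (proj2 (Nat.ltb_ge (N + k) N)) by lia; ring. }
  assert (Hu' : forall k s, Rabs s < 1 ->
    is_derive (u k) s (shift_diff (fun k => u k s) k / (1 - s ^ 2))).
  { intros k s Hs; assert (1 - s ^ 2 <> 0) by (apply Rabs_def2 in Hs; nra).
    refine (is_derive_eq _ _ _ _ (is_derive_Rsum (fun n s => f n * mob s n k)
      (fun n s => 0 * mob s n k + f n * (shift_diff (mob s n) k / (1 - s ^ 2))) s N _) _).
    - intros n; apply (is_derive_Rmult (fun _ => f n) (fun s => mob s n k));
        [apply is_derive_Rconst|now apply mob_is_derive].
    - unfold u; rewrite shift_diff_Rsum; unfold Rdiv; rewrite Rmult_comm, <- Rsum_scal.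
      apply Rsum_ext; intros n _; ring. }
  (* geometric decay of the coefficients makes the boundary terms negligible *)
  set (sg := (1 + a) / 2).
  assert (Hsg : 0 < sg < 1) by (unfold sg; lra).
  assert (Hsg2 : a < sg ^ 2 < 1) by (unfold sg; split; nra).
  (* The ratio is the square of [sg], so that one factor [sg ^ k] pays for the growth of [beta w k]
     and another remains. *)
  assert (Hdec : exists K, 0 <= K /\ forall k s, 0 <= s <= a -> Rabs (u k s) <= K * (sg ^ 2) ^ k).
  { unfold u; clear - Ha Hsg Hsg2; induction N as [|N [K [HK IH]]].
    - exists 0; split; [lra|]; intros; simpl; rewrite Rabs_R0; lra.
    - destruct (mob_decay a (sg ^ 2) N ltac:(lra) ltac:(lra)) as [K1 [HK1 Hm]].
      pose proof (Rabs_pos (f N)).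
      exists (K + Rabs (f N) * K1); split; [nra|]; intros k s Hs; simpl Rsum.
      eapply Rle_trans; [apply Rabs_triang|]; rewrite Rabs_mult.
      specialize (IH k s Hs); specialize (Hm s k ltac:(rewrite Rabs_pos_eq; lra)).
      rewrite Rmult_plus_distr_r, Rmult_assoc.
      apply Rplus_le_compat; trivial; now apply Rmult_le_compat_l. }
  destruct Hdec as [K [HK Hdec]].
  destruct (beta_upper sg Hsg) as [Bt [HBt Hbeta]].
  destruct (linear_times_geom_bounded sg Hsg) as [c [Hc Hlin]].
  assert (Hub : forall k s, 0 <= s <= a -> Rabs (u k s) * beta w k <= K * Bt * sg ^ k).
  { intros k s Hs; specialize (Hdec k s Hs); specialize (Hbeta k).
    pose proof (beta_pos w hw k).
    assert (0 < sg ^ k) by (apply pow_lt; lra).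
    apply Rle_trans with (K * (sg ^ 2) ^ k * beta w k).
    - apply Rmult_le_compat_r; lra.
    - rewrite <- pow_mult, Nat.mul_comm, pow_mult.
      replace (K * (sg ^ k) ^ 2 * beta w k) with (K * sg ^ k * (beta w k * sg ^ k)) by ring.
      replace (K * Bt * sg ^ k) with (K * sg ^ k * Bt) by ring.
      apply Rmult_le_compat_l; trivial; apply Rmult_le_pos; lra. }
  (* The part [C * A ^ 2] covers the energy at index [j + 1], and [c * A ^ 2] covers the cross term
     with its factor [INR j]. *)
  set (A := K * Bt); set (D := (C + c) * A ^ 2).
  assert (HA : 0 <= A) by (apply Rmult_le_pos; lra).
  assert (HD : 0 <= D) by (apply Rmult_le_pos; [lra|apply pow2_ge_0]).
  assert (Hbd : forall j s, 0 <= s <= a ->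
    C * (u (S j) s ^ 2 * beta w (S j) ^ 2) +
    INR j * Rabs (u j s * u (S j) s) * beta w (S j) ^ 2 <= D * sg ^ j).
  { intros j s Hs.
    assert (Hj : 0 < sg ^ j <= 1).
    { split; [apply pow_lt; lra|rewrite <- (pow1 j); apply pow_incr; lra]. }
    pose proof (beta_pos w hw (S j)) as Hb.
    set (X := Rabs (u (S j) s) * beta w (S j)); set (Y := Rabs (u j s) * beta w (S j)).
    assert (HX : 0 <= X <= A * (sg * sg ^ j)).
    { split; [apply Rmult_le_pos; [apply Rabs_pos|lra]|exact (Hub (S j) s Hs)]. }
    assert (HY : 0 <= Y) by (apply Rmult_le_pos; [apply Rabs_pos|lra]).
    (* [Hub] pairs equal indices, but the cross term also pairs [u j] with [beta w (S j)]; the shift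
       costs one factor [sg]. *)
    assert (HYs : Y * sg <= A * sg ^ j).
    { specialize (Hdec j s Hs); specialize (Hbeta (S j)).
      apply (Rmult_le_reg_r (sg ^ j)); [lra|].
      apply Rle_trans with (Rabs (u j s) * (beta w (S j) * (sg * sg ^ j))).
      - unfold Y; apply Req_le; ring.
      - change (sg * sg ^ j) with (sg ^ S j).
        apply Rle_trans with ((K * (sg ^ 2) ^ j) * Bt).
        + apply Rmult_le_compat; trivial; [apply Rabs_pos|].
          apply Rmult_le_pos; [lra|apply pow_le; lra].
        + unfold A; rewrite <- pow_mult, Nat.mul_comm, pow_mult; apply Req_le; ring. }
    replace (u (S j) s ^ 2 * beta w (S j) ^ 2) with (X ^ 2)
      by (unfold X; rewrite Rpow_mult_distr, pow2_abs; reflexivity).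
    replace (INR j * Rabs (u j s * u (S j) s) * beta w (S j) ^ 2) with (INR j * (X * Y))
      by (unfold X, Y; rewrite Rabs_mult; ring).
    assert (HX2 : X ^ 2 <= A ^ 2 * sg ^ j).
    { apply Rle_trans with ((A * (sg * sg ^ j)) ^ 2); [apply pow_incr; lra|].
      replace ((A * (sg * sg ^ j)) ^ 2) with (A ^ 2 * (sg ^ j * (sg ^ 2 * sg ^ j))) by ring.
      apply Rmult_le_compat_l; [apply pow2_ge_0|]; nra. }
    assert (HXY : X * Y <= A ^ 2 * (sg ^ j * sg ^ j)).
    { apply Rle_trans with (A * sg ^ j * (Y * sg)).
      - replace (A * sg ^ j * (Y * sg)) with (A * (sg * sg ^ j) * Y) by ring.
        apply Rmult_le_compat_r; lra.
      - replace (A ^ 2 * (sg ^ j * sg ^ j)) with (A * sg ^ j * (A * sg ^ j)) by ring.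
        apply Rmult_le_compat_l; trivial; apply Rmult_le_pos; lra. }
    specialize (Hlin j); pose proof (pos_INR j) as HjR.
    assert (HjXY : INR j * (X * Y) <= c * (A ^ 2 * sg ^ j)).
    { apply Rle_trans with (INR j * (A ^ 2 * (sg ^ j * sg ^ j))).
      - now apply Rmult_le_compat_l.
      - replace (INR j * (A ^ 2 * (sg ^ j * sg ^ j)))
          with ((INR j * sg ^ j) * (A ^ 2 * sg ^ j)) by ring.
        apply Rmult_le_compat_r; trivial.
        apply Rmult_le_pos; [apply pow2_ge_0|lra]. }
    unfold D; nra. }
  set (eta := fun j => 2 / (1 - a ^ 2) * (D * sg ^ j)).
  (* The section [m] stays fixed while the truncation [j] tends to infinity and [eta j] to zero. *)
  assert (Hmain : forall j, (m <= j)%nat -> E m a <= exp (L * a) * (F + eta j / L)).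
  { intros j Hj.
    assert (Heta : 0 <= eta j / L).
    { apply Rdiv_le_0_compat; trivial; apply Rmult_le_pos.
      - apply Rdiv_le_0_compat; lra.
      - apply Rmult_le_pos; trivial; apply pow_le; lra. }
    pose proof (gronwall (E (S j)) (fun s => Rsum (fun k => 2 * (u k s) *
      (shift_diff (fun k => u k s) k / (1 - s ^ 2)) * beta w k ^ 2) (S j)) a L (eta j)
      (proj1 Ha) HL) as HG.
    assert (HE : E (S j) a + eta j / L <= exp (L * a) * (E (S j) 0 + eta j / L)).
    { apply HG; clear HG.
      - intros s Hs.
        apply (is_derive_Rsum (fun k s => u k s ^ 2 * beta w k ^ 2)
          (fun k s => 2 * u k s * (shift_diff (fun k => u k s) k / (1 - s ^ 2)) * beta w k ^ 2)).
        intros k; specialize (Hu' k s ltac:(rewrite Rabs_pos_eq; lra)).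
        apply (is_derive_Rext (fun s => u k s * u k s * beta w k ^ 2)); [intros; ring|].
        apply (is_derive_eq _ _ _ _ (is_derive_Rmult _ _ _ _ _
          (is_derive_Rmult _ _ _ _ _ Hu' Hu') (is_derive_Rconst (beta w k ^ 2) s))).
        ring.
      - intros s Hs.
        assert (Hs2 : 0 < 1 - s ^ 2) by nra.
        set (Q := Rsum (fun k => u k s * shift_diff (fun k => u k s) k * beta w k ^ 2) (S j)).
        rewrite (Rsum_ext _ (fun k => 2 / (1 - s ^ 2) *
          (u k s * shift_diff (fun k => u k s) k * beta w k ^ 2))) by (intros; field; lra).
        rewrite Rsum_scal; fold Q.
        assert (HQ : Q <= C * E (S j) s + D * sg ^ j).
        { eapply Rle_trans; [apply (Hen (fun k => u k s) j)|].
          apply Rplus_le_compat_l, Hbd, Hs. }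
        assert (HY : 0 <= C * E (S j) s + D * sg ^ j).
        { apply Rplus_le_le_0_compat; apply Rmult_le_pos; try lra.
          - apply Rsum_nonneg; intros; apply Rmult_le_pos; apply pow2_ge_0.
          - apply pow_le; lra. }
        replace (L * E (S j) s + eta j) with (2 / (1 - a ^ 2) * (C * E (S j) s + D * sg ^ j))
          by (unfold L, eta; field; lra).
        apply Rle_trans with (2 / (1 - s ^ 2) * (C * E (S j) s + D * sg ^ j)).
        + apply Rmult_le_compat_l; trivial; apply Rdiv_le_0_compat; lra.
        + apply Rmult_le_compat_r; trivial.
          apply Rmult_le_compat_l; [lra|]; apply Rinv_le_contravar; nra. }
    specialize (HE0 (S j)).
    pose proof (E_mono m (S j) a ltac:(lia)).
    pose proof (exp_pos (L * a)).
    assert (exp (L * a) * (E (S j) 0 + eta j / L) <= exp (L * a) * (F + eta j / L))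
      by (apply Rmult_le_compat_l; lra).
    lra. }
  assert (Hlim : is_lim_seq (fun j => exp (L * a) * (F + eta j / L)) (exp (L * a) * F)).
  { apply (is_lim_seq_ext (fun j => exp (L * a) * (F + (2 / (1 - a ^ 2) * D / L) * sg ^ j))).
    - intros j; unfold eta; field; lra.
    - apply is_lim_seq_mult'; [apply is_lim_seq_const|].
      replace (Finite F) with (Finite (F + (2 / (1 - a ^ 2) * D / L) * 0)) by (f_equal; ring).
      apply is_lim_seq_plus'; [apply is_lim_seq_const|].
      apply is_lim_seq_mult'; [apply is_lim_seq_const|].
      apply is_lim_seq_geom; rewrite Rabs_pos_eq; lra. }
  apply (is_lim_seq_le_loc (fun _ => E m a) (fun j => exp (L * a) * (F + eta j / L))
    (Finite _) (Finite _)); [|apply is_lim_seq_const|exact Hlim].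
  exists m; exact Hmain.
Qed.

(** The matrix [mob a] is real, so real and imaginary parts decouple. *)
Lemma mob_bounded (a : R) : 0 <= a < 1 -> exists B, 0 < B /\
  forall (f : nat -> C) N m,
    nsq w (fun k => Csum (fun n => f n * RtoC (mob a n k))%C N) m <= B * nsq w f N.
Proof.
  intros Ha; destruct (mob_bounded_real a Ha) as [B [HB H]]; exists B; split; trivial.
  intros f N m.
  pose proof (H (fun n => Re (f n)) N m) as HR; pose proof (H (fun n => Im (f n)) N m) as HI.
  assert (E : nsq w f N = Rsum (fun n => Re (f n) ^ 2 * beta w n ^ 2) N +
    Rsum (fun n => Im (f n) ^ 2 * beta w n ^ 2) N).
  { unfold nsq; rewrite <- Rsum_plus; apply Rsum_ext; intros; rewrite Cmod2_alt; ring. }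
  rewrite E, Rmult_plus_distr_l.
  eapply Rle_trans; [|apply (Rplus_le_compat _ _ _ _ HR HI)].
  apply Req_le; unfold nsq; rewrite <- Rsum_plus; apply Rsum_ext; intros k _.
  rewrite Cmod2_alt, Re_Csum, Im_Csum.
  rewrite (Rsum_ext (fun n => Re (f n * RtoC (mob a n k))%C) (fun n => Re (f n) * mob a n k))
    by (intros; apply re_scal_r).
  rewrite (Rsum_ext (fun n => Im (f n * RtoC (mob a n k))%C) (fun n => Im (f n) * mob a n k))
    by (intros; apply im_scal_r).
  ring.
Qed.

(** * Composition with [tau s] and with rotations *)

Definition tau (s : R) (z : C) : C := ((z + s) / (1 + s * z))%C.

Lemma tau_den (s : R) (z : C) : 0 <= s < 1 -> Cmod z <= 1 -> (1 + s * z)%C <> 0.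
Proof.
  intros Hs Hz; apply one_plus_nonzero; rewrite Cmod_mult, Cmod_RtoC_nonneg by lra.
  pose proof (Cmod_ge_0 z); nra.
Qed.

(** Decay gives convergence to some [G]; summing the recursion yields
    [G * (1 + s z) = (z + s) tau^n], which identifies [G]. *)
Lemma mob_cser (s : R) (n : nat) (z : C) : 0 <= s < 1 -> Cmod z < 1 ->
  cser (fun k => RtoC (mob s n k) * z ^ k)%C (tau s z ^ n)%C.
Proof.
  intros Hs Hz; induction n as [|n IH].
  - replace (tau s z ^ 0)%C with (Csum (fun k => RtoC (mob s 0 k) * z ^ k)%C 1)
      by (simpl; ring).
    apply cser_finite; intros [|k] Hk; [lia|simpl; ring].
  - assert (Hex : exists G, cser (fun k => RtoC (mob s (S n) k) * z ^ k)%C G).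
    { destruct (mob_decay s ((1 + s) / 2) (S n)) as [K [HK Hd]]; [lra|lra|].
      eexists; apply (cser_abs _ (K * / (1 - Cmod z))); intros m.
      pose proof (Cmod_ge_0 z).
      apply geom_bound_sum; [lra|trivial|]; intros k.
      rewrite Cmod_mult, Cmod_pow, Cmod_R.
      apply Rmult_le_compat_r; [apply pow_le; lra|].
      eapply Rle_trans; [apply Hd; rewrite Rabs_pos_eq; lra|].
      rewrite <- (Rmult_1_r K) at 2; apply Rmult_le_compat_l; trivial.
      apply Rle_trans with (1 ^ k); [apply pow_incr; lra|rewrite pow1; lra]. }
    destruct Hex as [G HG].
    replace (tau s z ^ S n)%C with G; trivial.
    pose proof (tau_den s z Hs ltac:(lra)) as Hden.
    pose proof (proj1 (cser_shift _ _ 1) HG) as H1.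
    pose proof (proj1 (cser_shift _ _ 1) IH) as H2.
    pose proof (cser_plus _ _ _ _ (cser_plus _ _ _ _ (cser_scal (- s * z)%C _ _ HG)
      (cser_scal z _ _ IH)) (cser_scal s _ _ H2)) as H3.
    assert (E : (G - Csum (fun k => RtoC (mob s (S n) k) * z ^ k) 1)%C =
      (- s * z * G + z * tau s z ^ n +
       s * (tau s z ^ n - Csum (fun k => RtoC (mob s n k) * z ^ k) 1))%C).
    { apply (cser_unique _ _ _ H1).
      eapply cser_ext; [|exact H3]; intros k; cbv beta.
      change (1 + k)%nat with (S k).
      rewrite mob_S, !RtoC_plus, !RtoC_mult, RtoC_opp, !Cpow_S; ring. }
    cbn [Csum] in E; rewrite mob_0, RtoC_mult in E.
    assert (E2 : (G * (1 + s * z))%C = ((z + s) * tau s z ^ n)%C).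
    { replace (G * (1 + s * z))%C with ((G - (0 + s * RtoC (mob s n 0) * z ^ 0)) + s * z * G +
        s * RtoC (mob s n 0))%C by ring.
      rewrite E; ring. }
    rewrite Cpow_S; unfold tau at 1.
    replace G with (G * (1 + s * z) / (1 + s * z))%C by (field; trivial).
    rewrite E2; field; trivial.
Qed.

Definition bounded_composition (psi : disk -> disk) : Prop :=
  exists B, 0 <= B /\ forall f, H2 w f ->
    H2 w (composition_operator psi f) /\
    ip_norm (H2_ip w) (composition_operator psi f) <= B * ip_norm (H2_ip w) f.

(** The images [g N] of the Taylor polynomials of [f] form a Cauchy sequence. Since point
    evaluations are continuous, the function of its limit [l] agrees with the composition at every
    point. *)
Lemma tau_bounded (s : R) (psi : disk -> disk) : 0 <= s < 1 ->
  (forall z : disk, (psi z : C) = tau s z) -> bounded_composition psi.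
Proof.
  intros Hs Hpsi; destruct (mob_bounded s Hs) as [B [HB Hmob]].
  (* Comparing [l] with a single [g N] through [Cmod_plus_sq] doubles the bound on squared norms;
     [4 * B] leaves some slack. *)
  exists (sqrt (4 * B)); split; [apply sqrt_pos|]; intros f Hf.
  destruct (H2_coef w f Hf) as [Hfe Hfl].
  set (a := taylor_coeff f) in *.
  set (g := fun N k => Csum (fun n => a n * RtoC (mob s n k))%C N).
  assert (Hdiff : forall N d m, nsq w (fun k => g (N + d)%nat k - g N k)%C m <=
    B * Rsum (fun n => Cmod (a (N + n)%nat) ^ 2 * beta w (N + n) ^ 2) d).
  { intros N d m.
    (* Setting the first [N] coefficients to zero turns the bound into one for the difference of two
       images. *)
    pose proof (Hmob (fun n => if (n <? N)%nat then RtoC 0 else a n) (N + d)%nat m) as H.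
    assert (E1 : forall k, Csum (fun n => (if (n <? N)%nat then RtoC 0 else a n) *
      RtoC (mob s n k))%C (N + d) = (g (N + d)%nat k - g N k)%C).
    { intros k; unfold g; rewrite !Csum_split.
      rewrite (Csum_ext (fun n => (if (n <? N)%nat then RtoC 0 else a n) * _)%C
        (fun _ => RtoC 0) N).
      - rewrite Csum_zero.
        rewrite (Csum_ext (fun k0 => (if (N + k0 <? N)%nat then RtoC 0 else a (N + k0)%nat) * _)%C
          (fun n => a (N + n)%nat * RtoC (mob s (N + n) k))%C).
        + ring.
        + intros n _; now rewrite (proj2 (Nat.ltb_ge (N + n) N)) by lia.
      - intros n Hn; rewrite (proj2 (Nat.ltb_lt n N) Hn); ring. }
    assert (E2 : nsq w (fun n => if (n <? N)%nat then RtoC 0 else a n) (N + d) =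
      Rsum (fun n => Cmod (a (N + n)%nat) ^ 2 * beta w (N + n) ^ 2) d).
    { unfold nsq; rewrite Rsum_split.
      rewrite (Rsum_ext _ (fun _ => 0 * 0) N).
      - rewrite Rsum_scal, Rmult_0_l, Rplus_0_l; apply Rsum_ext; intros n _.
        now rewrite (proj2 (Nat.ltb_ge (N + n) N)) by lia.
      - intros n Hn; rewrite (proj2 (Nat.ltb_lt n N) Hn), Cmod_0; ring. }
    rewrite E2 in H; eapply Rle_trans; [|exact H]; apply Req_le.
    unfold nsq; apply Rsum_ext; intros k _; now rewrite E1. }
  destruct (l2_complete w hw g) as [l Hl].
  { intros eps He.
    destruct (series_tail (fun n => Cmod (a n) ^ 2 * beta w n ^ 2) (eps / B)) as [N HN]; trivial.
    { apply nsq_term_nonneg. }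
    { now apply Rdiv_lt_0_compat. }
    assert (Hwlog : forall m d K, (N <= m)%nat -> nsq w (fun k => g (m + d)%nat k - g m k)%C K <= eps).
    { intros m d K Hm; eapply Rle_trans; [apply Hdiff|].
      apply Rle_trans with (B * (eps / B)).
      - apply Rmult_le_compat_l; [lra|]; now apply HN.
      - apply Req_le; field; lra. }
    exists N; intros m n Hm Hn K.
    destruct (Nat.le_ge_cases m n) as [Hmn|Hmn].
    - replace (nsq w (fun k => g m k - g n k)%C K) with (nsq w (fun k => g n k - g m k)%C K)
        by (apply Rsum_ext; intros; now rewrite Cmod_minus_sym).
      replace n with (m + (n - m))%nat by lia; now apply Hwlog.
    - replace m with (n + (m - n))%nat by lia; now apply Hwlog. }
  assert (Hgn : forall N m, nsq w (g N) m <= B * nrm2 w a).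
  { intros N m; eapply Rle_trans; [apply Hmob|].
    apply Rmult_le_compat_l; [lra|]; now apply nsq_le_nrm2. }
  assert (Hlb : forall m, nsq w l m <= 2 * (B * nrm2 w a)).
  { intros m; apply Rnot_lt_le; intros Hlt.
    destruct (Hl ((nsq w l m - 2 * (B * nrm2 w a)) / 4)) as [N HN]; [lra|].
    specialize (HN N (le_n N) m); specialize (Hgn N m).
    assert (nsq w l m <= 2 * nsq w (g N) m + 2 * nsq w (fun k => g N k - l k)%C m); [|lra].
    unfold nsq; rewrite <- !Rsum_scal, <- Rsum_plus; apply Rsum_le; intros k _.
    replace (l k) with (g N k + (- (g N k - l k)))%C at 1 by ring.
    pose proof (Cmod_plus_sq (g N k) (- (g N k - l k))) as Hp; rewrite Cmod_opp in Hp.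
    pose proof (pow2_ge_0 (beta w k)); nra. }
  destruct (l2_of_bound w l _ Hlb) as [Hll Hln].
  assert (Hcomp : composition_operator psi f = fn l).
  { apply functional_extensionality; intros z; unfold composition_operator.
    destruct (l2_eval w hw (Cmod z)) as [Ev [HEv Hev]].
    { split; [apply Cmod_ge_0|apply (proj2_sig z)]. }
    pose proof (proj1 (disk_expansion_cser f a) Hfe (psi z)) as Hfz.
    rewrite Hpsi in Hfz.
    pose proof (proj1 (disk_expansion_cser _ _) (fn_expansion w hw l Hll) z) as Hlz.
    apply Cmod_small_eq; intros eps He.
    destruct (Hfz (eps / 2)) as [N1 HN1]; [lra|].
    set (eta := eps / 2 / (Ev + 1)).
    assert (Heta : 0 < eta) by (repeat apply Rdiv_lt_0_compat; lra).
    destruct (Hl (eta ^ 2)) as [N2 HN2]; [now apply pow_lt|].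
    set (N := (N1 + N2)%nat).
    specialize (HN1 N ltac:(lia)).
    destruct (Hev _ eta (Rlt_le _ _ Heta) (HN2 N ltac:(lia)) z (Rle_refl _)) as [Hs1 Hs2].
    assert (Hg : cser (fun k => g N k * (z : C) ^ k)%C (Csum (fun n => a n * tau s z ^ n)%C N)).
    { eapply cser_ext; [|apply (cser_Csum (fun n k => a n * (RtoC (mob s n k) * (z : C) ^ k))%C)].
      - intros k; simpl; unfold g; rewrite Cmult_comm, <- Csum_scal; apply Csum_ext; intros; ring.
      - intros n _; apply cser_scal, mob_cser; trivial; apply (proj2_sig z). }
    assert (Ed : C_Series (fun k => (g N k - l k) * (z : C) ^ k)%C =
      (Csum (fun n => a n * tau s z ^ n) N - fn l z)%C).
    { apply cser_C_Series.
      replace (Csum (fun n => a n * tau s z ^ n) N - fn l z)%C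
        with (Csum (fun n => a n * tau s z ^ n) N + (-(1)) * fn l z)%C by ring.
      eapply cser_ext; [|apply (cser_plus _ _ _ _ Hg (cser_scal (-(1)) _ _ Hlz))].
      intros k; simpl; ring. }
    rewrite Ed in Hs2.
    assert (Ev * eta < eps / 2).
    { unfold eta; apply (Rmult_lt_reg_r (Ev + 1)); [lra|].
      replace (Ev * (eps / 2 / (Ev + 1)) * (Ev + 1)) with (Ev * (eps / 2)) by (field; lra).
      nra. }
    rewrite Cmod_minus_sym in HN1.
    pose proof (Cmod_triangle3 (f (psi z)) (Csum (fun n => a n * tau s z ^ n)%C N) (fn l z)).
    lra. }
  rewrite Hcomp; split; [now apply H2_fn|].
  rewrite !ip_norm_coef, (taylor_coeff_fn w hw) by trivial; fold a.
  rewrite <- sqrt_mult by (try (now apply nrm2_nonneg); lra).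
  apply sqrt_le_1_alt; pose proof (nrm2_nonneg w a Hfl); nra.
Qed.

Lemma rotation_bounded (c : C) (psi : disk -> disk) : Cmod c = 1 ->
  (forall z : disk, (psi z : C) = (c * z)%C) -> bounded_composition psi.
Proof.
  intros Hc Hpsi; exists 1; split; [lra|]; intros f Hf.
  destruct (H2_coef w f Hf) as [Hfe Hfl].
  set (a := taylor_coeff f) in *.
  assert (He : disk_expansion (composition_operator psi f) (fun k => a k * c ^ k)%C).
  { apply disk_expansion_cser; intros z.
    pose proof (proj1 (disk_expansion_cser f a) Hfe (psi z)) as H.
    eapply cser_ext; [|exact H]; intros k; simpl.
    rewrite Hpsi, Cpow_mult_l; ring. }
  assert (Hterm : forall k, Cmod (a k * c ^ k) ^ 2 * beta w k ^ 2 = Cmod (a k) ^ 2 * beta w k ^ 2)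
    by (intros k; rewrite Cmod_mult, Cmod_pow, Hc, pow1, Rmult_1_r; reflexivity).
  split.
  - exists (fun k => a k * c ^ k)%C; split; trivial.
    eapply ex_series_ext; [|exact Hfl]; intros k; symmetry; apply Hterm.
  - rewrite Rmult_1_l, !ip_norm_coef; fold a; apply Req_le; f_equal.
    apply Series_ext; intros k; rewrite (taylor_coeff_eq _ _ He); apply Hterm.
Qed.

Lemma bounded_composition_comp (psi1 psi2 : disk -> disk) :
  bounded_composition psi1 -> bounded_composition psi2 ->
  bounded_composition (fun z => psi1 (psi2 z)).
Proof.
  intros [B1 [HB1 H1]] [B2 [HB2 H2']]; exists (B2 * B1); split; [now apply Rmult_le_pos|].
  intros f Hf; destruct (H1 f Hf) as [Hf1 Hn1]; destruct (H2' _ Hf1) as [Hf2 Hn2].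
  split; [exact Hf2|].
  eapply Rle_trans; [exact Hn2|]; rewrite Rmult_assoc; now apply Rmult_le_compat_l.
Qed.

End Moebius_bounded.

(** * Adjoints and rigidity of automorphisms *)

Section Adjoint.

Variable w : nat -> R.
Hypothesis hw : Hardy_weight w.

Definition monomial (k : nat) : disk -> C :=
  fn (fun j => if (j =? k)%nat then RtoC 1 else RtoC 0).

Lemma monomial_l2 (k : nat) : l2 w (fun j => if (j =? k)%nat then RtoC 1 else RtoC 0).
Proof.
  apply (l2_finite w _ (S k)); intros j Hj; destruct (Nat.eqb_spec j k); [lia|trivial].
Qed.

Lemma monomial_H2 (k : nat) : H2 w (monomial k).
Proof. apply H2_fn; trivial; apply monomial_l2. Qed.

Fixpoint partial_sum (a : nat -> C) (n : nat) : disk -> C :=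
  match n with
  | O => zero
  | S n => plus (partial_sum a n) (scal (a n) (monomial n))
  end.

Lemma partial_sum_H2 (a : nat -> C) (n : nat) : H2 w (partial_sum a n).
Proof.
  induction n as [|n IH]; simpl; [apply H2_zero|].
  apply H2_plus; trivial; apply H2_scal, monomial_H2.
Qed.

Lemma coef_zero (k : nat) : taylor_coeff zero k = 0.
Proof.
  apply (taylor_coeff_eq zero (fun _ => RtoC 0)), disk_expansion_cser; intros z.
  apply cser_zero; intros j; ring.
Qed.

Lemma partial_sum_coef (a : nat -> C) (n k : nat) :
  taylor_coeff (partial_sum a n) k = if (k <? n)%nat then a k else 0.
Proof.
  induction n as [|n IH]; [apply coef_zero|]; simpl partial_sum.
  pose proof (partial_sum_H2 a n) as Hp; pose proof (monomial_H2 n) as Hm.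
  pose proof (H2_scal w (a n) _ Hm) as Hs.
  rewrite (coef_plus w), (coef_scal w), IH by assumption.
  unfold monomial; rewrite (taylor_coeff_fn w hw) by apply monomial_l2.
  destruct (Nat.ltb_spec k n), (Nat.ltb_spec k (S n)), (Nat.eqb_spec k n); try lia;
    subst; ring.
Qed.

Lemma ip_zero_l (y : disk -> C) : H2_ip w zero y = 0.
Proof.
  apply cser_C_Series.
  apply cser_zero; intros j; rewrite coef_zero; ring.
Qed.

Lemma scal_zero_l (x : disk -> C) : scal (RtoC 0) x = zero.
Proof.
  apply functional_extensionality; intros z; change (0 * x z = 0)%C; ring.
Qed.

Lemma linear_zero (T : (disk -> C) -> disk -> C) :
  (forall (c : C) x, H2 w x -> T (scal c x) = scal c (T x)) -> T zero = zero.
Proof.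
  intros H; transitivity (scal (RtoC 0) (T zero)); [|apply scal_zero_l].
  rewrite <- H by apply H2_zero; f_equal; symmetry; apply scal_zero_l.
Qed.

(** Riesz representation in the orthogonal basis of monomials: the coefficients of the adjoint are
    read off from monomials, and the adjoint relation extends from partial sums to all of [H2] by
    continuity. *)
Lemma adjoint_exists (T : (disk -> C) -> disk -> C) :
  bounded_operator (H2 w) (H2_ip w) T -> exists T', is_adjoint (H2 w) (H2_ip w) T T'.
Proof.
  intros [HT [Hadd [Hscal [M0 HM0]]]].
  set (M := Rmax 0 M0).
  assert (HM : 0 <= M) by apply Rmax_l.
  assert (HTM : forall x, H2 w x -> ip_norm (H2_ip w) (T x) <= M * ip_norm (H2_ip w) x).
  { intros x Hx; eapply Rle_trans; [now apply HM0|].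
    apply Rmult_le_compat_r; [apply ip_norm_ge_0|apply Rmax_r]. }
  (* The coefficient forced by pairing with [monomial k], whose squared norm is [beta w k ^ 2]. *)
  set (s := fun y k => (Cconj (H2_ip w (T (monomial k)) y) * RtoC (/ beta w k ^ 2))%C).
  assert (Hb : forall k, 0 < beta w k ^ 2) by (intros k; apply pow_lt, beta_pos, hw).
  assert (Hs : forall y k, H2_ip w (T (monomial k)) y = (Cconj (s y k) * RtoC (beta w k ^ 2))%C).
  { intros y k; unfold s; rewrite Cmult_conj, Cconj_conj, RtoC_conj, <- Cmult_assoc, <- RtoC_mult.
    rewrite Rinv_l by (apply Rgt_not_eq, Hb); ring. }
  assert (Hpart : forall y a n, H2 w y ->
    H2_ip w (T (partial_sum a n)) y =
    Csum (fun k => a k * Cconj (s y k) * RtoC (beta w k ^ 2))%C n).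
  { intros y a n Hy; induction n as [|n IH].
    - transitivity (H2_ip w zero y); [|apply ip_zero_l]; f_equal.
      exact (linear_zero T Hscal).
    - simpl partial_sum.
      pose proof (partial_sum_H2 a n) as Hp; pose proof (monomial_H2 n) as Hm.
      pose proof (H2_scal w (a n) _ Hm) as Hsm.
      pose proof (HT _ Hm) as HTm; pose proof (H2_scal w (a n) _ HTm) as HTs.
      pose proof (HT _ Hp) as HTp.
      rewrite Hadd, Hscal, (ip_plus_l w), (ip_scal_l w), IH, Hs by assumption.
      cbn [Csum]; ring. }
  assert (Hsb : forall y, H2 w y -> forall n, nsq w (s y) n <= (M * ip_norm (H2_ip w) y) ^ 2).
  { intros y Hy n.
    pose proof (ip_norm_ge_0 w y) as Hny.
    (* Testing with the partial sum of [s y] itself turns the pairing into its squared norm, so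
       Cauchy-Schwarz bounds that square by [M * ip_norm (H2_ip w) y] times its root. *)
    assert (E : H2_ip w (T (partial_sum (s y) n)) y = RtoC (nsq w (s y) n)).
    { rewrite Hpart by trivial; clear; induction n as [|n IH]; [reflexivity|].
      cbn [Csum]; rewrite IH, <- Cmod2_conj, <- RtoC_mult, <- RtoC_plus; reflexivity. }
    pose proof (partial_sum_H2 (s y) n) as HP.
    pose proof (ip_Cauchy_Schwarz w _ y (HT _ HP) Hy) as HCS.
    pose proof (nsq_nonneg w (s y) n) as Hn0.
    rewrite E, Cmod_RtoC_nonneg in HCS by trivial.
    assert (Hnorm : ip_norm (H2_ip w) (partial_sum (s y) n) <= sqrt (nsq w (s y) n)).
    { apply (norm_le_of_nsq w); [trivial|apply sqrt_pos|]; intros m.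
      rewrite pow2_sqrt by trivial.
      apply Rle_trans with (nsq w (taylor_coeff (partial_sum (s y) n)) (n + m)).
      - apply Rsum_mono; [apply nsq_term_nonneg|lia].
      - unfold nsq; rewrite Rsum_split, (Rsum_ext _ (fun k => Cmod (s y k) ^ 2 * beta w k ^ 2) n).
        + rewrite (Rsum_ext _ (fun _ => 0 * 0) m), Rsum_scal; [lra|].
          intros k _; rewrite partial_sum_coef, (proj2 (Nat.ltb_ge (n + k) n)) by lia.
          rewrite Cmod_0; ring.
        + intros k Hk; rewrite partial_sum_coef, (proj2 (Nat.ltb_lt k n)) by lia; trivial. }
    assert (Hq : sqrt (nsq w (s y) n) <= M * ip_norm (H2_ip w) y).
    { pose proof (sqrt_pos (nsq w (s y) n)) as Hq0.
      pose proof (pow2_sqrt _ Hn0) as Eq.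
      assert (Hle : sqrt (nsq w (s y) n) * sqrt (nsq w (s y) n) <=
        sqrt (nsq w (s y) n) * (M * ip_norm (H2_ip w) y)).
      { replace (sqrt (nsq w (s y) n) * sqrt (nsq w (s y) n)) with (nsq w (s y) n)
          by (rewrite <- Eq at 1; ring).
        eapply Rle_trans; [exact HCS|].
        replace (sqrt (nsq w (s y) n) * (M * ip_norm (H2_ip w) y))
          with ((M * sqrt (nsq w (s y) n)) * ip_norm (H2_ip w) y) by ring.
        apply Rmult_le_compat_r; trivial.
        eapply Rle_trans; [now apply HTM|]; now apply Rmult_le_compat_l. }
      destruct Hq0 as [Hq0|Hq0].
      - now apply Rmult_le_reg_l in Hle.
      - rewrite <- Hq0; now apply Rmult_le_pos. }
    rewrite <- (pow2_sqrt _ Hn0); apply pow_incr; split; [apply sqrt_pos|trivial]. }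
  assert (Hsl : forall y, H2 w y -> l2 w (s y)) by (intros y Hy; eapply l2_of_bound; now apply Hsb).
  exists (fun y => fn (s y)); split.
  - split; [intros y Hy; now apply H2_fn, Hsl|].
    split; [|split].
    + intros y1 y2 Hy1 Hy2.
      apply (H2_ext w).
      * apply H2_fn; trivial; now apply Hsl, H2_plus.
      * apply H2_plus; now apply H2_fn, Hsl.
      * intros k; rewrite (coef_plus w) by (now apply H2_fn, Hsl).
        rewrite !(taylor_coeff_fn w hw) by (apply Hsl; trivial; now apply H2_plus).
        unfold s; rewrite (ip_plus_r w) by (trivial; apply HT, monomial_H2).
        rewrite Cplus_conj; ring.
    + intros c y Hy.
      apply (H2_ext w).
      * apply H2_fn; trivial; now apply Hsl, H2_scal.
      * apply H2_scal; now apply H2_fn, Hsl.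
      * intros k; rewrite (coef_scal w) by (now apply H2_fn, Hsl).
        rewrite !(taylor_coeff_fn w hw) by (apply Hsl; trivial; now apply H2_scal).
        unfold s; rewrite (ip_scal_r w) by (trivial; apply HT, monomial_H2).
        rewrite Cmult_conj, Cconj_conj; ring.
    + exists M; intros y Hy; apply (norm_le_of_nsq w).
      * now apply H2_fn, Hsl.
      * apply Rmult_le_pos; trivial; apply ip_norm_ge_0.
      * rewrite (taylor_coeff_fn w hw) by (now apply Hsl); now apply Hsb.
  - intros x y Hx Hy.
    destruct (H2_coef w x Hx) as [Hxe Hxl]; set (a := taylor_coeff x) in *.
    pose proof (H2_ip_cser w x (fn (s y)) Hx (H2_fn w hw _ (Hsl y Hy))) as Hcs.
    rewrite (taylor_coeff_fn w hw) in Hcs by now apply Hsl.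
    fold a in Hcs.
    pose proof (ip_norm_ge_0 w y) as Hny.
    set (Ky := M * ip_norm (H2_ip w) y) in *.
    assert (HKy : 0 <= Ky) by (apply Rmult_le_pos; trivial).
    apply Cmod_small_eq; intros eps He.
    destruct (Hcs (eps / 2)) as [N1 HN1]; [lra|].
    set (eta := eps / 2 / (Ky + 1)).
    assert (Heta : 0 < eta) by (repeat apply Rdiv_lt_0_compat; lra).
    destruct (series_tail (fun k => Cmod (a k) ^ 2 * beta w k ^ 2) (eta ^ 2)) as [N2 HN2]; trivial.
    { apply nsq_term_nonneg. }
    { now apply pow_lt. }
    set (n := (N1 + N2)%nat).
    specialize (HN1 n ltac:(lia)).
    rewrite <- Hpart in HN1 by trivial.
    pose proof (partial_sum_H2 a n) as HP.
    assert (Hd : H2 w (minus x (partial_sum a n))) by now apply H2_minus.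
    assert (Hdn : ip_norm (H2_ip w) (minus x (partial_sum a n)) <= eta).
    { apply (norm_le_of_nsq w); [trivial|lra|]; intros m.
      apply Rle_trans with (nsq w (taylor_coeff (minus x (partial_sum a n))) (n + m)).
      - apply Rsum_mono; [apply nsq_term_nonneg|lia].
      - unfold nsq; rewrite Rsum_split, (Rsum_ext _ (fun _ => 0 * 0) n).
        + rewrite Rsum_scal, Rmult_0_l, Rplus_0_l.
          eapply Rle_trans; [|apply (HN2 n m); lia]; apply Req_le, Rsum_ext; intros k _.
          rewrite (coef_minus w), partial_sum_coef, (proj2 (Nat.ltb_ge (n + k) n)) by (trivial; lia).
          do 2 f_equal; fold a; f_equal; ring.
        + intros k Hk; rewrite (coef_minus w), partial_sum_coef, (proj2 (Nat.ltb_lt k n)) by trivial.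
          fold a; replace (a k - a k)%C with (RtoC 0) by ring; rewrite Cmod_0; ring. }
    assert (Ex : x = plus (minus x (partial_sum a n)) (partial_sum a n)).
    { apply functional_extensionality; intros z.
      change (x z = x z + - partial_sum a n z + partial_sum a n z)%C; ring. }
    assert (E1 : H2_ip w (T x) y = (H2_ip w (T (minus x (partial_sum a n))) y +
      H2_ip w (T (partial_sum a n)) y)%C).
    { rewrite Ex at 1; rewrite Hadd by trivial; apply ip_plus_l; auto. }
    assert (H1 : Cmod (H2_ip w (T x) y - H2_ip w (T (partial_sum a n)) y) < eps / 2).
    { rewrite E1.
      replace (H2_ip w (T (minus x (partial_sum a n))) y + H2_ip w (T (partial_sum a n)) y -
        H2_ip w (T (partial_sum a n)) y)%C
        with (H2_ip w (T (minus x (partial_sum a n))) y) by ring.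
      eapply Rle_lt_trans; [apply ip_Cauchy_Schwarz; auto|].
      apply Rle_lt_trans with (eta * Ky).
      - unfold Ky; apply Rle_trans with
          ((M * ip_norm (H2_ip w) (minus x (partial_sum a n))) * ip_norm (H2_ip w) y).
        + apply Rmult_le_compat_r; auto.
        + replace (eta * (M * ip_norm (H2_ip w) y)) with ((M * eta) * ip_norm (H2_ip w) y) by ring.
          apply Rmult_le_compat_r; trivial; now apply Rmult_le_compat_l.
      - unfold eta; apply (Rmult_lt_reg_r (Ky + 1)); [lra|].
        replace (eps / 2 / (Ky + 1) * Ky * (Ky + 1)) with (Ky * (eps / 2)) by (field; lra).
        nra. }
    pose proof (Cmod_triangle3 (H2_ip w (T x) y) (H2_ip w (T (partial_sum a n)) y)
      (H2_ip w x (fn (s y)))).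
    lra.
Qed.

Lemma composition_bounded_operator (psi : disk -> disk) :
  bounded_composition w psi -> bounded_operator (H2 w) (H2_ip w) (composition_operator psi).
Proof.
  intros [B [HB H]]; split; [intros f Hf; now apply H|].
  split; [reflexivity|split; [reflexivity|]].
  exists B; intros f Hf; now apply H.
Qed.

Lemma invertible_composition_Fredholm (psi chi : disk -> disk) :
  bounded_composition w psi -> bounded_composition w chi ->
  (forall z, chi (psi z) = z) -> (forall z, psi (chi z) = z) ->
  Fredholm (H2 w) (H2_ip w) (composition_operator psi).
Proof.
  intros Hpsi [B [HB Hchi]] Hl Hr.
  pose proof (composition_bounded_operator psi Hpsi) as HT.
  assert (Hsurj : forall y, H2 w y -> exists x, H2 w x /\ composition_operator psi x = y).
  { intros y Hy; exists (composition_operator chi y); split; [now apply Hchi|].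
    apply functional_extensionality; intros z; unfold composition_operator; now rewrite Hl. }
  (* A spanning family is never empty, so a trivial kernel is spanned by [zero], which must be shown
     to belong to it. *)
  assert (Hfin : forall E : (disk -> C) -> Prop, E zero -> (forall x, E x -> x = zero) ->
    finite_dimensional E).
  { intros E HE0 HE; exists O, (fun _ => zero); split; [trivial|].
    intros x Hx; exists (fun _ => RtoC 0); rewrite (HE x Hx), sum_O.
    symmetry; apply scal_zero_l. }
  split; [exact HT|split; [|split]].
  - intros y Hy _; now apply Hsurj.
  - apply Hfin.
    + split; [apply H2_zero|reflexivity].
    + intros x [_ Hx]; apply functional_extensionality; intros z.
      rewrite <- (Hr z); exact (f_equal (fun f => f (chi z)) Hx).
  - destruct (adjoint_exists _ HT) as [T' Hadj]; exists T'; split; trivial.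
    apply Hfin.
    + split; [apply H2_zero|].
      exact (linear_zero T' (proj1 (proj2 (proj2 (proj1 Hadj))))).
    + intros y [Hy Hy0]; apply (ip_self_zero w hw); trivial.
      destruct (Hsurj y Hy) as [x [Hx Ex]].
      rewrite <- Ex at 1; rewrite (proj2 Hadj) by trivial; rewrite Hy0.
      rewrite (ip_conj w) by (trivial; apply H2_zero).
      rewrite ip_zero_l, RtoC_conj; simpl; lra.
Qed.

End Adjoint.

(** * The form of the automorphisms *)

Section Automorphism_rigidity.

Variable phi : C -> C.
Hypothesis hphi : forall z, Cmod z <= 1 -> analytic_at phi z.
Hypothesis hclosed : forall z, Cmod z <= 1 -> Cmod (phi z) <= 1.
Hypothesis hauto : disk_automorphism phi.

Lemma automorphism_not_locally_constant (z0 : C) : Cmod z0 < 1 ->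
  forall d, 0 < d -> exists z, Cmod (z - z0) < d /\ phi z <> phi z0.
Proof.
  intros Hz0 d Hd.
  set (e := Rmin d (1 - Cmod z0) / 2).
  assert (He : 0 < e) by (apply Rdiv_lt_0_compat; [apply Rmin_pos|]; lra).
  pose proof (Rmin_l d (1 - Cmod z0)); pose proof (Rmin_r d (1 - Cmod z0)).
  assert (He2 : Cmod (RtoC e) = e) by (apply Cmod_RtoC_nonneg; lra).
  exists (z0 + e)%C; split.
  - replace (z0 + e - z0)%C with (RtoC e) by ring; rewrite He2; unfold e in *; lra.
  - intros E; destruct hauto as [_ [_ [Hinj _]]].
    apply Hinj in E; trivial.
    + assert (E0 : RtoC e = 0) by (replace (RtoC e) with ((z0 + e) - z0)%C by ring; rewrite E; ring).
      apply RtoC_inj in E0; lra.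
    + eapply Rle_lt_trans; [apply Cmod_triangle|]; rewrite He2; unfold e in *; lra.
Qed.

(** If [phi zeta] were inside the disk, it would equal [phi z0] for some [z0] inside. Points of the
    disk close to [zeta] would have values near [phi z0], and by the open mapping theorem these
    values are also taken near [z0], against injectivity. *)
Lemma automorphism_unimodular (zeta : C) : Cmod zeta = 1 -> Cmod (phi zeta) = 1.
Proof.
  intros Hzeta; destruct (hclosed zeta ltac:(lra)) as [Hlt|]; [exfalso|trivial].
  destruct hauto as [_ [_ [Hinj Hsurj]]].
  destruct (Hsurj _ Hlt) as [z0 [Hz0 E0]].
  set (r := Cmod (zeta - z0)).
  assert (Hr : 0 < r) by (pose proof (Cmod_rev_triangle zeta z0); unfold r; lra).
  destruct (open_mapping phi z0 (1 - Cmod z0) (Rmin (r / 2) (1 - Cmod z0)))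
    as [d [Hd Hopen]].
  - lra.
  - apply Rmin_pos; lra.
  - intros z Hz; apply hphi; pose proof (Cmod_rev_triangle z z0); lra.
  - now apply automorphism_not_locally_constant.
  - destruct (analytic_at_continuous phi zeta d (hphi zeta ltac:(lra)) Hd) as [d' [Hd' Hc]].
    set (t := Rmin (d' / 2) (Rmin (r / 2) (1 / 2))).
    assert (Ht : 0 < t) by (unfold t; repeat apply Rmin_pos; lra).
    assert (Ht1 : t <= d' / 2) by apply Rmin_l.
    assert (Ht2 : t <= r / 2) by (unfold t; eapply Rle_trans; [apply Rmin_r|apply Rmin_l]).
    assert (Ht3 : t <= 1 / 2) by (unfold t; eapply Rle_trans; [apply Rmin_r|apply Rmin_r]).
    set (z := (RtoC (1 - t) * zeta)%C).
    assert (Hz1 : Cmod z = 1 - t) by (apply Cmod_scal_unit; lra).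
    assert (Hzz : Cmod (z - zeta) = t).
    { unfold z; replace (RtoC (1 - t) * zeta - zeta)%C with (RtoC (- t) * zeta)%C
        by (rewrite RtoC_minus, RtoC_opp; ring).
      rewrite Cmod_mult, Hzeta, Cmod_R, Rabs_Ropp, Rabs_pos_eq; lra. }
    destruct (Hopen (phi z)) as [z' [Hz' Ez']].
    { rewrite E0; apply Hc; lra. }
    pose proof (Rmin_l (r / 2) (1 - Cmod z0)); pose proof (Rmin_r (r / 2) (1 - Cmod z0)).
    apply Hinj in Ez'.
    + rewrite Ez' in Hz'.
      pose proof (Cmod_triangle3 zeta z z0) as Htri.
      rewrite (Cmod_minus_sym zeta z) in Htri; fold r in Htri; lra.
    + pose proof (Cmod_rev_triangle z' z0); lra.
    + lra.
Qed.

Lemma root_of_unity (m : nat) : (2 <= m)%nat ->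
  exists om : C, (om ^ m)%C = 1 /\ om <> 1 /\ Cmod om = 1.
Proof.
  intros Hm; apply le_INR in Hm; simpl in Hm.
  exists (cos (2 * (PI / INR m)), sin (2 * (PI / INR m))).
  split; [|split; [|apply Cmod_cos_sin]].
  - rewrite Cpow_cos_sin; replace (INR m * (2 * (PI / INR m))) with (2 * PI) by (field; lra).
    rewrite cos_2PI, sin_2PI; reflexivity.
  - intros E; apply (f_equal Re) in E; simpl in E.
    rewrite cos_2a_sin in E.
    assert (0 < sin (PI / INR m)); [|nra].
    pose proof PI_RGT_0.
    apply sin_gt_0; [apply Rdiv_lt_0_compat; lra|].
    apply (Rmult_lt_reg_r (INR m)); [lra|].
    unfold Rdiv; rewrite Rmult_assoc, Rinv_l by lra; nra.
Qed.

(* Dividing [phi] by the [m]-th power of the Blaschke factor at its zero [a]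
   leaves a zero-free function of modulus one on the circle, hence a constant. *)
Lemma automorphism_is_blaschke_power (a : C) : Cmod a < 1 -> phi a = 0 ->
  exists (m : nat) (c : C), (1 <= m)%nat /\ Cmod c = 1 /\
    forall z, Cmod z < 1 -> phi z = (c * ((z - a) / (1 - Cconj a * z)) ^ m)%C.
Proof.
  intros Ha E0.
  destruct hauto as [_ [_ [Hinj _]]].
  pose proof (hphi a ltac:(lra)) as Hphia.
  apply analytic_at_expands in Hphia; destruct Hphia as [b [r [Hr Hb]]].
  assert (Hb0 : b O = 0) by (rewrite <- (expands_value phi a b r Hr Hb); exact E0).
  assert (Hex : exists k, (1 <= k)%nat /\ b k <> 0).
  { apply NNPP; intros Hno.
    destruct (automorphism_not_locally_constant a Ha r Hr) as [z [Hz Hne]]; apply Hne.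
    pose proof (Hb _ Hz) as Hs; replace (a + (z - a))%C with z in Hs by ring.
    rewrite E0; apply (cser_unique _ _ _ Hs).
    apply cser_zero; intros k; replace (b k) with (RtoC 0); [ring|].
    destruct k as [|k]; [auto|].
    symmetry; apply NNPP; intros Hk; apply Hno; exists (S k); split; [lia|trivial]. }
  destruct Hex as [k [Hk Hbk]].
  destruct (first_nonzero b k Hbk Hk) as [m [Hm [Hbm Hj]]].
  assert (Hsum0 : forall h, Csum (fun k => b k * h ^ k)%C m = 0).
  { intros h; rewrite (Csum_ext _ (fun _ => RtoC 0)); [apply Csum_zero|].
    intros [|j] Hjm; [rewrite Hb0; ring|rewrite Hj by lia; ring]. }
  (* The quotient of [phi] by [(z - a) ^ m], its removable singularity filled by the leading
     coefficient. *)
  set (q := fun z => if excluded_middle_informative (z = a) then b m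
    else (phi z * / (z - a) ^ m)%C).
  set (g := fun z => (q z * (1 - Cconj a * z) ^ m)%C).
  assert (Hza : forall z, z <> a -> (z - a)%C <> 0) by (intros z; apply Cminus_eq_contra).
  assert (Hq : forall z, Cmod z <= 1 -> analytic_at q z).
  { intros z Hz; destruct (classic (z = a)) as [->|Hne].
    - apply analytic_at_expands; exists (fun k => b (m + k)%nat), r; split; trivial.
      intros h Hh; unfold q; destruct (excluded_middle_informative (a + h = a)%C) as [Eh|Eh].
      + assert (Eh0 : h = 0) by (replace h with ((a + h) - a)%C by ring; rewrite Eh; ring).
        replace (b m) with (Csum (fun k => b (m + k)%nat * h ^ k)%C 1)
          by (simpl; rewrite Nat.add_0_r; ring).
        apply cser_finite; intros [|j] Hj1; [lia|rewrite Eh0; simpl; ring].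
      + pose proof (proj1 (cser_shift _ _ m) (Hb h Hh)) as Hs.
        rewrite Hsum0 in Hs.
        assert (Hh0 : h <> 0) by (intros E; apply Eh; rewrite E; ring).
        replace (phi (a + h)%C * / (a + h - a) ^ m)%C
          with (/ h ^ m * (phi (a + h)%C - 0))%C
          by (replace (a + h - a)%C with h by ring; ring).
        eapply cser_ext; [|exact (cser_scal (/ h ^ m)%C _ _ Hs)]; intros j; simpl.
        rewrite Cpow_add_r; field; now apply Cpow_nz.
    - apply (analytic_at_ext (fun z => phi z * / (z - a) ^ m)%C _ _ (Cmod (z - a))).
      + apply Cmod_gt_0, Hza, Hne.
      + intros z' Hz'; unfold q; destruct (excluded_middle_informative (z' = a)) as [E|]; trivial.
        rewrite E, Cmod_minus_sym in Hz'; lra.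
      + apply analytic_at_mult; [now apply hphi|].
        apply (analytic_at_inv (fun z => (z - a) ^ m)%C); [|now apply Cpow_nz, Hza].
        apply (analytic_at_pow (fun z => z - a)%C), analytic_at_minus;
          [apply analytic_at_id|apply analytic_at_const]. }
  assert (Hphinz : forall z, Cmod z <= 1 -> z <> a -> phi z <> 0).
  { intros z [Hz|Hz] Hne E.
    - apply Hne, Hinj; trivial; now rewrite E0.
    - pose proof (automorphism_unimodular z Hz) as H1; rewrite E, Cmod_0 in H1; lra. }
  destruct (unimodular_constant g) as [Hg0 Hgc].
  - intros z Hz; apply (analytic_at_mult q (fun z => (1 - Cconj a * z) ^ m)%C); [now apply Hq|].
    apply (analytic_at_pow (fun z => 1 - Cconj a * z)%C), analytic_at_minus;
      [apply analytic_at_const|apply analytic_at_scal, analytic_at_id].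
  - intros z Hz; unfold g, q; apply Cmult_neq_0; [|now apply Cpow_nz, blaschke_den].
    destruct (excluded_middle_informative (z = a)) as [E|Hne]; trivial.
    apply Cmult_neq_0; [now apply Hphinz|].
    now apply Cinv_nonzero, Cpow_nz, Hza.
  - intros z Hz; unfold g, q.
    destruct (excluded_middle_informative (z = a)) as [E|Hne]; [rewrite E in Hz; lra|].
    replace (phi z * / (z - a) ^ m * (1 - Cconj a * z) ^ m)%C
      with (phi z * / ((z - a) / (1 - Cconj a * z)) ^ m)%C.
    + assert (Hb1 := blaschke_circle a z Ha Hz).
      rewrite Cmod_mult, Cmod_inv, Cmod_pow, Hb1, pow1, automorphism_unimodular; [lra|trivial|].
      apply Cpow_nz; intros E; rewrite E, Cmod_0 in Hb1; lra.
    + pose proof (Cpow_nz _ m (Hza z Hne)).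
      pose proof (Cpow_nz _ m (blaschke_den a z Ha ltac:(lra))).
      unfold Cdiv; rewrite Cpow_mult_l, Cpow_inv by (apply blaschke_den; lra); field; auto.
  - exists m, (g 0); split; [trivial|split; [trivial|]]; intros z Hz.
    pose proof (blaschke_den a z Ha ltac:(lra)) as Hd.
    rewrite <- (Hgc z Hz); unfold g, q.
    unfold Cdiv; rewrite Cpow_mult_l, Cpow_inv by trivial.
    pose proof (Cpow_nz _ m Hd) as Hdm.
    destruct (excluded_middle_informative (z = a)) as [E|Hne].
    + rewrite E, E0; destruct m as [|m']; [lia|].
      rewrite E in Hdm; rewrite (Cpow_S (a - a)).
      replace (a - a)%C with (RtoC 0) by ring; ring.
    + pose proof (Cpow_nz _ m (Hza z Hne)); field; auto.
Qed.

(** For [m >= 2] the points with Blaschke values [/ 2] and [/ 2 * om], where [om ^ m = 1], would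
    have the same image; so [m = 1]. The argument of the zero [a] is moved into the two rotations,
    which leaves the real parameter [s = Cmod a]. *)
Lemma automorphism_is_moebius : exists (s : R) (c1 c2 : C),
  0 <= s < 1 /\ Cmod c1 = 1 /\ Cmod c2 = 1 /\
  forall z, Cmod z < 1 -> phi z = (c1 * tau s (c2 * z))%C.
Proof.
  destruct hauto as [_ [_ [Hinj Hsurj]]].
  destruct (Hsurj 0 ltac:(rewrite Cmod_0; lra)) as [a [Ha Ea]].
  destruct (automorphism_is_blaschke_power a Ha Ea) as [m [c [Hm [Hc Hphi]]]].
  assert (Hm1 : m = 1%nat).
  { destruct (Nat.eq_dec m 1) as [|Hne]; trivial; exfalso.
    destruct (root_of_unity m ltac:(lia)) as [om [Hom [Hom1 Homm]]].
    (* The inverse of the Blaschke factor at [a]. *)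
    set (B := fun v => ((v + a) / (1 + Cconj a * v))%C).
    assert (Hden : forall v, Cmod v < 1 -> (1 + Cconj a * v)%C <> 0).
    { intros v Hv; apply one_plus_nonzero; rewrite Cmod_mult, Cmod_conj.
      pose proof (Cmod_ge_0 a); pose proof (Cmod_ge_0 v); nra. }
    assert (HB1 : forall v, Cmod v < 1 -> Cmod (B v) < 1).
    { intros v Hv.
      pose proof (blaschke_lt_1 (- a) v ltac:(now rewrite Cmod_opp) Hv) as Hb.
      unfold B; rewrite Copp_conj in Hb.
      replace (v - - a)%C with (v + a)%C in Hb by ring.
      replace (1 - - Cconj a * v)%C with (1 + Cconj a * v)%C in Hb by ring.
      exact Hb. }
    assert (Haa : (1 - a * Cconj a)%C <> 0).
    { rewrite <- Cmod2_conj, <- RtoC_minus; intros E; apply RtoC_inj in E.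
      pose proof (Cmod_ge_0 a); nra. }
    assert (HB2 : forall v, Cmod v < 1 -> ((B v - a) / (1 - Cconj a * B v))%C = v).
    { intros v Hv; specialize (Hden v Hv); unfold B; field; split; trivial.
      replace (1 + Cconj a * v - Cconj a * (v + a))%C with (1 - a * Cconj a)%C by ring; trivial. }
    assert (Hh : Cmod (/ 2) = / 2).
    { rewrite Cmod_inv, Cmod_RtoC_nonneg; [trivial|lra|]; intros E; apply RtoC_inj in E; lra. }
    assert (Hv1 : Cmod (/ 2) < 1) by lra.
    assert (Hv2 : Cmod (/ 2 * om) < 1) by (rewrite Cmod_mult, Hh, Homm; lra).
    assert (Eq : B (/ 2)%C = B (/ 2 * om)%C).
    { apply Hinj; auto.
      rewrite !Hphi, !HB2 by auto; rewrite Cpow_mult_l, Hom; ring. }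
    apply Hom1.
    pose proof (HB2 _ Hv2) as E2; rewrite <- Eq, (HB2 _ Hv1) in E2.
    assert (H20 : RtoC 2 <> 0) by (intros E; apply RtoC_inj in E; lra).
    replace om with (2 * (/ 2 * om))%C by (field; trivial).
    rewrite <- E2; field; trivial. }
  (* The unit part of [a]; for [a = 0] any unit serves. *)
  assert (He : exists e, Cmod e = 1 /\ a = (RtoC (Cmod a) * e)%C).
  { destruct (classic (a = 0)) as [E|E].
    - exists (RtoC 1); rewrite Cmod_1, E, Cmod_0; split; [trivial|ring].
    - assert (Hp : Cmod a <> 0) by (apply Rgt_not_eq, Cmod_gt_0, E).
      assert (HpC : RtoC (Cmod a) <> 0) by (intros E'; apply RtoC_inj in E'; auto).
      exists (a / RtoC (Cmod a))%C; split.
      + rewrite Cmod_div, Cmod_RtoC_nonneg by (trivial; apply Cmod_ge_0); field; trivial.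
      + field; trivial. }
  destruct He as [e [He1 He2]].
  set (s := Cmod a) in *.
  exists s, (- (c * e))%C, (- Cconj e)%C.
  split; [split; [apply Cmod_ge_0|trivial]|].
  split; [rewrite Cmod_opp, Cmod_mult; nra|].
  split; [rewrite Cmod_opp, Cmod_conj; trivial|].
  intros z Hz; rewrite Hphi, Hm1, Cpow_1_r by trivial.
  pose proof (blaschke_den a z Ha ltac:(lra)) as Hd.
  pose proof (unit_mult_conj e He1) as Hee.
  unfold tau; rewrite He2 at 1 2; rewrite He2 in Hd.
  rewrite Cmult_conj, RtoC_conj in *.
  assert (Hd2 : (1 + s * (- Cconj e * z))%C <> 0).
  { replace (1 + s * (- Cconj e * z))%C with (1 - s * Cconj e * z)%C by ring; trivial. }
  replace (z - s * e)%C with (e * Cconj e * z - s * e)%C by (rewrite Hee; ring).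
  field; auto.
Qed.

End Automorphism_rigidity.

(** * Inverses and the converse implication *)

Lemma tau_lt_1 (s : R) (z : C) : 0 <= s < 1 -> Cmod z < 1 -> Cmod (tau s z) < 1.
Proof.
  intros Hs Hz.
  pose proof (blaschke_lt_1 (- RtoC s) z
    ltac:(rewrite Cmod_opp, Cmod_RtoC_nonneg; lra) Hz) as Hb.
  rewrite Copp_conj, RtoC_conj in Hb; unfold tau.
  replace (z - - RtoC s)%C with (z + s)%C in Hb by ring.
  replace (1 - - RtoC s * z)%C with (1 + s * z)%C in Hb by ring.
  exact Hb.
Qed.

(** The inverse of [tau s] has parameter [- s]; writing it as [- tau s (- z)] keeps the parameter in
    [[0, 1)], where [tau_bounded] applies. *)
Lemma tau_inverse (s : R) (z : C) : 0 <= s < 1 -> Cmod z < 1 ->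
  tau s (- tau s (- z)) = z.
Proof.
  intros Hs Hz.
  pose proof (tau_den s (- z) Hs ltac:(rewrite Cmod_opp; lra)) as H1.
  assert (H2 : RtoC (1 - s * s) <> 0) by (intros E; apply RtoC_inj in E; nra).
  rewrite RtoC_minus, RtoC_mult in H2.
  unfold tau; field; split; trivial.
  replace (1 + s * - z + s * - (- z + s))%C with (1 - s * s)%C by ring; trivial.
Qed.

Lemma rotation_lt_1 (c z : C) : Cmod c = 1 -> Cmod z < 1 -> Cmod (c * z) < 1.
Proof. intros Hc Hz; rewrite Cmod_mult, Hc; lra. Qed.

Lemma automorphism_Fredholm (w : nat -> R) (hw : Hardy_weight w)
    (hgrowth : polynomial_growth w) (phi : C -> C)
    (hopen : forall z : C, Cmod z < 1 -> Cmod (phi z) < 1)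
    (s : R) (c1 c2 : C) : 0 <= s < 1 -> Cmod c1 = 1 -> Cmod c2 = 1 ->
  (forall z, Cmod z < 1 -> phi z = (c1 * tau s (c2 * z))%C) ->
  Fredholm (H2 w) (H2_ip w) (composition_operator (disk_restriction phi hopen)).
Proof.
  intros Hs Hc1 Hc2 Hphi.
  set (rot := fun c (Hc : Cmod c = 1) =>
    disk_restriction (fun z => c * z)%C (fun z => rotation_lt_1 c z Hc)).
  set (tau' := disk_restriction (tau s) (fun z => tau_lt_1 s z Hs)).
  assert (Hrot : forall c Hc, bounded_composition w (rot c Hc))
    by (intros c Hc; now apply (rotation_bounded w c)).
  assert (Htau : bounded_composition w tau') by now apply (tau_bounded w hw hgrowth s).
  assert (Hcj : forall c, Cmod c = 1 -> Cmod (- Cconj c) = 1)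
    by (intros c Hc; now rewrite Cmod_opp, Cmod_conj).
  (* The inverse map: the two minus signs of [tau_inverse] are absorbed into the rotations by
     [- Cconj c1] and [- Cconj c2]. *)
  set (chi := fun z => rot _ (Hcj c2 Hc2) (tau' (rot _ (Hcj c1 Hc1) z))).
  set (psi := disk_restriction phi hopen).
  assert (Epsi : psi = fun z => rot c1 Hc1 (tau' (rot c2 Hc2 z))).
  { apply functional_extensionality; intros [z Hz]; apply disk_val_inj; simpl; now apply Hphi. }
  assert (Hright : forall z, psi (chi z) = z).
  { intros [z Hz]; rewrite Epsi; apply disk_val_inj; simpl.
    pose proof (unit_mult_conj c1 Hc1) as E1; pose proof (unit_mult_conj c2 Hc2) as E2.
    replace (c2 * (- Cconj c2 * tau s (- Cconj c1 * z)))%C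
      with (- tau s (- (Cconj c1 * z)))%C.
    - rewrite tau_inverse by (trivial; rewrite Cmod_mult, Cmod_conj, Hc1; lra).
      rewrite Cmult_assoc, E1; ring.
    - replace (- Cconj c1 * z)%C with (- (Cconj c1 * z))%C by ring.
      replace (c2 * (- Cconj c2 * tau s (- (Cconj c1 * z))))%C
        with (- (c2 * Cconj c2) * tau s (- (Cconj c1 * z)))%C by ring.
      rewrite E2; ring. }
  assert (Hleft : forall z, chi (psi z) = z).
  { intros [z Hz]; rewrite Epsi; apply disk_val_inj; simpl.
    pose proof (unit_mult_conj c1 Hc1) as E1; pose proof (unit_mult_conj c2 Hc2) as E2.
    replace (- Cconj c1 * (c1 * tau s (c2 * z)))%C with (- tau s (c2 * z))%C.
    - replace (tau s (c2 * z)) with (tau s (- - (c2 * z))) by (f_equal; ring).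
      rewrite tau_inverse by (trivial; rewrite Cmod_opp, Cmod_mult, Hc2; lra).
      replace (- Cconj c2 * - (c2 * z))%C with (c2 * Cconj c2 * z)%C by ring.
      rewrite E2; ring.
    - replace (- Cconj c1 * (c1 * tau s (c2 * z)))%C
        with (- (c1 * Cconj c1) * tau s (c2 * z))%C by ring.
      rewrite E1; ring. }
  apply (invertible_composition_Fredholm w hw psi chi); trivial.
  - rewrite Epsi; apply (bounded_composition_comp w (rot c1 Hc1)); trivial.
    now apply (bounded_composition_comp w tau').
  - apply (bounded_composition_comp w (rot _ (Hcj c2 Hc2))); trivial.
    now apply (bounded_composition_comp w tau').
Qed.

Theorem theorem4p5 (w : nat -> R) (hw : Hardy_weight w)
    (hgrowth : polynomial_growth w)
    (phi : C -> C) (hanalytic : analytic_on_closed_disk phi)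
    (hclosed : forall z : C, Cmod z <= 1 -> Cmod (phi z) <= 1)
    (hopen : forall z : C, Cmod z < 1 -> Cmod (phi z) < 1) :
  Fredholm (H2 w) (H2_ip w) (composition_operator (disk_restriction phi hopen)) <->
  disk_automorphism phi.
Proof.
  split; intros H.
  - exact (fredholm_automorphism w hw hgrowth phi hanalytic hclosed hopen H).
  - destruct (automorphism_is_moebius phi (phi_analytic phi hanalytic) hclosed H)
      as [s [c1 [c2 [Hs [Hc1 [Hc2 Hphi]]]]]].
    exact (automorphism_Fredholm w hw hgrowth phi hopen s c1 c2 Hs Hc1 Hc2 Hphi).
Qed.
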